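(* The spectrum of the truncated Fourier–Plancherel operator $\mathscr{F}_{\mathbb{R}^{+}}$ on $L^2(\mathbb{R}^{+})$ is the segment $$\sigma(\mathscr{F}_{\mathbb{R}^{+}})=\Big[-e^{i\pi/4}\tfrac{1}{\sqrt2},\,e^{i\pi/4}\tfrac{1}{\sqrt2}\Big]=\{(1-\tau)(-e^{i\pi/4}/\sqrt2)+\tau e^{i\pi/4}/\sqrt2:\tau\in[0,1]\}.$$
   Context: $\mathbb{R}^{+}=(0,\infty)$. The truncated Fourier–Plancherel operator is $\mathscr{F}_{\mathbb{R}^{+}}=P_{\mathbb{R}^{+}}\mathscr{F}|_{L^2(\mathbb{R}^{+})}$, where $\mathscr{F}$ is the unitary Fourier–Plancherel operator on $L^2(\mathbb{R})$, $(\mathscr{F}x)(t)=\frac{1}{\sqrt{2\pi}}\int_{\mathbb{R}}x(\xi)e^{it\xi}d\xi$, $L^2(\mathbb{R}^{+})$ is identified with the functions in $L^2(\mathbb{R})$ vanishing on $(-\infty,0]$, and $P_{\mathbb{R}^{+}}$ is multiplication by the indicator of $\mathbb{R}^{+}$. For integrable $x$, $(\mathscr{F}_{\mathbb{R}^{+}}x)(t)=\frac{1}{\sqrt{2\pi}}\int_{\mathbb{R}^{+}}x(\xi)e^{it\xi}d\xi$, $t>0$. *)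

(* Defs.v *)
From HB Require Import structures.
From mathcomp Require Import all_boot all_order all_algebra.
From mathcomp Require Import all_classical all_reals.
From mathcomp Require Import ereal topology normedtype sequences trigo measure
  lebesgue_measure lebesgue_integral.
From mathcomp Require Import complex.

Set Implicit Arguments.
Unset Strict Implicit.
Unset Printing Implicit Defensive.

Import Order.TTheory GRing.Theory Num.Theory.
Import numFieldNormedType.Exports.
Local Open Scope classical_set_scope.
Local Open Scope ring_scope.

Section FourierPlancherel.
Variable R : realType.

Local Notation mu := (@lebesgue_measure R).

Definition expi (theta : R) : R[i] := Complex (cos theta) (sin theta).

Definition cintegral (D : set R) (f : R -> R[i]) : R[i] :=
  Complex (Rintegral mu D (fun s : R => complex.Re (f s))) (Rintegral mu D (fun s : R => complex.Im (f s))).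

Definition csqnorm (z : R[i]) : R := (complex.Re z) ^+ 2 + (complex.Im z) ^+ 2.

Definition L2pos (f : R -> R[i]) : Prop :=
  [/\ measurable_fun setT (fun t : R => complex.Re (f t)),
      measurable_fun setT (fun t : R => complex.Im (f t)),
      (forall t, t <= 0 -> f t = 0) &
      (\int[mu]_t (csqnorm (f t))%:E < +oo)%E].

Definition dist2 (f g : R -> R[i]) : \bar R :=
  (\int[mu]_t (csqnorm (f t - g t))%:E)%E.

Definition FP_trunc (x : R -> R[i]) (N : R) (t : R) : R[i] :=
  if 0 < t then
    ((Num.sqrt (2 * pi))^-1)%:C%C * cintegral `[0, N] (fun xi => x xi * expi (t * xi))
  else 0.

(* graph of the truncated Fourier--Plancherel operator on L^2(R^+):
   F_{R^+} x = y, where F x is the L^2-limit (Plancherel) of the Fourier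
   integrals over [-N, N] = [0, N] (x vanishes on the negative half-line). *)
Definition FP_pos_graph (x y : R -> R[i]) : Prop :=
  [/\ L2pos x, L2pos y &
      (fun n : nat => dist2 (FP_trunc x n%:R) y) @ \oo --> (0 : \bar R)].

(* lambda is in the resolvent set: F_{R^+} - lambda I is a bijection of
   L^2(R^+) (functions identified a.e.); by the bounded inverse theorem the
   inverse is then automatically bounded. *)
Definition FP_pos_resolvent (lambda : R[i]) : Prop :=
  (forall y, L2pos y -> exists x z,
      [/\ L2pos x, FP_pos_graph x z &
          dist2 (fun t => z t - lambda * x t) y = 0%E]) /\
  (forall x z, L2pos x -> FP_pos_graph x z ->
      dist2 (fun t => z t - lambda * x t) (fun=> 0) = 0%E ->
      dist2 x (fun=> 0) = 0%E).

Definition FP_pos_spectrum : set R[i] := [set lambda | ~ FP_pos_resolvent lambda].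

End FourierPlancherel.

(* Main.v *)
(* Write F for the truncated operator. Abel summation gives F^2 = (i/2) T with T the Carleman
   operator with kernel 1/(pi (s + t)); T is self-adjoint, bounded by 1 (Schur's test with weight
   t^(-1/2)) and positive (it is the square of the Laplace transform, up to the factor 1/pi).
   Hence (F - l)(F + l) = (i/2)(T - m) with m = - 2 i l^2, and l lies on the segment exactly when
   m lies in [0, 1].
   For m outside [0, 1] the operator (T - conj m)(T - m) is coercive, so F - l is bijective.
   On the segment, the functions s^(-1/2 + i nu), cut off slowly, are approximate eigenfunctions
   x of T for the symbol of T at nu, which takes every value in (0, 1); so u = (F + l) x is
   almost annihilated by F - l. It is not small: otherwise F x would be close to - l x, but the
   dilation by exp(pi/(2 nu)) multiplies x by about i, while F turns it into the inverse dilation,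
   which multiplies by about - i. So F - l is not bounded below, and as F is symmetric for the
   bilinear pairing, a gliding hump shows that F - l is not onto. *)
Require Import Defs.
From HB Require Import structures.
From mathcomp Require Import all_boot all_order all_algebra.
From mathcomp Require Import all_classical all_reals.
From mathcomp Require Import ereal topology normedtype sequences realfun exp trigo derive
  esum numfun measure measurable_realfun lebesgue_measure lebesgue_integral ftc.
From mathcomp Require Import complex.
From mathcomp Require Import ring lra.

Set Implicit Arguments.
Unset Strict Implicit.
Unset Printing Implicit Defensive.

Import Order.TTheory GRing.Theory Num.Theory.
Import numFieldNormedType.Exports.
Local Open Scope classical_set_scope.
Local Open Scope ring_scope.

Local Notation Re := complex.Re.
Local Notation Im := complex.Im.
Local Notation meas := (measurable_fun setT).

(** Neither F nor the kernel of its square is given by an absolutely convergent integral. With the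
    factor [exp (- e t)] inserted every exchange of integrals is absolute, and the integral of
    [exp (i a t)] over [t > 0] becomes [1 / (e - i a)]. For [a = xi - eta] its real part is pi times
    a Poisson kernel, which gives the boundedness of F; for [a = xi + eta] it tends to [i / a], and
    [1/(2 pi)] times this is the kernel of [(i/2) T]. T sees only the square of l: a vector almost
    annihilated by [(F - l)(F + l)] does not tell which factor is responsible. The dilation argument
    decides this, for l and -l alike. It needs a positive nu, so a symbol strictly between 0 and 1;
    the midpoint and the end points of the segment are reached because the set of l without a lower
    bound is closed. Resolvent points are defined by bijectivity, so the failure of a lower bound
    must be turned into a failure of surjectivity. Functions are not identified almost everywhere;
    hence F is treated as a relation, and equations in [L^2] say that a seminorm vanishes. *)

Lemma quad_disc (R : realFieldType) (a b c : R) : 0 <= a -> 0 <= c ->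
  (forall t, 0 <= a + t * (2 * b) + t ^+ 2 * c) -> b ^+ 2 <= a * c.
Proof.
move=> a0 c0 q.
have [c00|cn0] := eqVneq c 0.
  have [b0|bn0] := eqVneq b 0; first by rewrite b0 c00; nra.
  (* For [c = 0] the polynomial is affine, and at this argument it equals -1. *)
  have := q (- (a + 1) / (2 * b)).
  have -> : - (a + 1) / (2 * b) * (2 * b) = - (a + 1) by field.
  rewrite c00; nra.
have := q (- b / c).
have -> : a + - b / c * (2 * b) + (- b / c) ^+ 2 * c = (a * c - b ^+ 2) / c by field.
rewrite pmulr_lge0 ?invr_gt0 ?lt_def ?cn0 ?c0//; lra.
Qed.

(** * Square-integrable real functions *)

Section RealInt.
Context d (T : measurableType d) (R : realType).
Variable mu : {measure set T -> \bar R}.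
Local Notation RI := (Rintegral mu setT).
Implicit Types f g : T -> R.

Definition rint f := mu.-integrable setT (EFin \o f).
Definition sqi f : \bar R := (\int[mu]_x ((f x) ^+ 2)%:E)%E.
Definition L2 f := meas f /\ (sqi f < +oo)%E.

Lemma rint_meas f : rint f -> meas f.
Proof. by move=> /measurable_int /measurable_EFinP. Qed.

Lemma rint_le f g : meas f -> rint g ->
  (forall x, `|f x| <= g x) -> rint f.
Proof.
move=> mf ig fg; apply: le_integrable ig => //; first exact/measurable_EFinP.
by move=> x _ /=; rewrite lee_fin (le_trans (fg x))// ler_norm.
Qed.

Lemma rint_fin f : meas f -> (forall x, 0 <= f x) ->
  (\int[mu]_x (f x)%:E < +oo)%E -> rint f.
Proof.
move=> mf f0 fo; apply/integrableP; split; first exact/measurable_EFinP.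
rewrite (eq_integral (fun x => (f x)%:E))// => x _.
by rewrite /= ger0_norm.
Qed.

Lemma rintD f g : rint f -> rint g -> rint (fun x => f x + g x).
Proof. exact: integrableD. Qed.

Lemma rintB f g : rint f -> rint g -> rint (fun x => f x - g x).
Proof. exact: integrableB. Qed.

Lemma rintZ (c : R) f : rint f -> rint (fun x => c * f x).
Proof. by move=> /(integrableZl measurableT c). Qed.

Lemma rint_norm f : rint f -> rint (fun x => `|f x|).
Proof. exact: integrable_norm. Qed.

Lemma rint0 : rint (fun=> 0).
Proof. exact: integrable0. Qed.

Lemma RI_E f : rint f -> (RI f)%:E = (\int[mu]_x (f x)%:E)%E.
Proof. by move=> i; rewrite /Rintegral fineK//; exact: integrable_fin_num. Qed.

Lemma RI_le_abs f g : rint f -> rint g -> (forall x, `|f x| <= g x) ->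
  `|RI f| <= RI g.
Proof.
move=> ifn ig fg; apply: (le_trans (le_normr_Rintegral measurableT ifn)).
by apply: le_Rintegral => //; exact: rint_norm.
Qed.

Lemma sqi_ge0 f : (0 <= sqi f)%E.
Proof. by apply: integral_ge0 => x _; rewrite lee_fin sqr_ge0. Qed.

Lemma L2_sq f : L2 f -> rint (fun x => f x ^+ 2).
Proof.
move=> [mf fo]; apply: rint_fin => //.
- exact: measurable_funX.
- by move=> x; rewrite sqr_ge0.
Qed.

Lemma L2_mul f g : L2 f -> L2 g -> rint (fun x => f x * g x).
Proof.
move=> Lf Lg; apply: (@rint_le _ (fun x => f x ^+ 2 + g x ^+ 2)).
- by apply: measurable_funM; [case: Lf|case: Lg].
- by apply: rintD; exact: L2_sq.
- move=> x; rewrite ler_norml; apply/andP; split; nra.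
Qed.

Lemma L2_bound f g : meas f -> L2 g ->
  (forall x, f x ^+ 2 <= g x ^+ 2) -> L2 f.
Proof.
move=> mf [mg gf] fg; split=> //; apply: le_lt_trans gf.
apply: ge0_le_integral => //.
- by move=> x _; rewrite lee_fin sqr_ge0.
- by apply/measurable_EFinP; exact: measurable_funX.
- by apply/measurable_EFinP; exact: measurable_funX.
- by move=> x _; rewrite lee_fin.
Qed.

Lemma L2D f g : L2 f -> L2 g -> L2 (fun x => f x + g x).
Proof.
move=> Lf Lg; split; first by apply: measurable_funD; [case: Lf|case: Lg].
apply: (@le_lt_trans _ _ (\int[mu]_x (2 * f x ^+ 2 + 2 * g x ^+ 2)%:E)%E).
  apply: ge0_le_integral => //.
  - by move=> x _; rewrite lee_fin sqr_ge0.
  - by apply/measurable_EFinP/measurable_funX/measurable_funD; [case: Lf|case: Lg].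
  - by apply/measurable_EFinP/rint_meas/rintD; apply/rintZ/L2_sq.
  - by move=> x _; rewrite lee_fin; have := sqr_ge0 (f x - g x); nra.
apply: integrable_lty => //.
by apply: rintD; apply/rintZ/L2_sq.
Qed.

Lemma L2Z (c : R) f : L2 f -> L2 (fun x => c * f x).
Proof.
move=> Lf; split; first by apply: measurable_funM => //; case: Lf.
rewrite /sqi; under eq_integral do rewrite exprMn.
by apply: integrable_lty => //; apply/rintZ/L2_sq.
Qed.

Lemma sqi_RI f : L2 f -> sqi f = (RI (fun x => f x ^+ 2))%:E.
Proof. by move=> Lf; rewrite RI_E//; exact: L2_sq. Qed.

Lemma RI_cauchy_schwarz f g : L2 f -> L2 g ->
  (RI (fun x => f x * g x)) ^+ 2 <=
  RI (fun x => f x ^+ 2) * RI (fun x => g x ^+ 2).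
Proof.
move=> Lf Lg; set a := RI (fun x => f x ^+ 2).
set b := Rintegral _ _ _; set c := Rintegral _ _ _.
have a0 : 0 <= a by apply: Rintegral_ge0 => x _; exact: sqr_ge0.
have c0 : 0 <= c by apply: Rintegral_ge0 => x _; exact: sqr_ge0.
have q t : 0 <= a + t * (2 * b) + t ^+ 2 * c.
  have -> : a + t * (2 * b) + t ^+ 2 * c =
      RI (fun x => (f x + t * g x) ^+ 2).
    rewrite /a /b /c -!RintegralZl ?RintegralZr//; last 3 first.
    - exact: L2_sq.
    - exact/rintZ/L2_mul.
    - exact/L2_mul.
    rewrite -!RintegralD//.
    - by apply: eq_Rintegral => x _; ring.
    - by apply: rintD; [exact: L2_sq|do 2 apply: rintZ; exact: L2_mul].
    - by apply: rintZ; exact: L2_sq.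
    - exact: L2_sq.
    - by do 2 apply: rintZ; exact: L2_mul.
  by apply: Rintegral_ge0 => x _; exact: sqr_ge0.
exact: quad_disc.
Qed.

End RealInt.
Arguments sqi {d T R} mu f%_R.

(** * Fubini's theorem for real-valued integrals *)

Section FubiniR.
Context d1 d2 (T1 : measurableType d1) (T2 : measurableType d2) (R : realType).
Variables (m1 : {sigma_finite_measure set T1 -> \bar R})
  (m2 : {sigma_finite_measure set T2 -> \bar R}).

(** [Rintegral] is the [fine] part of the extended integral. Integrability of every section, and not
    just of almost every one, makes the iterated real integrals agree everywhere with the extended
    ones, to which Fubini applies. *)
Lemma fubiniR (h : T1 * T2 -> R) : meas h ->
  (forall x, rint m2 (fun y => h (x, y))) ->
  (forall y, rint m1 (fun x => h (x, y))) ->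
  (\int[m1]_x \int[m2]_y `|h (x, y)|%:E < +oo)%E ->
  rint m1 (fun x => Rintegral m2 setT (fun y => h (x, y))) /\
      Rintegral m1 setT (fun x => Rintegral m2 setT (fun y => h (x, y))) =
      Rintegral m2 setT (fun y => Rintegral m1 setT (fun x => h (x, y))).
Proof.
move=> mh ih1 ih2 hfin.
have mh' : meas (EFin \o h) by exact/measurable_EFinP.
have ih : (m1 \x m2)%E.-integrable setT (EFin \o h) by apply/integrable12ltyP.
have e1 : EFin \o (fun x => Rintegral m2 setT (fun y => h (x, y))) =
    fubini_F m2 (EFin \o h).
  by apply/funext => x /=; rewrite RI_E.
split.
- by rewrite /rint e1; exact: integrable_fubini_F.
- rewrite /Rintegral; congr fine.
  have := Fubini ih; rewrite /=.
  under eq_integral do rewrite -RI_E//.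
  by move=> ->; apply: eq_integral => y _; rewrite -RI_E.
Qed.

End FubiniR.

(** * Completeness *)

Section Complete.
Context d (T : measurableType d) (R : realType).
Variable mu : {measure set T -> \bar R}.

Lemma sum_half_le2 n : \sum_(0 <= k < n) (2^-1 : R) ^+ k <= 2.
Proof.
suff -> : \sum_(0 <= k < n) (2^-1 : R) ^+ k = 2 - 2 * 2^-1 ^+ n.
  by rewrite gerBl mulr_ge0// exprn_ge0.
elim: n => [|n IH]; first by rewrite big_geq//; ring.
by rewrite big_nat_recr//= IH exprS; field.
Qed.

(** Fatou's lemma for the shifted sequence [h (n + N)], so that a bound on a tail is enough. *)
Lemma sqi_fatou (h : nat -> T -> R) (g : T -> R) (c : \bar R) N :
  (forall n, meas (h n)) ->
  (forall t, h ^~ t @ \oo --> g t) ->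
  (forall n, (N <= n)%N -> (sqi mu (h n) <= c)%E) -> (sqi mu g <= c)%E.
Proof.
move=> mh hg hc.
pose F (n : nat) x : \bar R := ((h (n + N)%N x) ^+ 2)%:E.
have mF n : meas (F n).
  by apply/measurable_EFinP/measurable_funX.
have F0 n x : setT x -> (0 <= F n x)%E by rewrite lee_fin sqr_ge0.
have := fatou mu measurableT mF F0.
under eq_integral.
  move=> x _.
  have FE : F^~ x @ \oo --> ((g x) ^+ 2)%:E.
    apply/cvg_EFin; first by apply: nearW.
    rewrite /F /=; rewrite [X in X @ _](_ : _ = (fun n => (h n x) ^+ 2) \o addn^~ N)//.
    apply: (cvg_comp (addn^~ N)); first exact: cvg_addnr.
    by apply: (cvg_comp _ (fun y : R => y ^+ 2) (hg x)); exact: exprn_continuous.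
  rewrite (cvg_limn_einf_sup FE).1; over.
move=> /le_trans; apply.
rewrite limn_einf_lim; apply: lime_le; first exact: is_cvg_einfs.
apply: nearW => n; apply: (@le_trans _ _ (sqi mu (h (n + N)%N))).
  by apply: ereal_inf_lbound; exists n => //=.
by apply: hc; rewrite leq_addl.
Qed.

Lemma sqi_ae (A : set T) (f g : T -> R) : meas f ->
  meas g ->
  {ae mu, forall x, A x} -> (forall x, A x -> f x = g x) -> sqi mu f = sqi mu g.
Proof.
move=> mf mg aA fg; apply: ge0_ae_eq_integral => //.
- by apply/measurable_EFinP/measurable_funX.
- by apply/measurable_EFinP/measurable_funX.
- by move=> x _; rewrite lee_fin sqr_ge0.
- by move=> x _; rewrite lee_fin sqr_ge0.
- by apply: filterS aA => x Ax _; rewrite fg.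
Qed.

(** Riesz-Fischer for a sequence with geometric rate. The last clause keeps the limit zero wherever
    all terms vanish, so that supports in the half-line survive. *)
Lemma L2_complete (f : nat -> T -> R) :
  (forall n, L2 mu (f n)) ->
  (forall n m, (n <= m)%N ->
     (sqi mu (fun t => f m t - f n t)%R <= ((4^-1) ^+ n)%:E)%E) ->
  exists g, [/\ L2 mu g,
    forall n, (sqi mu (fun t => f n t - g t)%R <= ((4^-1) ^+ n)%:E)%E &
    forall t, (forall n, f n t = 0) -> g t = 0].
Proof.
move=> Lf hf.
have mf n : meas (f n) by case: (Lf n).
(* The weight [2 ^ n] still leaves a summable total, the sum of [2 ^ n * 4 ^ (- n)], and it makes
   the increments absolutely summable wherever [G] is finite. *)
pose e (n : nat) t : \bar R := (2 ^+ n * (f n.+1 t - f n t) ^+ 2)%:E.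
have e0 n t : (0 <= e n t)%E by rewrite lee_fin mulr_ge0 ?sqr_ge0 ?exprn_ge0.
have me n : meas (e n).
  by apply/measurable_EFinP/measurable_funM => //; apply/measurable_funX/measurable_funB.
pose G t : \bar R := (\sum_(0 <= n <oo) e n t)%E.
have mG : meas G.
  by have := @ge0_emeasurable_sum _ _ _ setT e xpredT; apply.
have G0 t : (0 <= G t)%E by apply: nneseries_ge0 => n _ _; exact: e0.
have iG : (\int[mu]_t G t < +oo)%E.
  rewrite integral_nneseries//.
  apply: (@le_lt_trans _ _ (2%:E)); last exact: ltry.
  apply: lime_le; first by apply: is_cvg_nneseries => n _ _; apply: integral_ge0 => *.
  apply: nearW => n.
  apply: (@le_trans _ _ (\sum_(0 <= k < n) ((2^-1 : R) ^+ k)%:E)%E).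
    apply: lee_sum => k _; rewrite /e.
    under eq_integral do rewrite EFinM.
    rewrite ge0_integralZl_EFin//; last 2 first.
    - by move=> x _; rewrite lee_fin sqr_ge0.
    - by apply/measurable_EFinP/measurable_funX/measurable_funB.
    apply: (@le_trans _ _ ((2 ^+ k)%:E * ((4^-1) ^+ k)%:E)%E).
      by apply: lee_wpmul2l; [rewrite lee_fin exprn_ge0|exact: hf].
    by rewrite -EFinM -exprMn lee_fin (_ : 2 * 4^-1 = 2^-1 :> R)//; field.
  rewrite sumEFin lee_fin.
  exact: sum_half_le2.
have Gint : mu.-integrable setT G.
  by apply/integrableP; split=> //; under eq_integral do rewrite gee0_abs//.
pose A := [set t | G t \is a fin_num].
have aA : {ae mu, forall t, A t}.
  by have := integrable_ae measurableT Gint; apply: filterS => t; exact.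
have mA : measurable A by rewrite -[A]setTI; exact: emeasurable_fin_num.
(* Off the full-measure set [A] the sequence is replaced by 0, so that it converges at every point
   and the limit is measurable. *)
pose h n t : R := f n t * \1_A t.
have mh n : meas (h n).
  by apply: measurable_funM => //; exact: measurable_indic.
have hE n t : A t -> h n t = f n t.
  by move=> At; rewrite /h indicE mem_set// mulr1.
have hN t : ~ A t -> h ^~ t = fun=> 0.
  by move=> At; apply/funext => n; rewrite /h indicE memNset// mulr0.
have hcvg t : cvgn (h ^~ t).
  have [At|/hN ->] := pselect (A t); last exact: is_cvg_cst.
  have b0 n : 0 <= 2^-1 * ((2^-1) ^+ n + 2 ^+ n * (f n.+1 t - f n t) ^+ 2).
    apply: mulr_ge0; first by rewrite invr_ge0.
    by apply: addr_ge0; [rewrite exprn_ge0// invr_ge0|rewrite mulr_ge0 ?sqr_ge0 ?exprn_ge0].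
  have c1 : cvgn (series (fun n => 2^-1 * ((2^-1) ^+ n + 2 ^+ n * (f n.+1 t - f n t) ^+ 2)) : nat -> R).
    apply: nondecreasing_is_cvgn.
      apply/nondecreasing_seqP => n; rewrite /series /= big_nat_recr//= lerDl; exact: b0.
    exists (2^-1 * (2 + fine (G t))) => _ [n _ <-].
    rewrite /series /= -mulr_sumr big_split /= ler_wpM2l//.
    apply: lerD.
      exact: sum_half_le2.
    rewrite -lee_fin fineK// -sumEFin.
    by apply: (@nneseries_lim_ge R (e ^~ t) xpredT 0%N n) => k _ _; exact: e0.
  (* Comparison with the series of [c1], by [2 |x| <= 1/p + p x^2] for [p = 2 ^ n]. *)
  have c2 : cvgn (series (fun n => f n.+1 t - f n t)).
    apply: normed_cvg; apply: series_le_cvg c1 => n //=.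
    have p0 : 0 < (2 : R) ^+ n by exact: exprn_gt0.
    rewrite exprVn; set p := 2 ^+ n in p0 *; set x := f n.+1 t - f n t.
    have : 0 <= p^-1 * (p * `|x| - 1) ^+ 2 by rewrite mulr_ge0 ?sqr_ge0// invr_ge0 ltW.
    have -> : p^-1 * (p * `|x| - 1) ^+ 2 = p * `|x| ^+ 2 - 2 * `|x| + p^-1.
      by field; rewrite gt_eqF.
    rewrite real_normK ?num_real//; lra.
  have -> : h^~ t = (fun n => f 0%N t + series (fun n => f n.+1 t - f n t) n).
    apply/funext => n; rewrite hE//; elim: n => [|n IH]; first by rewrite /series /= big_geq// addr0.
    by rewrite /series /= big_nat_recr//= addrA -[X in X + _]IH addrC subrK.
  by apply: is_cvgD => //; exact: is_cvg_cst.
pose g t : R := limn (h ^~ t).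
have hg t : h ^~ t @ \oo --> g t by exact: hcvg.
have mg : meas g by apply: (measurable_fun_cvg mh) => t _.
have key n : (sqi mu (fun t => f n t - g t)%R <= ((4^-1) ^+ n)%:E)%E.
  rewrite (@sqi_ae A _ (fun t => h n t - g t))//; last 3 first.
  - exact: measurable_funB.
  - exact: measurable_funB.
  - by move=> t /hE ->.
  apply: (@sqi_fatou (fun m t => h n t - h m t) _ _ n).
  - by move=> m; exact: measurable_funB.
  - by move=> t; apply: cvgB => //; exact: cvg_cst.
  - move=> m nm; rewrite (@sqi_ae A _ (fun t => f n t - f m t))//; last 3 first.
    + exact: measurable_funB.
    + exact: measurable_funB.
    + by move=> t At; rewrite !hE.
    rewrite /sqi; under eq_integral do rewrite -opprB sqrrN.
    exact: hf.
exists g; split=> //.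
- have -> : g = fun t => f 0%N t + (-1) * (f 0%N t - g t).
    by apply/funext => t; ring.
  apply: L2D => //; apply: L2Z; split; first exact: measurable_funB.
  by apply: (le_lt_trans (key 0%N)); rewrite ltry.
- move=> t ft; rewrite /g.
  have -> : h ^~ t = fun=> 0 by apply/funext => n; rewrite /h ft mul0r.
  exact: lim_cst.
Qed.

End Complete.

(** * Integrals on the line *)

Section RealLine.
Variable R : realType.
Local Notation mu := (@lebesgue_measure R).
Local Notation RI := (Rintegral mu setT).
Implicit Types f F : R -> R.

(** * Change of scale in Lebesgue integrals *)

(** The right-hand side is itself a measure, a multiple of a pushforward; it has the right value on
    half-open intervals, so uniqueness of Lebesgue measure applies. *)
Lemma lebesgue_measure_scale (a : R) (A : set R) : 0 < a -> measurable A ->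
  mu A = (a%:E * mu ((fun x => a * x)%R @^-1` A))%E.
Proof.
move=> a0 mA.
have mphi : meas (fun x : measurableTypeR R => (a * x : measurableTypeR R))
    by exact: measurable_funM.
pose m0 : {measure set (measurableTypeR R) -> \bar R} :=
  mscale (NngNum (ltW a0)) (pushforward mu (fun x : measurableTypeR R => (a * x : measurableTypeR R))).
pose m := m0 mphi.
have -> : (a%:E * mu ((fun x => a * x)%R @^-1` A))%E = m A by [].
apply: lebesgue_measure_unique => // X [[b c] _ <-].
have -> : m `]b, c]%classic = (a%:E * mu ((fun x => a * x)%R @^-1` `]b, c]%classic))%E by [].
have -> : (fun x : R => a * x) @^-1` `]b, c]%classic = `](b / a), (c / a)]%classic.
  apply/seteqP; split=> x /=; rewrite !in_itv/= ltr_pdivrMr// ler_pdivlMr//.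
    by rewrite mulrC.
  by rewrite mulrC.
rewrite !lebesgue_measure_itv/= !lte_fin ltr_pM2r ?invr_gt0//.
case: ifPn => _; last by rewrite mule0.
by rewrite -!EFinB -EFinM; congr EFin; field; rewrite gt_eqF.
Qed.

Lemma ge0_integral_scale (a : R) (f : R -> \bar R) : 0 < a ->
  meas f -> (forall x, (0 <= f x)%E) ->
  (\int[mu]_x f x = a%:E * \int[mu]_x f (a * x)%R)%E.
Proof.
move=> a0 mf f0.
have mphi : meas (fun x : measurableTypeR R => (a * x : measurableTypeR R))
    by exact: measurable_funM.
pose m0 : {measure set (measurableTypeR R) -> \bar R} :=
  mscale (NngNum (ltW a0)) (pushforward mu (fun x : measurableTypeR R => (a * x : measurableTypeR R))).
pose m := m0 mphi.
rewrite (@eq_measure_integral _ _ _ setT m).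
  rewrite ge0_integral_mscale//=; congr (_ * _)%E.
  by rewrite (ge0_integral_pushforward mphi)// preimage_setT.
by move=> A mA _; exact: lebesgue_measure_scale.
Qed.

Lemma rint_scale (a : R) f : 0 < a -> rint mu f -> rint mu (fun x => f (a * x)).
Proof.
move=> a0 /integrableP[mf fo]; have mf' : meas f by exact/measurable_EFinP.
apply/integrableP; split.
  apply/measurable_EFinP; apply: measurableT_comp => //; exact: measurable_funM.
move: fo; rewrite (@ge0_integral_scale a)//; last exact: measurableT_comp.
suff key (J : \bar R) : (a%:E * J < +oo -> J < +oo)%E by exact: key.
by case: J => [r|//|] //; rewrite ?ltry// mulry gtr0_sg// mul1e.
Qed.

(** The formula for nonnegative integrands is applied to [|f| + f] and to [|f|], and the two are
    subtracted. *)
Lemma RI_scale (a : R) f : 0 < a -> rint mu f ->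
  RI f = a * RI (fun x => f (a * x)).
Proof.
move=> a0 fi; have fi' := rint_scale a0 fi; have mf := rint_meas fi.
have mn : meas (fun x => `|f x|) by apply: measurableT_comp.
have i1 : rint mu (fun x => `|f x| + f x) by apply: rintD => //; exact: rint_norm.
have e1 : RI (fun x => `|f x| + f x) =
    a * RI (fun x => `|f (a * x)| + f (a * x)).
  apply: EFin_inj; rewrite EFinM !RI_E//; last by apply: rintD => //; exact: rint_norm.
  apply: (@ge0_integral_scale a (fun x => (`|f x| + f x)%:E)) => //.
  - by apply/measurable_EFinP/measurable_funD.
  - by move=> x; rewrite lee_fin -lerBlDr sub0r -normrN ler_norm.
have e2 : RI (fun x => `|f x|) =
    a * RI (fun x => `|f (a * x)|).
  apply: EFin_inj; rewrite EFinM !RI_E//; [|exact: rint_norm|exact: rint_norm].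
  apply: (@ge0_integral_scale a (fun x => `|f x|%:E)) => //.
  exact/measurable_EFinP.
move: e1; rewrite !RintegralD//; [|exact: rint_norm|exact: rint_norm].
by rewrite mulrDr -e2 => /addrI.
Qed.

Lemma sqi_scale (a : R) f : 0 < a -> meas f ->
  (sqi mu f = a%:E * sqi mu (fun x => f (a * x)%R))%E.
Proof.
move=> a0 mf; rewrite /sqi (@ge0_integral_scale a (fun x => (f x ^+ 2)%:E))//.
- exact/measurable_EFinP/measurable_funX.
- by move=> x; rewrite lee_fin sqr_ge0.
Qed.

Lemma cvg_invn : (n.+1%:R^-1 : R) @[n --> \oo] --> 0^'+.
Proof.
move=> A [e /= e0 eA].
have := near_infty_natSinv_lt (PosNum e0); apply: filterS => n /= ne.
apply: eA => /=; last by rewrite invr_gt0.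
by rewrite /= sub0r normrN ger0_norm// invr_ge0.
Qed.

(** The primitive may be singular at 0, so the fundamental theorem is used on [[1/(n+1), +oo[] and
    the domain exhausted by monotone convergence. Nonnegativity gives integrability at the same
    time. *)
Lemma integral_pos_FTC f F (l F0 : R) :
  (forall x, 0 < x -> 0 <= f x) -> (forall x, 0 < x -> {for x, continuous f}) ->
  (forall x : R, 0 < x -> is_derive x 1 F (f x)) ->
  F x @[x --> +oo] --> l -> F x @[x --> 0^'+] --> F0 ->
  rint mu (fun x => if 0 < x then f x else 0) /\
  RI (fun x => if 0 < x then f x else 0) = l - F0.
Proof.
move=> f0 cf dF Fl FF0.
pose a (n : nat) : R := n.+1%:R^-1.
have a0 n : 0 < a n by rewrite invr_gt0.
have mfo : measurable_fun (`]0, +oo[%classic : set R) f.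
  apply: open_continuous_measurable_fun; first exact: interval_open.
  by move=> x; rewrite inE/= in_itv/= andbT => /cf.
pose E n := `[a n, +oo[%classic : set R.
have EU : \bigcup_n E n = `]0, +oo[%classic.
  apply/seteqP; split=> x /=.
    by move=> [n _]; rewrite /E/= !in_itv/= !andbT => /(lt_le_trans (a0 n)).
  rewrite in_itv/= andbT => x0.
  have [n _ /(_ n)/= an] := near_infty_natSinv_lt (PosNum x0).
  by exists n => //; rewrite /E/= in_itv/= andbT ltW// an.
have key n : (\int[mu]_(x in E n) (f x)%:E = (l - F (a n))%:E)%E.
  rewrite EFinB; apply: ge0_continuous_FTC2y => //.
  - by move=> x ax; rewrite f0// (lt_le_trans (a0 n)).
  - apply: continuous_in_subspaceT => x; rewrite inE/= in_itv/= andbT => ax.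
    by apply: cf; rewrite (lt_le_trans (a0 n)).
  - by move=> x ax; have [] := dF x (lt_trans (a0 n) ax).
  - apply: cvg_at_right_filter; apply: differentiable_continuous.
    by apply/derivable1_diffP; have [] := dF _ (a0 n).
  - move=> x; rewrite in_itv/= andbT => ax.
    by rewrite derive1E; have [_ ->] := dF x (lt_trans (a0 n) ax).
have I0 : (\int[mu]_(x in (`]0%R, +oo[%classic : set R)) (f x)%:E = (l - F0)%:E)%E.
  rewrite -EU; apply: (@cvg_unique _ _ ((fun n => (\int[mu]_(x in E n) (f x)%:E)%E) @ \oo)).
  - exact: ereal_hausdorff.
  - apply: ge0_nondecreasing_set_cvg_integral.
    + move=> m n mn; rewrite subsetEset => x; rewrite /E/= !in_itv/= !andbT.
      by apply: le_trans; rewrite lef_pV2 ?posrE// ler_nat.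
    + by move=> n; exact: measurable_itv.
    + move=> n; apply/measurable_EFinP; apply: measurable_funS mfo => //.
      move=> x; rewrite /E/= !in_itv/= !andbT; exact: lt_le_trans.
    + by move=> n x; rewrite /E/= in_itv/= andbT lee_fin => /(lt_le_trans (a0 n))/f0.
  - rewrite /=; have -> : (fun n => (\int[mu]_(x in E n) (f x)%:E)%E) = fun n => (l - F (a n))%:E.
      by apply/funext => n; exact: key.
    apply: cvg_EFin; first exact: nearW.
    apply: cvgB; first exact: cvg_cst.
    by apply: (cvg_comp _ _ cvg_invn).
have fE : (fun x => if 0 < x then f x else 0) = f \_ `]0, +oo[.
  apply/funext => x; rewrite patchE; case: ifPn => x0; case: ifPn => //.
    by rewrite notin_setE/= in_itv/= x0.
  by rewrite inE/= in_itv/= andbT (negPf x0).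
have e : (\int[mu]_x (if (0 < x)%R then f x else 0%R)%:E = (l - F0)%:E)%E.
  rewrite -I0 [RHS]integral_mkcond; apply: eq_integral => x _.
  by rewrite restrict_EFin -fE.
split; last by rewrite /Rintegral e.
apply: rint_fin.
- rewrite fE; have mI : measurable (`]0, +oo[%classic : set R) by exact: measurable_itv.
  exact/(measurable_restrictT f mI).
- by move=> x; case: ifPn => // /f0.
- by rewrite e ltry.
Qed.


(** * Damped exponential, Poisson and power integrals by explicit primitives *)

Lemma is_derive_cont f (x d : R) : is_derive x 1 f d -> {for x, continuous f}.
Proof.
by move=> [df _]; exact/differentiable_continuous/derivable1_diffP.
Qed.

Lemma cvg_expR_bounded (e M : R) (B : R -> R) : 0 < e ->
  (forall t, `|B t| <= M) -> expR (- (e * t)) * B t @[t --> +oo] --> 0.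
Proof.
move=> e0 BM; have M0 : 0 <= M by exact: le_trans (BM 0).
apply/cvgr0Pnorm_le => d d0; near=> t.
have t0 : M / d / e <= t by near: t; exact/nbhs_pinfty_ge/num_real.
rewrite normrM ger0_norm ?expR_ge0//.
have h : M <= d * (1 + e * t).
  move: t0; rewrite !ler_pdivrMr// => t0.
  apply: (le_trans t0); rewrite [leRHS]mulrC ler_pM2r//; nra.
have h2 : 1 + e * t <= expR (e * t) by exact: expR_ge1Dx.
have E : expR (- (e * t)) * expR (e * t) = 1 by rewrite mulrC expRxMexpNx_1.
have E0 := expR_gt0 (- (e * t)).
apply: (le_trans (ler_wpM2l (ltW E0) (BM t))).
apply: (le_trans (ler_wpM2l (ltW E0) h)).
rewrite [leRHS](_ : d = d * (expR (- (e * t)) * expR (e * t))); last by rewrite E mulr1.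
by rewrite mulrCA !ler_pM2l.
Unshelve. all: by end_near. Qed.

(** The Abel factor. It vanishes for [t <= 0], so integrals over the whole line that contain it are
    integrals over the half-line. *)
Definition expp (e t : R) : R := if 0 < t then expR (- (e * t)) else 0.

Lemma expp_int (e : R) : 0 < e ->
  rint mu (expp e) /\ RI (expp e) = e^-1.
Proof.
move=> e0; have en0 : e != 0 by rewrite gt_eqF.
have dF (x : R) : is_derive x 1 (fun t => expR (- (e * t)) * (- e^-1)) (expR (- (e * x))).
  by apply: is_derive_eq; rewrite /GRing.scale /=; field.
have [] := @integral_pos_FTC (fun t => expR (- (e * t))) _ 0 (- e^-1) _ _ (fun x _ => dF x).
- by move=> x _; exact: expR_ge0.
- move=> x _; apply: is_derive_cont; exact: is_derive_eq.
- by apply: (@cvg_expR_bounded e `|e^-1|) => // t; rewrite normrN.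
- rewrite [X in _ --> X](_ : _ = expR (- (e * 0)) * - e^-1); last first.
    by rewrite mulr0 oppr0 expR0 mul1r.
  apply: cvg_at_right_filter; exact: is_derive_cont (dF 0).
- by rewrite sub0r opprK.
Qed.

(** The integrand changes sign, whereas the primitive lemma is for nonnegative functions; so
    [1 + f >= 0] is integrated and the integral of [expp e] subtracted. The form of [f] is the
    derivative of [exp (- e t) (al sin (a t) + be cos (a t)) / (e^2 + a^2)] without its exponential
    factor; cosine and sine are both special cases. *)
Lemma expp_osc_int (e a al be : R) (f : R -> R) : 0 < e ->
  (forall t, f t = ((al * a - e * be) * cos (a * t) - (be * a + e * al) * sin (a * t)) /
    (e ^+ 2 + a ^+ 2)) -> (forall t, -1 <= f t) ->
  rint mu (fun t => expp e t * f t) /\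
  RI (fun t => expp e t * f t) = - be / (e ^+ 2 + a ^+ 2).
Proof.
move=> e0 fE f1; have en0 : e != 0 by rewrite gt_eqF.
have q0 : 0 < e ^+ 2 + a ^+ 2 by rewrite ltr_wpDr ?sqr_ge0 ?exprn_gt0.
have qn0 : e ^+ 2 + a ^+ 2 != 0 by rewrite gt_eqF.
move: fE; set q := _ + _ in q0 qn0 * => fE.
pose B t := - e^-1 + (al * sin (a * t) + be * cos (a * t)) / q.
have dF (x : R) : is_derive x 1 (fun t => expR (- (e * t)) * B t)
    (expR (- (e * x)) * (1 + f x)).
  rewrite fE /B; apply: is_derive_eq; rewrite /GRing.scale /=.
  by field; rewrite qn0 en0.
have [] := @integral_pos_FTC (fun t => expR (- (e * t)) * (1 + f t)) _ 0 (B 0)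
   _ _ (fun x _ => dF x).
- by move=> x _; rewrite mulr_ge0 ?expR_ge0// -lerBlDl sub0r.
- move=> x _; rewrite (funext fE); apply: is_derive_cont; exact: is_derive_eq.
- apply: (@cvg_expR_bounded e (e^-1 + (`|al| + `|be|) / q)) => // t.
  have ei : 0 <= e^-1 by rewrite invr_ge0 ltW.
  have qi : 0 <= q^-1 by rewrite invr_ge0 ltW.
  apply: (le_trans (ler_normD _ _)); rewrite normrN (ger0_norm ei) lerD2l.
  rewrite normrM (ger0_norm qi) ler_wpM2r//.
  rewrite (le_trans (ler_normD _ _))// !normrM lerD// ler_piMr//.
    by rewrite ler_norml sin_geN1 sin_le1.
  by rewrite ler_norml cos_geN1 cos_le1.
- rewrite [X in _ --> X](_ : _ = expR (- (e * 0)) * B 0); last first.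
    by rewrite mulr0 oppr0 expR0 mul1r.
  apply: cvg_at_right_filter; exact: is_derive_cont (dF 0).
move=> i1 I1; have [i0 I0] := expp_int e0.
have E : (fun t => expp e t * f t) =
   (fun t => (if 0 < t then expR (- (e * t)) * (1 + f t) else 0) - expp e t).
  by apply/funext => t; rewrite /expp; case: ifP => _; ring.
split; first by rewrite E; exact: rintB.
rewrite E RintegralB// I0 I1 /B mulr0 sin0 cos0.
by field; rewrite qn0 en0.
Qed.

Lemma expp_cos_int (e a : R) : 0 < e ->
  rint mu (fun t => expp e t * cos (a * t)) /\
  RI (fun t => expp e t * cos (a * t)) = e / (e ^+ 2 + a ^+ 2).
Proof.
move=> e0; have := @expp_osc_int e a (a) (- e) (fun t => cos (a * t)) e0.
rewrite opprK; apply=> t; last exact: cos_geN1.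
by field; rewrite gt_eqF// ltr_wpDr ?sqr_ge0 ?exprn_gt0.
Qed.

Lemma expp_sin_int (e a : R) : 0 < e ->
  rint mu (fun t => expp e t * sin (a * t)) /\
  RI (fun t => expp e t * sin (a * t)) = a / (e ^+ 2 + a ^+ 2).
Proof.
move=> e0; have := @expp_osc_int e a (- e) (- a) (fun t => sin (a * t)) e0.
rewrite opprK; apply=> t; last exact: sin_geN1.
by field; rewrite gt_eqF// ltr_wpDr ?sqr_ge0 ?exprn_gt0.
Qed.

Lemma poisson_int (e x : R) : 0 < e ->
  rint mu (fun y => if 0 < y then e / (e ^+ 2 + (x - y) ^+ 2) else 0) /\
  RI (fun y => if 0 < y then e / (e ^+ 2 + (x - y) ^+ 2) else 0) <= pi.
Proof.
move=> e0; have en0 : e != 0 by rewrite gt_eqF.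
have q0 (y : R) : 0 < e ^+ 2 + (x - y) ^+ 2 by rewrite ltr_wpDr ?sqr_ge0 ?exprn_gt0.
have dF (y : R) : is_derive y 1 (fun y => atan ((y - x) * e^-1)) (e / (e ^+ 2 + (x - y) ^+ 2)).
  apply: is_derive_eq; rewrite /GRing.scale /=.
  have := q0 y; move/lt0r_neq0; set r := _ + _ => rn0.
  have -> : 1 + ((y - x) / e) ^+ 2 = r / e ^+ 2 by rewrite /r; field.
  by field; rewrite rn0 en0.
have [] := @integral_pos_FTC (fun y => e / (e ^+ 2 + (x - y) ^+ 2)) _ (pi / 2) (atan ((0 - x) * e^-1))
   _ _ (fun x _ => dF x).
- by move=> y _; rewrite divr_ge0// ltW.
- move=> y _; apply: is_derive_cont; apply: is_deriveM.
  by apply: is_deriveV; rewrite gt_eqF.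
- apply: (cvg_comp _ _ _ (@cvgy_atan R)).
  apply/cvgryPge => A; near=> y.
  by rewrite ler_pdivlMr// lerBrDr; near: y; exact/nbhs_pinfty_ge/num_real.
- have := is_derive_cont (dF 0); exact: cvg_at_right_filter.
move=> i1 ->; split=> //.
have := atan_gtNpi2 ((0 - x) * e^-1); lra.
Unshelve. all: by end_near. Qed.

(* Equal to [u^p] for [u > 0]; the law [pw (p + q) u = pw p u * pw q u] holds for all [u]. *)
Definition pw (p u : R) : R := expR (p * ln u).

Lemma pw_gt0 p u : 0 < pw p u. Proof. exact: expR_gt0. Qed.

Lemma pwD p q u : pw (p + q) u = pw p u * pw q u.
Proof. by rewrite /pw mulrDl expRD. Qed.

Lemma pwM p u v : 0 < u -> 0 < v -> pw p (u * v) = pw p u * pw p v.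
Proof. by move=> u0 v0; rewrite /pw lnM ?posrE// mulrDr expRD. Qed.

Lemma pw1 u : 0 < u -> pw 1 u = u.
Proof. by move=> u0; rewrite /pw mul1r lnK. Qed.

(** The primitive is [atan (u ^ p)]. The case [p = 1/2] normalizes the Carleman kernel, [p = 1/4]
    controls the error under dilations, and [p = 2 eps] gives the norms of the approximate
    eigenfunctions. *)
Lemma pw_atan_int (p : R) : 0 < p ->
  rint mu (fun u => if 0 < u then p * pw (p - 1) u / (1 + pw (2 * p) u) else 0) /\
  RI (fun u => if 0 < u then p * pw (p - 1) u / (1 + pw (2 * p) u) else 0) = pi / 2.
Proof.
move=> p0; have pn0 : p != 0 by rewrite gt_eqF.
have dE (q u : R) : 0 < u -> is_derive u 1 (fun u => pw q u) (pw q u * (q * u^-1)).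
  by move=> u0; rewrite /pw; have dl := is_derive1_ln u0; apply: is_derive_eq.
have dF (u : R) : 0 < u -> is_derive u 1 (fun u => atan (pw p u))
    (p * pw (p - 1) u / (1 + pw (2 * p) u)).
  move=> u0; have dE' := dE p u u0; apply: is_derive_eq.
  have -> : 2 * p = p + p by ring.
  have pE : pw p u = pw (p - 1) u * u by rewrite -[X in _ * X](pw1 u0) -pwD subrK.
  rewrite (pwD p p) pE.
  have v0 := pw_gt0 (p - 1) u; set v := pw _ _ in v0 *.
  have r0 : 0 < 1 + (v * u) ^+ 2 by rewrite ltr_wpDr ?sqr_ge0.
  by rewrite -expr2; field; rewrite !gt_eqF.
have [] := @integral_pos_FTC (fun u => p * pw (p - 1) u / (1 + pw (2 * p) u)) _ (pi / 2) (atan 0)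
   _ _ dF.
- by move=> u u0; rewrite divr_ge0 ?mulr_ge0 ?addr_ge0// ltW// ?pw_gt0.
- move=> u u0; have c q : {for u, continuous (fun u => pw q u)} := is_derive_cont (dE q u u0).
  apply: cvgM; first by apply: cvgM; [exact: cvg_cst|exact: c].
  apply: cvgV; first by rewrite gt_eqF// ltr_wpDl// pw_gt0.
  by apply: cvgD; [exact: cvg_cst|exact: c].
- apply: (cvg_comp _ _ _ (@cvgy_atan R)).
  apply/cvgryPge => A; near=> u.
  have u1 : expR ((`|A|) / p) <= u by near: u; exact/nbhs_pinfty_ge/num_real.
  have u0 : 0 < u by rewrite (lt_le_trans _ u1)// expR_gt0.
  apply: (le_trans (ler_norm A)); rewrite /pw.
  apply: (@le_trans _ _ (p * ln u)); last by rewrite (le_trans _ (expR_ge1Dx _))// lerDr.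
  rewrite mulrC -ler_pdivrMr// -(expRK (`|A| / p)).
  by rewrite ler_ln ?posrE// expR_gt0.
- apply: (@cvg_comp _ _ _ (fun u => pw p u) atan _ (nbhs 0) _ _ (@continuous_atan R 0)).
  apply/cvgr0Pnorm_le => d d0; near=> u.
  have u0 : 0 < u by near: u; exact: nbhs_right_gt.
  have u1 : u < expR (ln d / p) by near: u; apply: nbhs_right_lt; exact: expR_gt0.
  rewrite (ger0_norm (ltW (pw_gt0 _ _))) /pw -[d in leRHS]lnK ?posrE// ler_expR.
  rewrite mulrC -ler_pdivlMr// -(expRK (ln d / p)).
  by rewrite ler_ln ?posrE ?expR_gt0// ltW.
by move=> i1 ->; rewrite atan0 subr0.
Unshelve. all: by end_near. Qed.

End RealLine.

(** * Complex-valued integrals *)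

Section ComplexModulus.
Variable R : realType.
Local Notation C := R[i].
Implicit Types z w : C.

(** A modulus with values in [R], since the norm of [R[i]] takes its values in [R[i]]. *)
Definition cabs z : R := Num.sqrt (csqnorm z).

Lemma csqnorm_ge0 z : 0 <= csqnorm z.
Proof. by rewrite addr_ge0 ?sqr_ge0. Qed.

Lemma cabs_sq z : cabs z ^+ 2 = csqnorm z.
Proof. by rewrite sqr_sqrtr// csqnorm_ge0. Qed.

Lemma cabs_ge0 z : 0 <= cabs z. Proof. exact: sqrtr_ge0. Qed.

Lemma cReD z w : Re (z + w) = Re z + Re w. Proof. by case: z; case: w. Qed.
Lemma cImD z w : Im (z + w) = Im z + Im w. Proof. by case: z; case: w. Qed.
Lemma cReN z : Re (- z) = - Re z. Proof. by case: z. Qed.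
Lemma cImN z : Im (- z) = - Im z. Proof. by case: z. Qed.
Lemma cReM z w : Re (z * w) = Re z * Re w - Im z * Im w.
Proof. by case: z; case: w. Qed.
Lemma cImM z w : Im (z * w) = Re z * Im w + Im z * Re w.
Proof. by case: z; case: w. Qed.
Lemma cReJ z : Re (z^*)%C = Re z. Proof. by case: z. Qed.
Lemma cImJ z : Im (z^*)%C = - Im z. Proof. by case: z. Qed.
Definition cE := (cReD, cImD, cReN, cImN, cReM, cImM, cReJ, cImJ).

Lemma complex_eq z w : Re z = Re w -> Im z = Im w -> z = w.
Proof. by case: z => a b; case: w => c d /= -> ->. Qed.

Lemma csqnormM z w : csqnorm (z * w) = csqnorm z * csqnorm w.
Proof. by rewrite /csqnorm !cE; ring. Qed.

Lemma csqnormJ z : csqnorm (z^*)%C = csqnorm z.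
Proof. by rewrite /csqnorm !cE; ring. Qed.

Lemma cabsM z w : cabs (z * w) = cabs z * cabs w.
Proof. by rewrite /cabs csqnormM sqrtrM ?csqnorm_ge0. Qed.

Lemma cabsJ z : cabs (z^*)%C = cabs z. Proof. by rewrite /cabs csqnormJ. Qed.

Lemma cabsN z : cabs (- z) = cabs z.
Proof. by rewrite /cabs /csqnorm !cE !sqrrN. Qed.

Lemma cabs0 : cabs 0 = 0. Proof. by rewrite /cabs /csqnorm /= expr0n /= addr0 sqrtr0. Qed.

Lemma cabs_eq0 z : cabs z = 0 -> z = 0.
Proof.
move=> z0; have : csqnorm z = 0 by rewrite -cabs_sq z0 expr0n.
move/eqP; rewrite /csqnorm paddr_eq0 ?sqr_ge0// !sqrf_eq0 => /andP[/eqP a /eqP b].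
exact: complex_eq.
Qed.

Lemma cabsR (a : R) : cabs a%:C%C = `|a|.
Proof. by rewrite /cabs /csqnorm /= expr0n /= addr0 sqrtr_sqr. Qed.

Lemma cabs_expi (a : R) : cabs (expi a) = 1.
Proof. by rewrite /cabs /csqnorm /= cos2Dsin2 sqrtr1. Qed.

Lemma cabs_i : cabs ('i%C : C) = 1.
Proof. by rewrite /cabs /csqnorm /= expr0n expr1n add0r sqrtr1. Qed.

Lemma expiD (a b : R) : expi (a + b) = expi a * expi b.
Proof. by apply: complex_eq; rewrite !cE /= ?cosD ?sinD; ring. Qed.

Lemma expiN (a : R) : expi (- a) = (expi a)^*%C.
Proof. by apply: complex_eq; rewrite !cE /= ?cosN ?sinN. Qed.

Lemma Re_lin z w : Re z * Re w + Im z * Im w <= cabs z * cabs w.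
Proof.
have [h|h] := leP (Re z * Re w + Im z * Im w) 0.
  by apply: (le_trans h); rewrite mulr_ge0 ?cabs_ge0.
rewrite -(@ler_pXn2r _ 2) ?nnegrE ?mulr_ge0 ?cabs_ge0 ?(ltW h)//.
rewrite exprMn !cabs_sq /csqnorm.
have := sqr_ge0 (Re z * Im w - Im z * Re w); nra.
Qed.

Lemma Re_le_cabs z : `|Re z| <= cabs z.
Proof.
by rewrite -sqrtr_sqr ler_sqrt ?csqnorm_ge0// lerDl sqr_ge0.
Qed.

Lemma Im_le_cabs z : `|Im z| <= cabs z.
Proof.
by rewrite -sqrtr_sqr ler_sqrt ?csqnorm_ge0// lerDr sqr_ge0.
Qed.

Lemma cabs_le z (a : R) : 0 <= a -> csqnorm z <= a ^+ 2 -> cabs z <= a.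
Proof.
by move=> a0 h; rewrite -(@ler_pXn2r _ 2) ?nnegrE ?cabs_ge0// cabs_sq.
Qed.

End ComplexModulus.

Section ComplexIntegral.
Variable R : realType.
Local Notation C := R[i].
Local Notation mu := (@lebesgue_measure R).
Local Notation RI := (Rintegral mu setT).

Definition cmeas d (T : measurableType d) (f : T -> C) :=
  meas (fun x => Re (f x)) /\ meas (fun x => Im (f x)).

Section cmeas.
Context d (T : measurableType d).
Implicit Types f g : T -> C.

Lemma cmeasM f g : cmeas f -> cmeas g -> cmeas (fun x => f x * g x).
Proof.
move=> [a b] [c e]; split.
- under eq_fun do rewrite cReM.
  by apply: measurable_funB; exact: measurable_funM.
- under eq_fun do rewrite cImM.
  by apply: measurable_funD; exact: measurable_funM.
Qed.

Lemma cmeasJ f : cmeas f -> cmeas (fun x => (f x)^*%C).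
Proof.
move=> [a b]; split.
- by under eq_fun do rewrite cReJ.
- by under eq_fun do rewrite cImJ; exact: measurableT_comp.
Qed.

Lemma cmeas_cst (c : C) : cmeas (fun _ : T => c).
Proof. by split; exact: measurable_cst. Qed.

Lemma cmeasR (f : T -> R) : meas f -> cmeas (fun x => (f x)%:C%C).
Proof. by move=> mf; split=> //=; exact: measurable_cst. Qed.

Lemma cmeas_expi (f : T -> R) : meas f -> cmeas (fun x => expi (f x)).
Proof.
move=> mf; split=> /=.
- by apply: measurableT_comp => //; apply: continuous_measurable_fun; exact: continuous_cos.
- by apply: measurableT_comp => //; apply: continuous_measurable_fun; exact: continuous_sin.
Qed.

Lemma meas_csqnorm f : cmeas f -> meas (fun x => csqnorm (f x)).
Proof.
by move=> [a b]; apply: measurable_funD; exact: measurable_funX.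
Qed.

Lemma meas_cabs f : cmeas f -> meas (fun x => cabs (f x)).
Proof.
move=> mf; apply: (@measurableT_comp _ _ _ _ _ _ (@Num.sqrt R)).
  apply: continuous_measurable_fun; exact: sqrt_continuous.
exact: meas_csqnorm.
Qed.

Lemma cmeas_if f (b : T -> bool) : meas b -> cmeas f ->
  cmeas (fun x => if b x then f x else 0).
Proof.
move=> mb [mr mi]; split.
- rewrite (_ : (fun _ => _) = fun x => if b x then Re (f x) else 0); last first.
    by apply/funext => x; case: ifP.
  exact: measurable_fun_ifT.
- rewrite (_ : (fun _ => _) = fun x => if b x then Im (f x) else 0); last first.
    by apply/funext => x; case: ifP.
  exact: measurable_fun_ifT.
Qed.

End cmeas.

Lemma cmeas_comp d1 d2 (T1 : measurableType d1) (T2 : measurableType d2)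
  (f : T2 -> C) (g : T1 -> T2) : cmeas f -> meas g ->
  cmeas (fun x => f (g x)).
Proof. by move=> [a b] mg; split; [exact: (measurableT_comp a)|exact: (measurableT_comp b)]. Qed.

Local Notation RR := (measurableTypeR R).
Implicit Types f g : RR -> C.

Definition cint f := rint mu (fun x => Re (f x)) /\ rint mu (fun x => Im (f x)).
Definition cI f : C := cintegral setT f.

Lemma cint_meas f : cint f -> cmeas f.
Proof. by move=> [a b]; split; [exact: (rint_meas a)|exact: (rint_meas b)]. Qed.

Lemma cint_le f (g : RR -> R) : cmeas f -> rint mu g ->
  (forall x, cabs (f x) <= g x) -> cint f.
Proof.
move=> [mr mi] ig fg; split.
- by apply: rint_le ig _ => // x; exact: le_trans (Re_le_cabs _) (fg x).
- by apply: rint_le ig _ => // x; exact: le_trans (Im_le_cabs _) (fg x).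
Qed.

Lemma cint_cabs f : cint f -> rint mu (fun x => cabs (f x)).
Proof.
move=> [a b]; apply: (@rint_le _ _ _ _ _ (fun x => `|Re (f x)| + `|Im (f x)|)).
- by apply: meas_cabs; split; [exact: (rint_meas a)|exact: (rint_meas b)].
- by apply: rintD; exact: rint_norm.
- move=> x; rewrite ger0_norm ?cabs_ge0//; apply: cabs_le; first by rewrite addr_ge0.
  rewrite /csqnorm -[Re _ ^+ 2]real_normK ?num_real// -[Im _ ^+ 2]real_normK ?num_real//.
  have := normr_ge0 (Re (f x)); have := normr_ge0 (Im (f x)); nra.
Qed.

Lemma cintD f g : cint f -> cint g -> cint (fun x => f x + g x).
Proof.
move=> [a b] [c e]; split.
- by rewrite /rint; under eq_fun do rewrite cReD; exact: rintD.
- by rewrite /rint; under eq_fun do rewrite cImD; exact: rintD.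
Qed.

Lemma cintZ (c : C) f : cint f -> cint (fun x => c * f x).
Proof.
move=> [a b]; split.
- rewrite (_ : (fun _ => _) = fun x => Re c * Re (f x) - Im c * Im (f x)); last first.
    by apply/funext => x; rewrite cReM.
  by apply: rintB; exact: rintZ.
- rewrite (_ : (fun _ => _) = fun x => Re c * Im (f x) + Im c * Re (f x)); last first.
    by apply/funext => x; rewrite cImM.
  by apply: rintD; exact: rintZ.
Qed.

Lemma cID f g : cint f -> cint g -> cI (fun x => f x + g x) = cI f + cI g.
Proof.
move=> [a b] [c e]; apply: complex_eq; rewrite !cE /cI /cintegral /=.
- by rewrite -RintegralD//; apply: eq_Rintegral => x _; rewrite cReD.
- by rewrite -RintegralD//; apply: eq_Rintegral => x _; rewrite cImD.
Qed.

Lemma cIZ (c : C) f : cint f -> cI (fun x => c * f x) = c * cI f.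
Proof.
move=> [a b]; apply: complex_eq; rewrite !cE /cI /cintegral /=.
- rewrite -!RintegralZl// -RintegralB//; [|exact: rintZ|exact: rintZ].
  by apply: eq_Rintegral => x _; rewrite cReM.
- rewrite -!RintegralZl// -RintegralD//; [|exact: rintZ|exact: rintZ].
  by apply: eq_Rintegral => x _; rewrite cImM.
Qed.

Lemma cIJ f : cint f -> cI (fun x => (f x)^*%C) = (cI f)^*%C.
Proof.
move=> [a b]; apply: complex_eq; rewrite !cE /cI /cintegral /=.
- by apply: eq_Rintegral => x _; rewrite cReJ.
- rewrite -[RHS]mulN1r -RintegralZl//; apply: eq_Rintegral => x _.
  by rewrite cImJ mulN1r.
Qed.

Lemma eq_cI f g : f =1 g -> cI f = cI g.
Proof. by move=> /funext ->. Qed.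

Lemma cIR (f : RR -> R) : cI (fun x => (f x)%:C%C) = (RI f)%:C%C.
Proof.
rewrite /cI /cintegral /=; congr Complex.
by rewrite Rintegral_cst// mul0r.
Qed.

(** With [z] the integral, [|z|^2] is the integral of the real part of [conj z * f], hence at most
    [|z|] times the integral of [g]. Estimating real and imaginary parts separately would lose a
    constant. *)
Lemma cI_abs f (g : RR -> R) : cint f -> rint mu g ->
  (forall x, cabs (f x) <= g x) -> cabs (cI f) <= RI g.
Proof.
move=> [a b] ig fg; set z := cI f.
have G0 : 0 <= RI g.
  by apply: Rintegral_ge0 => x _; exact: le_trans (cabs_ge0 _) (fg x).
have [z0|z0] := eqVneq (cabs z) 0; first by rewrite z0.
have zp : 0 < cabs z by rewrite lt_def z0 cabs_ge0.
rewrite -(ler_pM2l zp) -expr2 cabs_sq.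
have -> : csqnorm z = RI (fun x => Re z * Re (f x) + Im z * Im (f x)).
  rewrite RintegralD//; [|exact: rintZ|exact: rintZ].
  by rewrite !RintegralZl// /csqnorm !expr2.
rewrite -RintegralZl//; apply: le_Rintegral => //.
- by apply: rintD; exact: rintZ.
- exact: rintZ.
- by move=> x _; apply: (le_trans (Re_lin _ _)); rewrite ler_pM2l.
Qed.

Lemma cfubini (h : RR * RR -> C) : cmeas h ->
  (forall x, cint (fun y => h (x, y))) ->
  (forall y, cint (fun x => h (x, y))) ->
  (\int[mu]_x \int[mu]_y (cabs (h (x, y)))%:E < +oo)%E ->
  cint (fun x => cI (fun y => h (x, y))) /\
  cI (fun x => cI (fun y => h (x, y))) = cI (fun y => cI (fun x => h (x, y))).
Proof.
move=> mh h1 h2 hfin; have mc := meas_cabs mh; case: mh => mr mi.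
have mabs (p : C -> R) : meas (fun z => p (h z)) ->
   (forall z, `|p z| <= cabs z) ->
   (\int[mu]_x \int[mu]_y `|p (h (x, y))|%:E < +oo)%E.
  move=> mp pc; apply: le_lt_trans hfin.
  apply: ge0_le_integral => //.
  - by move=> x _; apply: integral_ge0 => y _; rewrite lee_fin.
  - apply: (measurable_fun_fubini_tonelli_F (fun z => `|p (h z)|%:E)) => //.
    by apply/measurable_EFinP; exact: measurableT_comp.
  - apply: (measurable_fun_fubini_tonelli_F (fun z => (cabs (h z))%:E)) => //.
    + exact/measurable_EFinP.
    + by move=> z; rewrite lee_fin cabs_ge0.
  - move=> x _; apply: ge0_le_integral => //.
    + apply/measurable_EFinP; apply: measurableT_comp => //.
      exact: (measurableT_comp mp).
    + by apply/measurable_EFinP; exact: (measurableT_comp mc).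
    + by move=> y _; rewrite lee_fin.
have [r1 r2] := fubiniR mr (fun x => (h1 x).1) (fun y => (h2 y).1) (mabs _ mr (@Re_le_cabs R)).
have [i1 i2] := fubiniR mi (fun x => (h1 x).2) (fun y => (h2 y).2) (mabs _ mi (@Im_le_cabs R)).
split; first by split; [exact: r1|exact: i1].
by apply: complex_eq; [exact: r2|exact: i2].
Qed.

(** Two integrable functions coupled by a bounded kernel: the double integral is absolutely
    convergent. The Fourier kernel and the Laplace kernel both enter the proof in this form. *)
Lemma cfubiniM (f g : RR -> C) (k : RR * RR -> C) (M : R) : cint f -> cint g ->
  cmeas k -> (forall z, cabs (k z) <= M) ->
  cint (fun x => f x * cI (fun y => g y * k (x, y))) /\
  cI (fun x => f x * cI (fun y => g y * k (x, y))) =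
  cI (fun y => g y * cI (fun x => f x * k (x, y))).
Proof.
move=> fi gi mk kM; have mf := cint_meas fi; have mg := cint_meas gi.
have M0 : 0 <= M by exact: le_trans (cabs_ge0 _) (kM (0, 0)).
pose h (z : RR * RR) := f z.1 * (g z.2 * k z).
have mh : cmeas h.
  apply: cmeasM; first exact: (cmeas_comp mf).
  by apply: cmeasM => //; exact: (cmeas_comp mg).
have sk (x : R) : cint (fun y => g y * k (x, y)).
  apply: (@cint_le _ (fun y => M * cabs (g y))).
  - apply: cmeasM => //; exact: (cmeas_comp mk).
  - by apply/rintZ/cint_cabs.
  - by move=> y; rewrite cabsM mulrC ler_wpM2r ?cabs_ge0.
have sk' (y : R) : cint (fun x => f x * k (x, y)).
  apply: (@cint_le _ (fun x => M * cabs (f x))).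
  - apply: cmeasM => //; exact: (cmeas_comp mk).
  - by apply/rintZ/cint_cabs.
  - by move=> x; rewrite cabsM mulrC ler_wpM2r ?cabs_ge0.
have h1 x : cint (fun y => h (x, y)) by rewrite /h/=; exact/cintZ.
have hE y : (fun x => h (x, y)) = fun x => g y * (f x * k (x, y)).
  by apply/funext => x; rewrite /h /=; ring.
have h2 y : cint (fun x => h (x, y)) by rewrite hE; exact/cintZ.
have fin : (\int[mu]_x \int[mu]_y (cabs (h (x, y)))%:E < +oo)%E.
  have G0 : 0 <= RI (fun y => M * cabs (g y)).
    by apply: Rintegral_ge0 => y _; rewrite mulr_ge0 ?cabs_ge0.
  have ig : rint mu (fun y => M * cabs (g y)) by exact/rintZ/cint_cabs.
  apply: (@le_lt_trans _ _ (\int[mu]_x (RI (fun y => M * cabs (g y)) * cabs (f x))%:E)%E).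
    apply: ge0_le_integral => //.
    - by move=> x _; apply: integral_ge0 => y _; rewrite lee_fin cabs_ge0.
    - apply: (measurable_fun_fubini_tonelli_F (fun z => (cabs (h z))%:E)) => //.
      + by apply/measurable_EFinP/meas_cabs.
      + by move=> z; rewrite lee_fin cabs_ge0.
    - by apply/measurable_EFinP/measurable_funM => //; exact: meas_cabs.
    - move=> x _; rewrite mulrC EFinM RI_E// -ge0_integralZl_EFin//.
      + apply: ge0_le_integral => //.
        * by move=> y _; rewrite lee_fin cabs_ge0.
        * by apply/measurable_EFinP/meas_cabs/cint_meas.
        * by apply: measurable_funeM; exact: (measurable_int _ ig).
        * move=> y _; rewrite -EFinM lee_fin /h /= !cabsM ler_wpM2l ?cabs_ge0//.
          by rewrite mulrC ler_wpM2r ?cabs_ge0.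
      + by move=> y _; rewrite lee_fin mulr_ge0 ?cabs_ge0.
      + exact: (measurable_int _ ig).
      + exact: cabs_ge0.
  by apply: integrable_lty => //; exact/rintZ/cint_cabs.
have [r1 r2] := cfubini mh h1 h2 fin.
have E : (fun x => cI (fun y => h (x, y))) = fun x => f x * cI (fun y => g y * k (x, y)).
  by apply/funext => x; rewrite -cIZ.
split; first by rewrite -E.
rewrite -E r2; apply: eq_cI => y; rewrite hE cIZ//.
Qed.

End ComplexIntegral.

(** * The space of square-integrable functions on the half-line *)

Section Space.
Variable R : realType.
Local Notation C := R[i].
Local Notation mu := (@lebesgue_measure R).
Local Notation RI := (Rintegral mu setT).
Local Notation RR := (measurableTypeR R).

Lemma integral_csqnorm (f : RR -> C) : cmeas f ->
  (\int[mu]_t (csqnorm (f t))%:E =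
   sqi mu (fun t => Re (f t)) + sqi mu (fun t => Im (f t)))%E.
Proof.
move=> [mr mi]; rewrite /sqi -ge0_integralD//.
- by move=> x _; rewrite lee_fin sqr_ge0.
- exact/measurable_EFinP/measurable_funX.
- by move=> x _; rewrite lee_fin sqr_ge0.
- exact/measurable_EFinP/measurable_funX.
Qed.

Lemma L2posP (f : RR -> C) : L2pos f <->
  [/\ L2 mu (fun t => Re (f t)), L2 mu (fun t => Im (f t)) &
      forall t, t <= 0 -> f t = 0].
Proof.
split=> [[mr mi f0 fo]|[[mr fr] [mi fi] f0]].
- have mf : cmeas f by [].
  rewrite (integral_csqnorm mf) in fo.
  split=> //; split=> //; apply: le_lt_trans fo.
    by rewrite leeDl// sqi_ge0.
  by rewrite leeDr// sqi_ge0.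
- have mf : cmeas f by [].
  split=> //; rewrite (integral_csqnorm mf); exact: lte_add_pinfty.
Qed.

(* Elements of [H] are functions rather than classes modulo null sets, so the norm [hnorm] below
   is only a seminorm and null elements have to be carried along. *)
Record H := MkH { hfun :> RR -> C; hP : L2pos hfun }.

Lemma H_ext (x y : H) : (forall t, x t = y t) -> x = y.
Proof.
case: x => f fP; case: y => g gP /= /funext fg; subst g.
by congr MkH; exact: Prop_irrelevance.
Qed.

Lemma H_L2 (x : H) : L2 mu (fun t => Re (x t)) /\ L2 mu (fun t => Im (x t)).
Proof. by have /L2posP[] := hP x. Qed.

Lemma H_meas (x : H) : cmeas x.
Proof. by have [[a _] [b _]] := H_L2 x. Qed.

Lemma H_pos (x : H) t : t <= 0 -> x t = 0.
Proof. by have /L2posP[_ _] := hP x; exact. Qed.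

Lemma L2posD (f g : RR -> C) : L2pos f -> L2pos g -> L2pos (fun t => f t + g t).
Proof.
move=> /L2posP[a b c] /L2posP[a' b' c']; apply/L2posP; split.
- by under eq_fun do rewrite cReD; exact: L2D.
- by under eq_fun do rewrite cImD; exact: L2D.
- by move=> t t0; rewrite c// c'// addr0.
Qed.

Lemma L2posZ (k : C) (f : RR -> C) : L2pos f -> L2pos (fun t => k * f t).
Proof.
move=> /L2posP[a b c]; apply/L2posP; split.
- rewrite (_ : (fun _ => _) = fun x => Re k * Re (f x) + (- Im k) * Im (f x)); last first.
    by apply/funext => x; rewrite cReM mulNr.
  by apply: L2D; exact: L2Z.
- rewrite (_ : (fun _ => _) = fun x => Re k * Im (f x) + Im k * Re (f x)); last first.
    by apply/funext => x; rewrite cImM.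
  by apply: L2D; exact: L2Z.
- by move=> t t0; rewrite c// mulr0.
Qed.

Lemma L2pos0 : L2pos (fun _ : RR => 0 : C).
Proof.
apply/L2posP; split=> //=; split=> //; rewrite /sqi.
- by under eq_integral do rewrite expr0n/=; rewrite integral0.
- by under eq_integral do rewrite expr0n/=; rewrite integral0.
Qed.

Definition Hadd (x y : H) := MkH (L2posD (hP x) (hP y)).
Definition Hscale (k : C) (x : H) := MkH (L2posZ k (hP x)).
Definition Hopp (x : H) := Hscale (-1) x.
Definition Hzero := MkH L2pos0.

HB.instance Definition _ := gen_eqMixin H.
HB.instance Definition _ := gen_choiceMixin H.

Lemma HaddA : associative Hadd.
Proof. by move=> x y z; apply: H_ext => t /=; rewrite addrA. Qed.
Lemma HaddC : commutative Hadd.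
Proof. by move=> x y; apply: H_ext => t /=; rewrite addrC. Qed.
Lemma Hadd0 : left_id Hzero Hadd.
Proof. by move=> x; apply: H_ext => t /=; rewrite add0r. Qed.
Lemma HaddN : left_inverse Hzero Hopp Hadd.
Proof. by move=> x; apply: H_ext => t /=; rewrite mulN1r addNr. Qed.

HB.instance Definition _ := GRing.isZmodule.Build H HaddA HaddC Hadd0 HaddN.

Lemma HscaleA a b (x : H) : Hscale a (Hscale b x) = Hscale (a * b) x.
Proof. by apply: H_ext => t /=; rewrite mulrA. Qed.
Lemma Hscale1 : left_id 1 Hscale.
Proof. by move=> x; apply: H_ext => t /=; rewrite mul1r. Qed.
Lemma HscaleDr : right_distributive Hscale +%R.
Proof. by move=> a x y; apply: H_ext => t /=; rewrite mulrDr. Qed.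
Lemma HscaleDl (x : H) : {morph Hscale^~ x : a b / a + b}.
Proof. by move=> a b; apply: H_ext => t /=; rewrite mulrDl. Qed.

HB.instance Definition _ := GRing.Zmodule_isLmodule.Build C H
  HscaleA Hscale1 HscaleDr HscaleDl.

Implicit Types x y z u v : H.

Lemma HDE x y t : (x + y) t = x t + y t. Proof. by []. Qed.
Lemma HZE (k : C) x t : (k *: x) t = k * x t. Proof. by []. Qed.
Lemma HNE x t : (- x) t = - x t. Proof. by rewrite /= mulN1r. Qed.
Lemma H0E t : (0 : H) t = 0. Proof. by []. Qed.
Definition HE := (HNE, HDE, HZE, H0E).

(* The real inner product [Re <x, y>], which has the same norm as the Hermitian one. *)
Definition ip x y := RI (fun t => Re (x t) * Re (y t) + Im (x t) * Im (y t)).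
Definition sqn x := ip x x.
Definition hnorm x := Num.sqrt (sqn x).

Lemma ip_rint x y : rint mu (fun t => Re (x t) * Re (y t) + Im (x t) * Im (y t)).
Proof.
have [a b] := H_L2 x; have [c d] := H_L2 y.
by apply: rintD; exact: L2_mul.
Qed.

Lemma ipC x y : ip x y = ip y x.
Proof. by apply: eq_Rintegral => t _; ring. Qed.

Lemma ipDl x y z : ip (x + y) z = ip x z + ip y z.
Proof.
rewrite /ip -RintegralD//; [|exact: ip_rint|exact: ip_rint].
by apply: eq_Rintegral => t _; rewrite HDE !cE; ring.
Qed.

Lemma ipDr x y z : ip z (x + y) = ip z x + ip z y.
Proof. by rewrite !(ipC z) ipDl. Qed.

Lemma ipZl (r : R) x y : ip (r%:C%C *: x) y = r * ip x y.
Proof.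
rewrite /ip -RintegralZl//; last exact: ip_rint.
by apply: eq_Rintegral => t _; rewrite HZE !cE /=; ring.
Qed.

Lemma ipZr (r : R) x y : ip y (r%:C%C *: x) = r * ip y x.
Proof. by rewrite !(ipC y) ipZl. Qed.

Lemma ipNl x y : ip (- x) y = - ip x y.
Proof. by have := ipZl (-1) x y; rewrite rmorphN1 scaleN1r mulN1r. Qed.

Lemma ipNr x y : ip y (- x) = - ip y x.
Proof. by rewrite !(ipC y) ipNl. Qed.

Lemma sqn_RI x : sqn x = RI (fun t => csqnorm (x t)).
Proof. by apply: eq_Rintegral => t _; rewrite /csqnorm !expr2. Qed.

Lemma csqnorm_rint x : rint mu (fun t => csqnorm (x t)).
Proof. by have := ip_rint x x; congr (rint _ _). Qed.

Lemma sqn_integral x : ((sqn x)%:E = \int[mu]_t (csqnorm (x t))%:E)%E.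
Proof.
by rewrite sqn_RI RI_E//; exact: csqnorm_rint.
Qed.

Lemma sqn_ge0 x : 0 <= sqn x.
Proof. by rewrite sqn_RI; apply: Rintegral_ge0 => t _; exact: csqnorm_ge0. Qed.

Lemma sqnD x y : sqn (x + y) = sqn x + 2 * ip x y + sqn y.
Proof. by rewrite /sqn !(ipDl, ipDr) (ipC y x); ring. Qed.

Lemma sqnZ (k : C) x : sqn (k *: x) = csqnorm k * sqn x.
Proof.
rewrite !sqn_RI -RintegralZl//; last exact: csqnorm_rint.
by apply: eq_Rintegral => t _; rewrite HZE csqnormM.
Qed.

Lemma hnorm_ge0 x : 0 <= hnorm x. Proof. exact: sqrtr_ge0. Qed.

Lemma hnorm_sqr x : hnorm x ^+ 2 = sqn x. Proof. by rewrite sqr_sqrtr ?sqn_ge0. Qed.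

Lemma hnormZ (k : C) x : hnorm (k *: x) = cabs k * hnorm x.
Proof. by rewrite /hnorm sqnZ sqrtrM ?csqnorm_ge0. Qed.

Lemma hnormN x : hnorm (- x) = hnorm x.
Proof. by rewrite -scaleN1r hnormZ cabsN (cabsR 1) normr1 mul1r. Qed.

Lemma hnorm0 : hnorm 0 = 0.
Proof. by rewrite -(scale0r (0 : H)) hnormZ cabs0 mul0r. Qed.

Lemma hnorm_le x (a : R) : 0 <= a -> sqn x <= a ^+ 2 -> hnorm x <= a.
Proof. by move=> a0 h; rewrite -(@ler_pXn2r _ 2) ?nnegrE ?hnorm_ge0// hnorm_sqr. Qed.

Lemma ip_CS x y : `|ip x y| <= hnorm x * hnorm y.
Proof.
have h : ip x y ^+ 2 <= sqn x * sqn y.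
  apply: quad_disc => [||t]; [exact: sqn_ge0|exact: sqn_ge0|].
  have -> : sqn x + t * (2 * ip x y) + t ^+ 2 * sqn y = sqn (x + t%:C%C *: y).
    by rewrite sqnD ipZr sqnZ /csqnorm /=; ring.
  exact: sqn_ge0.
rewrite -(@ler_pXn2r _ 2) ?nnegrE ?mulr_ge0 ?hnorm_ge0//.
by rewrite real_normK ?num_real// exprMn !hnorm_sqr.
Qed.

Lemma hnormD x y : hnorm (x + y) <= hnorm x + hnorm y.
Proof.
apply: hnorm_le; first by rewrite addr_ge0 ?hnorm_ge0.
have := ler_norm (ip x y); have := ip_CS x y.
rewrite sqnD -!hnorm_sqr; nra.
Qed.

Lemma hnormB x y : hnorm (x - y) <= hnorm x + hnorm y.
Proof. by rewrite -(hnormN y) hnormD. Qed.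

Lemma hnormBC x y : hnorm (x - y) = hnorm (y - x). Proof. by rewrite -hnormN opprB. Qed.

Lemma hnorm_triangle x y z : hnorm (x - z) <= hnorm (x - y) + hnorm (y - z).
Proof. by rewrite (le_trans _ (hnormD _ _))// addrA subrK. Qed.

Lemma hnorm_triangleB x y : hnorm x - hnorm y <= hnorm (x - y).
Proof. by rewrite lerBlDr (le_trans _ (hnormD _ _))// subrK. Qed.

Lemma le_all_eq0 (a : R) : 0 <= a -> (forall e, 0 < e -> a <= e) -> a = 0.
Proof.
move=> a0 h; apply/eqP; rewrite eq_le a0 andbT; apply/ler_addgt0Pr => e e0.
by rewrite add0r h.
Qed.

Lemma dist2E x y : dist2 x y = (sqn (x - y))%:E.
Proof. by rewrite sqn_integral /dist2; apply: eq_integral => t _; rewrite !HE. Qed.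

Definition conv (u : nat -> H) x := forall e : R, 0 < e ->
  exists N, forall m, (N <= m)%N -> hnorm (u m - x) <= e.

Definition cauchy (u : nat -> H) := forall e : R, 0 < e ->
  exists N, forall m, (N <= m)%N -> hnorm (u m - u N) <= e.

Lemma pow_small (r e : R) : 0 <= r < 1 -> 0 < e -> exists k : nat, r ^+ k <= e.
Proof.
move=> /andP[r0 r1] e0.
have /cvgr0Pnorm_le /(_ e e0) [k _ /(_ k (leqnn k)) /=] : (fun k => r ^+ k) @ \oo --> 0.
  have -> : (fun k => r ^+ k) = geometric 1 r by rewrite -exprn_geometric.
  by apply: cvg_geometric; rewrite ger0_norm.
by rewrite ger0_norm ?exprn_ge0// => h; exists k.
Qed.

Lemma conv_unique (u : nat -> H) x y : conv u x -> conv u y -> hnorm (x - y) = 0.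
Proof.
move=> ux uy; apply: le_all_eq0; first exact: hnorm_ge0.
move=> e e0; have e20 : 0 < e / 2 by rewrite divr_gt0.
have [N1 h1] := ux _ e20; have [N2 h2] := uy _ e20.
have := h1 _ (leq_maxl N1 N2); have := h2 _ (leq_maxr N1 N2).
set m := maxn _ _; have := hnorm_triangle x (u m) y; rewrite (hnormBC x (u m)); lra.
Qed.

Lemma H_complete (u : nat -> H) : cauchy u -> exists x, conv u x.
Proof.
move=> cu.
have h20 (k : nat) : 0 < (2^-1 : R) ^+ k.+1 by rewrite exprn_gt0.
have [N hN] := @boolp.choice _ _ (fun k N => forall m, (N <= m)%N ->
  hnorm (u m - u N) <= (2^-1 : R) ^+ k.+1) (fun k => cu _ (h20 k)).
(* The running maximum makes the chosen indices monotone. The tolerance [2 ^ - (k + 1)] in [hN] is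
   half of [2 ^ - k], because two terms are compared through [u (N k)]. *)
pose phi k := \max_(j < k.+1) N j.
have phiN k : (N k <= phi k)%N by exact: (leq_bigmax (Ordinal (ltnSn k))).
have phim j k : (j <= k)%N -> (phi j <= phi k)%N.
  move=> jk; apply/bigmax_leqP => i _.
  have ik : (i < k.+1)%N by exact: leq_trans (ltn_ord i) _.
  exact: (leq_bigmax (Ordinal ik)).
have key k m : (phi k <= m)%N -> hnorm (u m - u (phi k)) <= (2^-1 : R) ^+ k.
  move=> km; apply: (le_trans (hnorm_triangle _ (u (N k)) _)).
  have := hN k m (leq_trans (phiN k) km); have := hN k (phi k) (phiN k).
  rewrite (hnormBC (u (phi k))) exprS; lra.
have keyq j k : (j <= k)%N -> sqn (u (phi k) - u (phi j)) <= (4^-1) ^+ j.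
  move=> jk; rewrite -hnorm_sqr (_ : 4^-1 = (2^-1) ^+ 2 :> R); last by field.
  rewrite -exprM mulnC exprM ler_pXn2r ?nnegrE ?hnorm_ge0 ?exprn_ge0//.
  exact/key/phim.
have qle x : (sqi mu (fun t => Re (x t)) <= (sqn x)%:E)%E /\ (sqi mu (fun t => Im (x t)) <= (sqn x)%:E)%E.
  rewrite sqn_integral integral_csqnorm; last exact: H_meas.
  by split; [rewrite leeDl// sqi_ge0|rewrite leeDr// sqi_ge0].
have qr j k : (j <= k)%N -> (sqi mu (fun t => Re (u (phi k) t) - Re (u (phi j) t))%R <= ((4^-1) ^+ j)%:E)%E.
  move=> jk; have := (qle (u (phi k) - u (phi j))).1.
  have -> : (fun t => Re ((u (phi k) - u (phi j)) t)) = fun t => Re (u (phi k) t) - Re (u (phi j) t).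
    by apply/funext => t; rewrite !HE !cE.
  by move=> /le_trans; apply; rewrite lee_fin keyq.
have qi j k : (j <= k)%N -> (sqi mu (fun t => Im (u (phi k) t) - Im (u (phi j) t))%R <= ((4^-1) ^+ j)%:E)%E.
  move=> jk; have := (qle (u (phi k) - u (phi j))).2.
  have -> : (fun t => Im ((u (phi k) - u (phi j)) t)) = fun t => Im (u (phi k) t) - Im (u (phi j) t).
    by apply/funext => t; rewrite !HE !cE.
  by move=> /le_trans; apply; rewrite lee_fin keyq.
have [gr [Lr hr zr]] := L2_complete (fun k => (H_L2 (u (phi k))).1) qr.
have [gi [Li hi zi]] := L2_complete (fun k => (H_L2 (u (phi k))).2) qi.
have Lg : L2pos (fun t : RR => Complex (gr t) (gi t)).
  apply/L2posP; split=> // t t0.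
  by rewrite zr ?zi// => k; rewrite H_pos.
exists (MkH Lg) => e e0.
have [k hk] : exists k, (2^-1 : R) ^+ k <= e / 3.
  by apply: pow_small; [apply/andP; split; lra|rewrite divr_gt0].
exists (phi k) => m km.
apply: (le_trans (hnorm_triangle _ (u (phi k)) _)).
have h1 := key k m km.
have h2 : hnorm (u (phi k) - MkH Lg) <= 2 * (2^-1 : R) ^+ k.
  apply: hnorm_le; first by rewrite mulr_ge0// exprn_ge0.
  rewrite -lee_fin sqn_integral integral_csqnorm; last exact: H_meas.
  have -> : ((2 * (2^-1 : R) ^+ k) ^+ 2)%:E = ((4 * (4^-1) ^+ k)%:E)%E :> \bar R.
    rewrite exprMn -exprM mulnC exprM (_ : (2^-1) ^+ 2 = 4^-1 :> R); last by field.
    by congr EFin; ring.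
  apply: (@le_trans _ _ (((4^-1) ^+ k)%:E + ((4^-1) ^+ k)%:E)%E); last first.
    rewrite -EFinD lee_fin; have : 0 <= (4^-1 : R) ^+ k by rewrite exprn_ge0. lra.
  apply: leeD.
  - apply: le_trans (hr k); rewrite /sqi.
    by under eq_integral do rewrite HDE HNE cReD cReN /=.
  - apply: le_trans (hi k); rewrite /sqi.
    by under eq_integral do rewrite HDE HNE cImD cImN /=.
lra.
Qed.

(** * Coercive equations, and the uniform boundedness argument *)

(** For a suitable [th > 0] the map [h - th (Q h - y)] is a contraction, and the limit of its
    iterates solves the equation up to a null element. *)
Lemma zarantonello (Q : H -> H) (d K : R) :
  (forall x y, Q (x - y) = Q x - Q y) ->
  (forall (r : R) x, Q (r%:C%C *: x) = r%:C%C *: Q x) ->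
  0 < d -> 0 < K -> (forall x, hnorm (Q x) <= K * hnorm x) ->
  (forall x, d * sqn x <= ip (Q x) x) -> forall y, exists h, hnorm (Q h - y) = 0.
Proof.
move=> QB QZ d0 K0' QK' Qd y.
(* Enlarging the bound by [d] gives [d / L < 1], so that the contraction factor [r] is a genuine
   square root. *)
pose L := K + d.
have L0 : 0 < L by rewrite addr_gt0.
have QL x : hnorm (Q x) <= L * hnorm x.
  by apply: (le_trans (QK' x)); rewrite ler_wpM2r ?hnorm_ge0// lerDl ltW.
(* This value minimizes [1 - 2 th d + th^2 L^2], the bound for the squared contraction factor; the
   minimum is [1 - (d / L)^2]. *)
pose th : R := d / L ^+ 2.
have th0 : 0 < th by rewrite divr_gt0// exprn_gt0.
pose J h := h - th%:C%C *: (Q h - y).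
pose r := Num.sqrt (1 - (d / L) ^+ 2).
have dL : 0 < d / L < 1.
  by rewrite divr_gt0//= ltr_pdivrMr// mul1r ltrDr.
have r2 : r ^+ 2 = 1 - (d / L) ^+ 2.
  rewrite sqr_sqrtr// subr_ge0 expr_le1//; first by case/andP: dL => _ /ltW.
  by case/andP: dL => /ltW.
have r01 : 0 <= r < 1.
  rewrite sqrtr_ge0/= -(@ltr_pXn2r _ 2) ?nnegrE ?sqrtr_ge0// r2 expr1n.
  by rewrite ltrBlDr ltrDl exprn_gt0//; case/andP: dL.
have Jc x z : hnorm (J x - J z) <= r * hnorm (x - z).
  have -> : J x - J z = (x - z) - th%:C%C *: Q (x - z).
    by apply: H_ext => t; rewrite QB /J !HE; ring.
  apply: hnorm_le; first by rewrite mulr_ge0 ?hnorm_ge0//; case/andP: r01.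
  move: (x - z) => w; rewrite exprMn r2 hnorm_sqr.
  rewrite sqnD ipNr ipZr (ipC w) -[sqn (- _)]hnorm_sqr hnormN hnormZ cabsR exprMn.
  rewrite (ger0_norm (ltW th0)).
  have h1 := Qd w; have h2 : hnorm (Q w) ^+ 2 <= L ^+ 2 * sqn w.
    by rewrite -hnorm_sqr -exprMn ler_pXn2r ?nnegrE ?mulr_ge0 ?hnorm_ge0 ?(ltW L0).
  have h3 : th ^+ 2 * hnorm (Q w) ^+ 2 <= th ^+ 2 * (L ^+ 2 * sqn w) by rewrite ler_wpM2l ?sqr_ge0.
  have h4 : th * (d * sqn w) <= th * ip (Q w) w by rewrite ler_wpM2l// ltW.
  have e1 : th * d = (d / L) ^+ 2 by rewrite /th; field; rewrite gt_eqF.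
  have e2 : th ^+ 2 * L ^+ 2 = (d / L) ^+ 2 by rewrite /th; field; rewrite gt_eqF.
  rewrite mulrA e2 in h3; rewrite mulrA e1 in h4; rewrite mulrBl mul1r; lra.
pose u k := iter k J 0.
pose c := hnorm (u 1%N - u 0%N).
have c0 : 0 <= c by exact: hnorm_ge0.
have r0 : 0 <= r by case/andP: r01.
have r1 : 0 < 1 - r by rewrite subr_gt0; case/andP: r01.
have st k : hnorm (u k.+1 - u k) <= r ^+ k * c.
  elim: k => [|k IH]; first by rewrite mul1r.
  by rewrite exprS -mulrA; apply: (le_trans (Jc _ _)); rewrite ler_wpM2l.
have far k m : hnorm (u (k + m)%N - u k) <= r ^+ k * c / (1 - r) * (1 - r ^+ m).
  elim: m => [|m IH]; first by rewrite addn0 !subrr hnorm0 mulr0.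
  apply: (le_trans (hnorm_triangle _ (u (k + m)%N) _)).
  have := st (k + m)%N; rewrite -addnS exprD => h.
  have e : r ^+ k * r ^+ m * c = r ^+ k * c / (1 - r) * (r ^+ m - r ^+ m.+1).
    by rewrite exprS; field; rewrite gt_eqF.
  rewrite e in h; lra.
have cu : cauchy u.
  move=> e e0.
  have [N hN] : exists N, r ^+ N <= e / (c / (1 - r) + 1).
    by apply: pow_small => //; rewrite divr_gt0// ltr_wpDl// divr_ge0// ltW.
  exists N => m Nm; rewrite -(subnKC Nm).
  apply: (le_trans (far _ _)).
  have p0 : 0 <= c / (1 - r) by rewrite divr_ge0// ltW.
  have p1 : 0 < c / (1 - r) + 1 by rewrite ltr_wpDl.
  rewrite ler_pdivlMr// in hN; set P := c / (1 - r) in p0 p1 hN.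
  have s0 : 0 <= r ^+ (m - N) by rewrite exprn_ge0.
  have t0 : 0 <= r ^+ N by rewrite exprn_ge0.
  have -> : r ^+ N * c / (1 - r) = r ^+ N * P by rewrite /P mulrA.
  have : 0 <= r ^+ N * P * r ^+ (m - N) by apply: mulr_ge0 => //; exact: mulr_ge0.
  lra.
have [h hc] := H_complete cu.
exists h; apply: le_all_eq0; first exact: hnorm_ge0.
move=> e e0.
pose e1 := e / 3 / (L + th^-1 + th^-1).
have D0 : 0 < L + th^-1 + th^-1 by rewrite !addr_gt0 ?invr_gt0.
have e10 : 0 < e1 by rewrite !divr_gt0.
have [N hN] := hc _ e10.
have a1 := hN N (leqnn N); have a2 := hN N.+1 (leqnSn N).
have uE : Q (u N) - y = th^-1%:C%C *: (u N - u N.+1).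
  apply: H_ext => t; rewrite /= -/(u N) !mulN1r.
  have -> : th^-1%:C%C = (th%:C%C)^-1 :> C by rewrite fmorphV.
  by field; rewrite (inj_eq (@complexI R) th 0) gt_eqF.
have b1 : hnorm (Q h - Q (u N)) <= L * e1.
  by rewrite -QB; apply: (le_trans (QL _)); rewrite hnormBC ler_pM2l.
have b2 : hnorm (Q (u N) - y) <= th^-1 * (e1 + e1).
  rewrite uE hnormZ cabsR ger0_norm ?invr_ge0 ?(ltW th0)//.
  rewrite ler_pM2l ?invr_gt0//; apply: (le_trans (hnorm_triangle _ h _)).
  by rewrite (hnormBC h) lerD.
apply: (le_trans (hnorm_triangle _ (Q (u N)) _)).
have -> : e = 3 * (e1 * (L + th^-1 + th^-1)) by rewrite /e1 divfK ?gt_eqF//; field.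
have : 0 < e1 * (L + th^-1 + th^-1) by rewrite mulr_gt0.
lra.
Qed.

(* Sokal's argument for the uniform boundedness principle: the signs are chosen
   one at a time so that the k-th functional stays large on the whole sum. *)
Lemma gliding_hump (U : R -> H -> Prop) :
  (forall e : R, 0 < e -> exists u, U e u /\ hnorm u = 1) ->
  exists y, forall M, exists e u, [/\ 0 < e, U e u & e * M < `|ip u y|].
Proof.
move=> hU.
(* The steps have length [p k = 3 ^ - k], and all steps after the k-th sum to at most [p k / 2], so
   the k-th functional keeps at least [p k / 2] on the limit. Since [p k / ek k = 2 ^ k], this
   exceeds [ek k * M] for large [k]. *)
pose ek (k : nat) : R := (6^-1) ^+ k.
have ek0 k : 0 < ek k by rewrite exprn_gt0.
have [v hv] := @boolp.choice _ _ (fun k u => U (ek k) u /\ hnorm u = 1) (fun k => hU _ (ek0 k)).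
pose p (k : nat) : R := (3^-1) ^+ k.
have p0 k : 0 < p k by rewrite exprn_gt0.
pose st k (y : H) : H := if 0 <= ip (v k) y then y + (p k)%:C%C *: v k else y - (p k)%:C%C *: v k.
pose fix y k := if k is k'.+1 then st k' (y k') else 0.
have ipv k : ip (v k) (v k) = 1 by rewrite -/(sqn _) -hnorm_sqr (hv k).2 expr1n.
have big k : p k <= `|ip (v k) (y k.+1)|.
  rewrite /= /st; case: ifP => h.
    by rewrite ipDr ipZr ipv mulr1 ger0_norm ?lerDr// addr_ge0// ltW.
  move/negbT : h; rewrite -ltNge => h.
  rewrite ipDr ipNr ipZr ipv mulr1 ler0_norm; first by rewrite opprD opprK lerDr oppr_ge0 ltW.
  by rewrite subr_le0 (le_trans (ltW h))// ltW.
have stp k : hnorm (y k.+1 - y k) <= p k.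
  rewrite /= /st; case: ifP => h.
    by rewrite addrAC subrr add0r hnormZ (hv k).2 mulr1 cabsR ger0_norm// ltW.
  by rewrite addrAC subrr add0r hnormN hnormZ (hv k).2 mulr1 cabsR ger0_norm// ltW.
have far k m : hnorm (y (k + m)%N - y k) <= 3 / 2 * (p k - p (k + m)%N).
  elim: m => [|m IH]; first by rewrite addn0 !subrr hnorm0 mulr0.
  rewrite addnS; apply: (le_trans (hnorm_triangle _ (y (k + m)%N) _)).
  have := stp (k + m)%N; have -> : p (k + m).+1 = 3^-1 * p (k + m)%N by rewrite /p exprS.
  lra.
have cy : cauchy y.
  move=> e e0.
  have [N hN] : exists N, p N <= e / 2.
    by apply: pow_small; [apply/andP; split; lra|rewrite divr_gt0].
  exists N => m Nm; rewrite -(subnKC Nm); apply: (le_trans (far _ _)).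
  have := p0 (N + (m - N))%N; lra.
have [z hz] := H_complete cy.
exists z => M.
have tail k : hnorm (y k.+1 - z) <= 2^-1 * p k.
  apply/ler_addgt0Pr => e e0; have [N hN] := hz _ e0.
  pose m := (k.+1 + N)%N.
  apply: (le_trans (hnorm_triangle _ (y m) _)); rewrite hnormBC.
  have := far k.+1 N; have := hN m (leq_addl _ _); have := p0 m; rewrite -/m.
  have -> : p k.+1 = 3^-1 * p k by rewrite /p exprS.
  lra.
have low k : 2^-1 * p k <= `|ip (v k) z|.
  have := big k; have := ip_CS (v k) (y k.+1 - z).
  rewrite (hv k).2 mul1r ipDr ipNr => h1 h2; have := tail k.
  have := ler_normB (ip (v k) (y k.+1) - ip (v k) z) (- ip (v k) z).
  rewrite opprK subrK normrN; lra.
have [k hk] : exists k, (2^-1 : R) ^+ k <= (4 * (`|M| + 1))^-1.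
  apply: pow_small; first by apply/andP; split; lra.
  by rewrite invr_gt0 mulr_gt0// ltr_wpDl.
exists (ek k), (v k); split=> //; first exact: (hv k).1.
apply: lt_le_trans (low k).
have -> : ek k = (2^-1) ^+ k * p k by rewrite -exprMn /ek; congr (_ ^+ _); field.
rewrite mulrAC ltr_pM2r//.
apply: (@le_lt_trans _ _ ((2^-1) ^+ k * (`|M| + 1))).
  by rewrite ler_wpM2l ?exprn_ge0// (le_trans (ler_norm M))// lerDl.
apply: (@le_lt_trans _ _ ((4 * (`|M| + 1))^-1 * (`|M| + 1))).
  by rewrite ler_wpM2r// addr_ge0.
have : `|M| + 1 != 0 by rewrite gt_eqF// ltr_wpDl.
by move=> ?; rewrite invfM mulrVK ?unitfE//; lra.
Qed.

End Space.

(** * The Carleman operator *)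

Section Carleman.
Variable R : realType.
Local Notation C := R[i].
Local Notation mu := (@lebesgue_measure R).
Local Notation RI := (Rintegral mu setT).
Local Notation RR := (measurableTypeR R).

(** * Measurability of parametric integrals, and the Schur test *)

Lemma meas_id : meas (fun x : RR => x : R).
Proof. exact: measurable_id. Qed.

Lemma meas_fst : meas (fun z : RR * RR => z.1 : R).
Proof. exact: (measurableT_comp meas_id measurable_fst). Qed.

Lemma meas_snd : meas (fun z : RR * RR => z.2 : R).
Proof. exact: (measurableT_comp meas_id measurable_snd). Qed.

Lemma meas_inv : meas (fun x : R => x^-1).
Proof.
have -> : (fun x : R => x^-1) =
    fun x => if 0 < x then expR (- ln x) else if x < 0 then - expR (- ln (- x)) else 0.
  apply/funext => x; case: ltgtP => [x0|x0|<-]; last by rewrite invr0.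
    by rewrite expRN lnK ?posrE.
  by rewrite expRN lnK ?posrE ?oppr_gt0// invrN opprK.
apply: measurable_fun_ifT; first exact: measurable_fun_ltr.
  by apply: measurableT_comp => //; apply: measurableT_comp => //; exact: measurable_ln.
apply: measurable_fun_ifT; [exact: measurable_fun_ltr| |exact: measurable_cst].
apply: measurableT_comp => //; apply: measurableT_comp => //; apply: measurableT_comp => //.
by apply: (measurableT_comp (@measurable_ln R)).
Qed.

Lemma meas_section1 d (U : measurableType d) (h : RR * RR -> U) (s : RR) : meas h ->
  meas (fun t => h (s, t)).
Proof. by move=> mh; exact: (measurableT_comp mh). Qed.

Lemma meas_section2 d (U : measurableType d) (h : RR * RR -> U) (t : RR) : meas h ->
  meas (fun s => h (s, t)).
Proof. by move=> mh; exact: (measurableT_comp mh). Qed.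

Lemma rint_notin (f : RR -> R) : meas f -> (forall x, 0 <= f x) ->
  ~ rint mu f -> (\int[mu]_x (f x)%:E = +oo)%E.
Proof.
move=> mf f0 nf; apply/eqP; rewrite -leye_eq leNgt; apply/negP => h.
by apply: nf; exact: rint_fin.
Qed.

(** Tonelli gives measurability for nonnegative integrands; [h] is the difference of [|h| + h] and
    [|h|]. *)
Lemma meas_RI (h : RR * RR -> R) : meas h ->
  (forall s, rint mu (fun t => h (s, t))) ->
  meas (fun s : RR => RI (fun t => h (s, t))).
Proof.
have pos (k : RR * RR -> R) : meas k -> (forall z, 0 <= k z) ->
    (forall s, rint mu (fun t => k (s, t))) ->
    meas (fun s : RR => RI (fun t => k (s, t))).
  move=> mk k0 ik; apply/measurable_EFinP.
  have -> : EFin \o (fun s : RR => RI (fun t => k (s, t))) =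
      fun s => (\int[mu]_t (k (s, t))%:E)%E.
    by apply/funext => s /=; rewrite RI_E.
  by apply: (measurable_fun_fubini_tonelli_F (fun z => (k z)%:E)) => //; exact/measurable_EFinP.
move=> mh ih.
have mn : meas (fun z => `|h z|) by apply: measurableT_comp.
have i1 s : rint mu (fun t => `|h (s, t)|) by exact: rint_norm.
have i2 s : rint mu (fun t => `|h (s, t)| + h (s, t)) by exact: rintD.
have -> : (fun s : RR => RI (fun t => h (s, t))) = fun s =>
    RI (fun t => `|h (s, t)| + h (s, t)) - RI (fun t => `|h (s, t)|).
  apply/funext => s.
  rewrite (@RintegralD _ _ _ mu setT (fun t => `|h (s, t)|) (fun t => h (s, t)) measurableT (i1 s) (ih s)).
  by rewrite addrAC subrr add0r.
apply: measurable_funB.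
  apply: (pos (fun z => `|h z| + h z)) => //; first exact: measurable_funD.
  by move=> z; rewrite -lerBlDr sub0r -normrN ler_norm.
exact: (pos (fun z => `|h z|)).
Qed.

(** Cauchy-Schwarz for [K g = (K w)^(1/2) * (K / w)^(1/2) g] bounds the square of the integral at
    [s] by [w s] times the integral of [K g^2 / w]. Integrating over [s] and exchanging the order
    uses the second bound on [K w], which cancels the weight. *)
Lemma schur (K : RR * RR -> R) (w g : RR -> R) :
  meas K -> meas w -> meas g ->
  (forall z, 0 <= K z) -> (forall t, 0 < w t) ->
  (forall s, rint mu (fun t => K (s, t) * w t)) ->
  (forall s, RI (fun t => K (s, t) * w t) <= w s) ->
  (forall t, rint mu (fun s => K (s, t) * w s)) ->
  (forall t, RI (fun s => K (s, t) * w s) <= w t) ->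
  (forall s, rint mu (fun t => K (s, t) * g t)) ->
  (sqi mu (fun s => RI (fun t => K (s, t) * g t)%R) <= sqi mu g)%E.
Proof.
move=> mK mw mg K0 w0 i1 I1 i2 I2 ig.
have mw1 : meas (fun z : RR * RR => w z.1) by exact: (measurableT_comp mw).
have mw2 : meas (fun z : RR * RR => w z.2) by exact: (measurableT_comp mw).
have mg2 : meas (fun z : RR * RR => g z.2) by exact: (measurableT_comp mg).
have mwV : meas (fun z : RR * RR => (w z.2)^-1).
  exact: (measurableT_comp meas_inv mw2).
pose L (z : RR * RR) := w z.1 * (K z * (g z.2 ^+ 2 * (w z.2)^-1)).
have mB : meas (fun z : RR * RR => g z.2 ^+ 2 * (w z.2)^-1).
  apply: measurable_funM; last exact: mwV.
  exact: measurable_funX.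
have mL : meas L.
  by apply: measurable_funM => //; exact: measurable_funM.
have B0 t : 0 <= g t ^+ 2 * (w t)^-1 by rewrite mulr_ge0 ?sqr_ge0// invr_ge0 ltW.
have L0 z : 0 <= L z by rewrite /L mulr_ge0 ?(ltW (w0 _))// mulr_ge0.
have mKg : meas (fun z => K z * g z.2) by exact: measurable_funM.
have pw s : (((RI (fun t => K (s, t) * g t)) ^+ 2)%:E <=
    \int[mu]_t (L (s, t))%:E)%E.
  have mKs : meas (fun t => K (s, t) * (g t ^+ 2 * (w t)^-1)).
    exact: (meas_section1 s (measurable_funM mK mB)).
  have [iB|hnormB] := pselect (rint mu (fun t => K (s, t) * (g t ^+ 2 * (w t)^-1))).
    rewrite /L /= -RI_E; last exact: rintZ.
    rewrite RintegralZl// lee_fin.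
    set B := RI (fun t => K (s, t) * (g t ^+ 2 * (w t)^-1)).
    set A := RI (fun t => K (s, t) * w t).
    have B0' : 0 <= B by apply: Rintegral_ge0 => t _; rewrite mulr_ge0.
    apply: (@le_trans _ _ (A * B)); last by apply: ler_wpM2r => //; exact: I1.
    apply: quad_disc => // [|r].
      by apply: Rintegral_ge0 => t _; rewrite mulr_ge0// ltW.
    have -> : A + r * (2 * RI (fun t => K (s, t) * g t)) + r ^+ 2 * B =
        RI (fun t => K (s, t) * ((w t)^-1 * (w t + r * g t) ^+ 2)).
      have -> : RI (fun t => K (s, t) * ((w t)^-1 * (w t + r * g t) ^+ 2)) =
          RI (fun t => K (s, t) * w t + ((r * 2) * (K (s, t) * g t) +
            r ^+ 2 * (K (s, t) * (g t ^+ 2 * (w t)^-1)))).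
        by apply: eq_Rintegral => t _; field; exact: lt0r_neq0.
      rewrite RintegralD//; [|exact: i1|by apply: rintD; exact: rintZ].
      rewrite RintegralD//; [|exact: rintZ|exact: rintZ].
      rewrite (@RintegralZl _ _ _ mu setT _ (r * 2) measurableT (ig s)).
      rewrite (@RintegralZl _ _ _ mu setT _ (r ^+ 2) measurableT iB) -/A -/B.
      by rewrite mulrA addrA.
    apply: Rintegral_ge0 => t _; rewrite mulr_ge0// mulr_ge0 ?sqr_ge0//.
    by rewrite invr_ge0 ltW.
  (* If [K g^2 / w] is not integrable at this [s], the right-hand side is infinite. *)
  have -> : (\int[mu]_t (L (s, t))%:E = +oo)%E; last exact: leey.
  apply: rint_notin => //; first exact: (meas_section1 s mL).
  move=> iL; apply: hnormB.
  have -> : (fun t : RR => K (s, t) * (g t ^+ 2 * (w t)^-1)) = fun t => (w s)^-1 * L (s, t).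
    by apply/funext => t; rewrite /L /= mulKf// gt_eqF.
  exact: rintZ.
apply: (@le_trans _ _ (\int[mu]_s \int[mu]_t (L (s, t))%:E)%E).
  apply: ge0_le_integral => //.
  - by move=> s _; rewrite lee_fin sqr_ge0.
  - apply/measurable_EFinP/measurable_funX.
    exact: (meas_RI mKg).
  - by apply: (measurable_fun_fubini_tonelli_F (fun z => (L z)%:E)) => //; exact/measurable_EFinP.
rewrite (fubini_tonelli (fun z => (L z)%:E))//; last exact/measurable_EFinP.
apply: ge0_le_integral => //.
- by move=> t _; apply: integral_ge0 => s _; rewrite lee_fin.
- apply: (measurable_fun_fubini_tonelli_G (fun z => (L z)%:E)) => //; exact/measurable_EFinP.
- exact/measurable_EFinP/measurable_funX.
- move=> t _.
  have -> : (fun s : RR => (L (s, t))%:E) = fun s => ((g t ^+ 2 * (w t)^-1) * (K (s, t) * w s))%:E.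
    by apply/funext => s; rewrite /L /=; congr EFin; ring.
  rewrite -RI_E; last exact: rintZ.
  rewrite lee_fin.
  apply: (@le_trans _ _ (g t ^+ 2 * (w t)^-1 * RI (fun s => K (s, t) * w s))).
    by rewrite -(@RintegralZl _ _ _ mu setT _ _ measurableT (i2 t)).
  apply: (@le_trans _ _ (g t ^+ 2 * (w t)^-1 * w t)); first exact: ler_wpM2l.
  by rewrite mulfVK// gt_eqF.
Qed.

Lemma rint_scale_inv (a : R) (f : RR -> R) : 0 < a -> rint mu (fun x => f (a * x)) -> rint mu f.
Proof.
move=> a0 h; have := @rint_scale R a^-1 (fun x => f (a * x)); rewrite invr_gt0 => /(_ a0 h).
by congr (rint _ _); apply/funext => x; rewrite mulVKf// gt_eqF.
Qed.

(** * The Carleman kernel: bound and symmetry of its operator *)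

Definition kern (s t : R) : R := if (0 < s) && (0 < t) then (pi * (s + t))^-1 else 0.

Lemma kernC s t : kern s t = kern t s.
Proof. by rewrite /kern andbC addrC. Qed.

Lemma kern_ge0 s t : 0 <= kern s t.
Proof.
rewrite /kern; case: ifP => // /andP[s0 t0].
by rewrite invr_ge0 mulr_ge0 ?pi_ge0// ltW// addr_gt0.
Qed.

Lemma meas_kern : meas (fun z : RR * RR => kern z.1 z.2).
Proof.
rewrite /kern; apply: measurable_fun_ifT => //.
- by apply: measurable_and; apply: measurable_fun_ltr.
- apply: (measurableT_comp meas_inv).
  apply: measurable_funM => //; apply: measurable_funD; [exact: meas_fst|exact: meas_snd].
Qed.

Lemma meas_kern1 (s : R) : meas (fun t : RR => kern s t).
Proof. exact: (meas_section1 s meas_kern). Qed.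

(** From [(s + t)^2 >= s^2 + t^2], the square is dominated by a Poisson integrand centred at 0.
    Hence the integral defining the Carleman operator converges absolutely at every [s], not only at
    almost every one. *)
Lemma kern_L2 (s : R) : L2 mu (fun t : RR => kern s t).
Proof.
have [s0|s0] := ltP 0 s; last first.
  have -> : (fun t : RR => kern s t) = fun=> 0.
    by apply/funext => t; rewrite /kern ltNge s0.
  split=> //; rewrite /sqi; under eq_integral do rewrite expr0n/=.
  by rewrite integral0.
split; first exact: meas_kern1.
have [i1 _] := poisson_int 0 s0.
have i2 : rint mu (fun t => kern s t ^+ 2).
  apply: (rint_le _ (rintZ (s^-1 * pi ^- 2) i1)).
    apply: measurable_funX; exact: meas_kern1.
  move=> t; rewrite ger0_norm ?sqr_ge0// /kern s0/=; case: ifP => t0; last first.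
    by rewrite expr0n/= mulr0.
  rewrite sub0r sqrrN.
  have d1 : 0 < s ^+ 2 + t ^+ 2 by rewrite addr_gt0 ?exprn_gt0.
  have p0 := @pi_gt0 R.
  move: (@pi R) p0 => p p0.
  have -> : s^-1 * p ^- 2 * (s / (s ^+ 2 + t ^+ 2)) = (p ^+ 2 * (s ^+ 2 + t ^+ 2))^-1.
    by field; rewrite !gt_eqF.
  have a0 : 0 < p ^+ 2 * (s ^+ 2 + t ^+ 2) by rewrite mulr_gt0// exprn_gt0.
  have b0 : 0 < (p * (s + t)) ^+ 2 by rewrite exprn_gt0// mulr_gt0// addr_gt0.
  rewrite exprVn lef_pV2 ?posrE// exprMn ler_pM2l ?exprn_gt0// sqrrD.
  have := mulr_gt0 s0 t0; lra.
exact: (integrable_lty _ i2).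
Qed.

(* The Schur weight [t^(-1/2)], extended by 1 so that it is positive everywhere. *)
Definition schur_wt (t : R) : R := if 0 < t then pw (- 2^-1) t else 1.

Lemma meas_pw (p : R) : meas (fun t : RR => pw p t).
Proof.
rewrite /pw; apply: (@measurableT_comp _ _ _ _ _ _ (@expR R)) => //.
by apply: measurable_funM => //; apply: (@measurableT_comp _ _ _ _ _ _ (@ln R)).
Qed.

Lemma meas_schur_wt : meas (fun t : RR => schur_wt t).
Proof.
rewrite /schur_wt; apply: measurable_fun_ifT => //.
- by apply: measurable_fun_ltr => //; exact: meas_id.
- exact: meas_pw.
Qed.

Lemma schur_wt_gt0 t : 0 < schur_wt t.
Proof. by rewrite /schur_wt; case: ifP => // _; exact: pw_gt0. Qed.

Lemma sqrt_kern_int :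
  rint mu (fun u : RR => if 0 < u then pw (- 2^-1) u / (pi * (1 + u)) else 0) /\
  RI (fun u : RR => if 0 < u then pw (- 2^-1) u / (pi * (1 + u)) else 0) = 1.
Proof.
have h0 : 0 < 2^-1 :> R by rewrite invr_gt0.
have [i I] := pw_atan_int h0.
have p0 : pi != 0 :> R by rewrite gt_eqF// pi_gt0.
have E : (fun u : RR => if 0 < u then pw (- 2^-1) u / (pi * (1 + u)) else 0) =
   fun u => (2 / pi) * (if 0 < u then 2^-1 * pw (2^-1 - 1) u / (1 + pw (2 * 2^-1) u) else 0).
  apply/funext => u; case: ifP => u0; last by rewrite mulr0.
  have -> : 2 * 2^-1 = 1 :> R by field.
  have -> : 2^-1 - 1 = - 2^-1 :> R by field.
  have u1 : 1 + u != 0 by rewrite gt_eqF// addr_gt0.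
  by rewrite pw1//; move: (@pi R) p0 => p p0; field; rewrite ?p0 ?u1.
split; first by rewrite E; exact: rintZ.
by rewrite E RintegralZl// I; move: (@pi R) p0 => p p0; field.
Qed.

(** The kernel is homogeneous of degree -1, so [t = s u] reduces every [s > 0] to [sqrt_kern_int],
    with equality; for [s <= 0] the kernel vanishes. *)
Lemma kern_schur_wt (s : R) : rint mu (fun t : RR => kern s t * schur_wt t) /\
  RI (fun t : RR => kern s t * schur_wt t) <= schur_wt s.
Proof.
have [s0|s0] := ltP 0 s; last first.
  have E : (fun t : RR => kern s t * schur_wt t) = fun=> 0.
    by apply/funext => t; rewrite /kern ltNge s0 mul0r.
  rewrite E; split; first exact: rint0.
  by rewrite Rintegral_cst// mul0r ltW// schur_wt_gt0.
have [i I] := sqrt_kern_int.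
have p0 : pi != 0 :> R by rewrite gt_eqF// pi_gt0.
have E : (fun u : RR => kern s (s * u) * schur_wt (s * u)) =
    fun u => (pw (- 2^-1) s * s^-1) * (if 0 < u then pw (- 2^-1) u / (pi * (1 + u)) else 0).
  apply/funext => u; rewrite /kern /schur_wt s0 /= pmulr_rgt0//.
  case: ifP => u0; last by rewrite mul0r mulr0.
  have u1 : 1 + u != 0 by rewrite gt_eqF// addr_gt0.
  have s1 : s != 0 by rewrite gt_eqF.
  have u2 : s + s * u != 0 by rewrite gt_eqF// addr_gt0// mulr_gt0.
  by rewrite pwM//; move: (@pi R) p0 => p p0; field; rewrite ?p0 ?u1 ?u2 ?s1.
have i' : rint mu (fun u : RR => kern s (s * u) * schur_wt (s * u)) by rewrite E; exact: rintZ.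
have i'' := @rint_scale_inv s (fun t => kern s t * schur_wt t) s0 i'.
split=> //; rewrite (RI_scale s0 i'') E RintegralZl// I mulr1 mulrCA mulfV ?gt_eqF// mulr1.
by rewrite /schur_wt s0.
Qed.

Lemma kern_g_rint (s : R) (g : RR -> R) : L2 mu g -> rint mu (fun t => kern s t * g t).
Proof. by move=> Lg; apply: L2_mul => //; exact: kern_L2. Qed.

Lemma kern_schur (g : RR -> R) : L2 mu g ->
  L2 mu (fun s : RR => RI (fun t => kern s t * g t)) /\
  (sqi mu (fun s => RI (fun t => kern s t * g t)%R) <= sqi mu g)%E.
Proof.
move=> Lg; have mg : meas g by case: Lg.
have mk : meas (fun z : RR * RR => kern z.1 z.2 * g z.2).
  by apply: measurable_funM; [exact: meas_kern|exact: (measurableT_comp mg)].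
have S : (sqi mu (fun s => RI (fun t => kern s t * g t)%R) <= sqi mu g)%E.
  apply: (@schur (fun z => kern z.1 z.2) schur_wt) => //=.
  - exact: meas_kern.
  - exact: meas_schur_wt.
  - by move=> z; exact: kern_ge0.
  - exact: schur_wt_gt0.
  - by move=> s; exact: (kern_schur_wt s).1.
  - by move=> s; exact: (kern_schur_wt s).2.
  - by move=> t; under eq_fun do rewrite kernC; exact: (kern_schur_wt t).1.
  - by move=> t; under eq_Rintegral do rewrite kernC; exact: (kern_schur_wt t).2.
  - by move=> s; exact: kern_g_rint.
split=> //; split; last by apply: (le_lt_trans S); case: Lg.
by apply: (meas_RI mk) => s; exact: kern_g_rint.
Qed.

Definition carleman_fun (x : RR -> C) (s : RR) : C := cI (fun t => (kern s t)%:C%C * x t).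

Lemma carleman_cint (x : H R) s : cint (fun t => (kern s t)%:C%C * x t).
Proof.
have [a b] := H_L2 x; split.
- have -> : (fun t : RR => Re ((kern s t)%:C%C * x t)) = fun t => kern s t * Re (x t).
    by apply/funext => t; rewrite cReM /=; ring.
  exact: kern_g_rint.
- have -> : (fun t : RR => Im ((kern s t)%:C%C * x t)) = fun t => kern s t * Im (x t).
    by apply/funext => t; rewrite cImM /=; ring.
  exact: kern_g_rint.
Qed.

Lemma carleman_Re (x : H R) s : Re (carleman_fun x s) = RI (fun t => kern s t * Re (x t)).
Proof. by apply: eq_Rintegral => t _; rewrite cReM /=; ring. Qed.

Lemma carleman_Im (x : H R) s : Im (carleman_fun x s) = RI (fun t => kern s t * Im (x t)).
Proof. by apply: eq_Rintegral => t _; rewrite cImM /=; ring. Qed.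

Lemma carleman_L2pos (x : H R) : L2pos (carleman_fun x).
Proof.
have [a b] := H_L2 x; apply/L2posP; split.
- have -> : (fun t => Re (carleman_fun x t)) = fun s : RR => RI (fun t => kern s t * Re (x t)).
    by apply/funext => s; exact: carleman_Re.
  exact: (kern_schur a).1.
- have -> : (fun t => Im (carleman_fun x t)) = fun s : RR => RI (fun t => kern s t * Im (x t)).
    by apply/funext => s; exact: carleman_Im.
  exact: (kern_schur b).1.
- move=> s s0; rewrite /carleman_fun; have -> : (fun t : RR => (kern s t)%:C%C * x t) = fun=> 0%:C%C.
    by apply/funext => t; rewrite /kern ltNge s0 mul0r.
  by rewrite cIR Rintegral_cst// mul0r.
Qed.

Definition carleman (x : H R) : H R := MkH (carleman_L2pos x).

Lemma carlemanD x y : carleman (x + y) = carleman x + carleman y.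
Proof.
apply: H_ext => s; rewrite HDE /= /carleman_fun -cID; [|exact: carleman_cint|exact: carleman_cint].
by apply: eq_cI => t; rewrite mulrDr.
Qed.

Lemma carlemanZ k x : carleman (k *: x) = k *: carleman x.
Proof.
apply: H_ext => s; rewrite HZE /= /carleman_fun -cIZ; last exact: carleman_cint.
by apply: eq_cI => t; rewrite mulrCA.
Qed.

Lemma carlemanN x : carleman (- x) = - carleman x.
Proof. by rewrite -scaleN1r carlemanZ scaleN1r. Qed.

Lemma carlemanB x y : carleman (x - y) = carleman x - carleman y.
Proof. by rewrite carlemanD carlemanN. Qed.

Lemma carleman_contr x : hnorm (carleman x) <= hnorm x.
Proof.
have [a b] := H_L2 x.
rewrite /hnorm ler_sqrt ?sqn_ge0// -lee_fin !sqn_integral !integral_csqnorm; [|exact: H_meas|exact: H_meas].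
apply: leeD.
- have -> : (fun t => Re (carleman x t)) = fun s : RR => RI (fun t => kern s t * Re (x t)).
    by apply/funext => s; exact: carleman_Re.
  exact: (kern_schur a).2.
- have -> : (fun t => Im (carleman x t)) = fun s : RR => RI (fun t => kern s t * Im (x t)).
    by apply/funext => s; exact: carleman_Im.
  exact: (kern_schur b).2.
Qed.

Lemma ip_cI (x y : H R) : cint (fun t => x t * (y t)^*%C) /\ ip x y = Re (cI (fun t => x t * (y t)^*%C)).
Proof.
have [a b] := H_L2 x; have [c d] := H_L2 y; split.
  split.
  - have -> : (fun t => Re (x t * (y t)^*%C)) = fun t => Re (x t) * Re (y t) + Im (x t) * Im (y t).
      by apply/funext => t; rewrite !cE; ring.
    by apply: rintD; exact: L2_mul.
  - have -> : (fun t => Im (x t * (y t)^*%C)) = fun t => Im (x t) * Re (y t) - Re (x t) * Im (y t).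
      by apply/funext => t; rewrite !cE; ring.
    by apply: rintB; exact: L2_mul.
by apply: eq_Rintegral => t _; rewrite !cE; ring.
Qed.

Lemma H_cabs_L2 (x : H R) : L2 mu (fun t => cabs (x t)).
Proof.
have [a b] := H_L2 x; split; first exact/meas_cabs/H_meas.
have [+ _] := ip_cI x x; move/cint_cabs/integrable_lty => /(_ measurableT).
rewrite /sqi; under eq_integral do rewrite /= cabsM cabsJ -expr2.
by [].
Qed.

(** The kernel is symmetric, and Fubini is legitimate because [kern_schur] applied to [|x|] shows
    that its image is square-integrable, hence integrable against [|y|]. *)
Lemma carleman_sym x y : ip (carleman x) y = ip x (carleman y).
Proof.
have Lx := H_cabs_L2 x; have Ly := H_cabs_L2 y.
have mx := H_meas x; have my := H_meas y.
pose h (z : RR * RR) : C := (y z.1)^*%C * ((kern z.1 z.2)%:C%C * x z.2).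
have mh : cmeas h.
  apply: cmeasM; first by apply: cmeasJ; exact: (cmeas_comp my).
  apply: cmeasM; last exact: (cmeas_comp mx).
  by apply: cmeasR; exact: meas_kern.
have h1 s : cint (fun t => h (s, t)) by rewrite /h /=; apply: cintZ; exact: carleman_cint.
have hE t : (fun s => h (s, t)) = fun s => x t * (((kern t s)%:C%C) * (y s)^*%C).
  by apply/funext => s; rewrite /h /= kernC; ring.
have cJ t : cint (fun s => (kern t s)%:C%C * (y s)^*%C).
  apply: (@cint_le _ _ (fun s => kern t s * cabs (y s))).
  - by apply: cmeasM; [apply: cmeasR; exact: meas_kern1|exact: cmeasJ].
  - exact: kern_g_rint.
  - by move=> s; rewrite cabsM cabsR cabsJ ger0_norm ?kern_ge0.
have h2 t : cint (fun s => h (s, t)) by rewrite hE; exact: cintZ.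
have fin : (\int[mu]_s \int[mu]_t (cabs (h (s, t)))%:E < +oo)%E.
  have E s : (\int[mu]_t (cabs (h (s, t)))%:E =
     (cabs (y s) * RI (fun t => kern s t * cabs (x t)))%:E)%E.
    rewrite -RintegralZl//; last exact: kern_g_rint.
    rewrite RI_E; last by apply: rintZ; exact: kern_g_rint.
    apply: eq_integral => t _; congr EFin.
    by rewrite /h /= !cabsM cabsJ cabsR ger0_norm ?kern_ge0.
  under eq_integral do rewrite E.
  apply: integrable_lty => //; apply: L2_mul => //.
  exact: (kern_schur Lx).1.
have [_ sw] := cfubini mh h1 h2 fin.
rewrite (ip_cI (carleman x) y).2 (ip_cI x (carleman y)).2.
have -> : cI (fun t => carleman x t * (y t)^*%C) = cI (fun s => cI (fun t => h (s, t))).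
  apply: eq_cI => s; rewrite /h /= mulrC.
  by have := cIZ ((y s)^*%C) (carleman_cint x s).
rewrite sw; congr Re; apply: eq_cI => t.
rewrite hE (cIZ (x t) (cJ t)).
suff -> : (carleman y t)^*%C = cI (fun s => (kern t s)%:C%C * (y s)^*%C) by [].
rewrite -[carleman y t]/(carleman_fun y t) /carleman_fun -(cIJ (carleman_cint y t)).
by apply: eq_cI => s; apply: complex_eq; rewrite !cE /=; ring.
Qed.

End Carleman.

(** * Fourier integrals over the half-line *)

Section Fourier.
Variable R : realType.
Local Notation C := R[i].
Local Notation mu := (@lebesgue_measure R).
Local Notation RI := (Rintegral mu setT).
Local Notation RR := (measurableTypeR R).

Lemma RIZ (c : R) (f : RR -> R) : rint mu f ->
  RI (fun x => c * f x) = c * RI f.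
Proof. by move=> i; exact: (@RintegralZl _ _ _ mu setT f c measurableT i). Qed.

Lemma RI_dct (f_ : nat -> RR -> R) (f g : RR -> R) :
  (forall k, meas (f_ k)) -> (forall x, f_ ^~ x @ \oo --> f x) ->
  rint mu g -> (forall k x, `|f_ k x| <= g x) ->
  rint mu f /\ RI (f_ k) @[k --> \oo] --> RI f.
Proof.
move=> mf ff ig fg.
have mfl : meas f by apply: (measurable_fun_cvg mf) => x _.
have [] := @dominated_convergence _ _ _ mu setT measurableT (fun k x => (f_ k x)%:E)
  (fun x => (f x)%:E) (fun x => (g x)%:E).
- by move=> k; exact/measurable_EFinP.
- exact/measurable_EFinP.
- by apply: aeW => x _; apply: cvg_EFin; [exact: nearW|exact: ff].
- exact: ig.
- by apply: aeW => x k _; rewrite lee_fin.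
move=> i1 _ h; split; first exact: i1.
apply: fine_cvg; rewrite fineK; first exact: h.
by apply: integrable_fin_num.
Qed.

Definition ccvg (u : nat -> C) (a : C) :=
  Re (u k) @[k --> \oo] --> Re a /\ Im (u k) @[k --> \oo] --> Im a.

Lemma ccvg_cst (a : C) : ccvg (fun=> a) a.
Proof. by split; exact: cvg_cst. Qed.

Lemma ccvgR (u : nat -> R) (a : R) : u @ \oo --> a -> ccvg (fun k => (u k)%:C%C) a%:C%C.
Proof. by move=> ua; split=> //; exact: cvg_cst. Qed.

Lemma ccvgMl (c : C) u a : ccvg u a -> ccvg (fun k => c * u k) (c * a).
Proof.
move=> [ur ui]; split.
- rewrite cReM; under eq_fun do rewrite cReM.
  by apply: cvgB; apply: cvgM => //; exact: cvg_cst.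
- rewrite cImM; under eq_fun do rewrite cImM.
  by apply: cvgD; apply: cvgM => //; exact: cvg_cst.
Qed.

Lemma cI_dct (f_ : nat -> RR -> C) (f : RR -> C) (g : RR -> R) :
  (forall k, cmeas (f_ k)) -> (forall x, ccvg (f_ ^~ x) (f x)) ->
  rint mu g -> (forall k x, cabs (f_ k x) <= g x) -> ccvg (fun k => cI (f_ k)) (cI f).
Proof.
move=> mf fc ig fg; split.
- apply: (RI_dct _ (fun x => (fc x).1) ig _).2 => [k|k x]; first by case: (mf k).
  exact: le_trans (Re_le_cabs _) (fg k x).
- apply: (RI_dct _ (fun x => (fc x).2) ig _).2 => [k|k x]; first by case: (mf k).
  exact: le_trans (Im_le_cabs _) (fg k x).
Qed.

Lemma expp_ge0 e t : 0 <= expp e t :> R.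
Proof. by rewrite /expp; case: ifP => // _; exact: expR_ge0. Qed.

Lemma expp_le1 e t : 0 <= e -> expp e t <= 1 :> R.
Proof.
move=> e0; rewrite /expp; case: ifP => // t0.
by rewrite -expR0 ler_expR oppr_le0 mulr_ge0// ltW.
Qed.

Lemma expp_sq (e t : R) : expp (e / 2) t ^+ 2 = expp e t.
Proof.
rewrite /expp; case: ifP => _; last by rewrite expr0n.
by rewrite expr2 -expRD; congr expR; field.
Qed.

Lemma meas_expp (e : R) : meas (fun t : RR => expp e t).
Proof.
apply: measurable_fun_ifT => //; first exact: measurable_fun_ltr.
by apply: (@measurableT_comp _ _ _ _ _ _ (@expR R)) => //; apply: measurableT_comp => //; exact: measurable_funM.
Qed.

Lemma expp_cvg (t : R) : 0 < t -> (expp (k.+1%:R^-1) t : R) @[k --> \oo] --> (1 : R).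
Proof.
move=> t0; rewrite /expp t0 -[X in _ --> X]expR0.
apply: (@cvg_comp _ _ _ (fun k : nat => - (k.+1%:R^-1 * t)) expR _ (nbhs 0)); last exact: continuous_expR.
rewrite -oppr0; apply: cvgN; rewrite -[X in _ --> X](mul0r t); apply: cvgM; last exact: cvg_cst.
exact: cvg_harmonic.
Qed.

(** This is [1 / (e - i a)]. It has a Poisson kernel as real part, up to the factor pi, when [a] is
    a difference of two variables, and it tends to [i / a] as [e] tends to 0. *)
Definition laplace_expi (e a : R) : C := Complex (e / (e ^+ 2 + a ^+ 2)) (a / (e ^+ 2 + a ^+ 2)).

Lemma expp_expi_int (e a : R) : 0 < e ->
  cint (fun t => (expp e t)%:C%C * expi (t * a)) /\
  cI (fun t => (expp e t)%:C%C * expi (t * a)) = laplace_expi e a.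
Proof.
move=> e0; have [i1 I1] := expp_cos_int a e0; have [i2 I2] := expp_sin_int a e0.
have E1 : (fun t : RR => Re ((expp e t)%:C%C * expi (t * a))) = fun t => expp e t * cos (a * t).
  by apply/funext => t; rewrite !cE /= [t * a]mulrC; ring.
have E2 : (fun t : RR => Im ((expp e t)%:C%C * expi (t * a))) = fun t => expp e t * sin (a * t).
  by apply/funext => t; rewrite !cE /= [t * a]mulrC; ring.
split; first by split; rewrite ?E1 ?E2.
by apply: complex_eq; rewrite /cI /cintegral /= ?E1 ?E2.
Qed.

Lemma meas_expi2 (s : R) : cmeas (fun z : RR * RR => expi (s * (z.1 * z.2))).
Proof.
apply: cmeas_expi; apply: measurable_funM => //.
by apply: measurable_funM; [exact: meas_fst|exact: meas_snd].
Qed.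

Lemma cint_expi (u : RR -> C) (t : R) : cint u -> cint (fun xi => u xi * expi (t * xi)).
Proof.
move=> iu; apply: (cint_le _ (cint_cabs iu)).
  apply: cmeasM; first exact: cint_meas.
  by apply: cmeas_expi; apply: measurable_funM => //; exact: meas_id.
by move=> x; rewrite cabsM cabs_expi mulr1.
Qed.

(* Composing two Fourier integrals over the half-line, with the Abel factor [expp e] between. *)
Lemma abel (u : RR -> C) (s e xi : R) : 0 < e -> cint u ->
  cint (fun t => ((expp e t)%:C%C * expi (t * xi)) * cI (fun eta => u eta * expi (s * (t * eta)))) /\
  cI (fun t => ((expp e t)%:C%C * expi (t * xi)) * cI (fun eta => u eta * expi (s * (t * eta)))) =
  cI (fun eta => u eta * laplace_expi e (xi + s * eta)).
Proof.
move=> e0 iu; have [ie _] := expp_expi_int xi e0.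
have [] := @cfubiniM R (fun t => (expp e t)%:C%C * expi (t * xi)) u
  (fun z => expi (s * (z.1 * z.2))) 1 ie iu (meas_expi2 s).
  by move=> z; rewrite cabs_expi.
move=> i1 I1; split; first exact: i1.
rewrite I1 /=; apply: eq_cI => eta; congr (_ * _).
rewrite -(expp_expi_int (xi + s * eta) e0).2; apply: eq_cI => t.
rewrite -mulrA -expiD; congr (_ * expi _); ring.
Qed.

Definition fourier_cst : R := (Num.sqrt (2 * pi))^-1.

Lemma fourier_cst_ge0 : 0 <= fourier_cst. Proof. by rewrite invr_ge0 sqrtr_ge0. Qed.

Lemma fourier_cst_sq : fourier_cst ^+ 2 = (2 * pi)^-1.
Proof. by rewrite exprVn sqr_sqrtr// mulr_ge0// pi_ge0. Qed.

Definition fourierI (u : RR -> C) (t : RR) : C :=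
  if 0 < t then fourier_cst%:C%C * cI (fun xi => u xi * expi (t * xi)) else 0.

Lemma fourierI_meas (u : RR -> C) : cint u -> cmeas (fourierI u).
Proof.
move=> iu; apply: cmeas_if; first by apply: measurable_fun_ltr => //; exact: meas_id.
apply: cmeasM; first exact: cmeas_cst.
have mh : cmeas (fun z : RR * RR => u z.2 * expi (z.1 * z.2)).
  apply: cmeasM; first exact: (cmeas_comp (cint_meas iu)).
  by apply: cmeas_expi; apply: measurable_funM; [exact: meas_fst|exact: meas_snd].
case: mh => mr mi; split.
- by apply: (meas_RI mr) => t; exact: (cint_expi t iu).1.
- by apply: (meas_RI mi) => t; exact: (cint_expi t iu).2.
Qed.

Lemma fourierI_bound (u : RR -> C) t : cint u ->
  cabs (fourierI u t) <= fourier_cst * RI (fun x => cabs (u x)).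
Proof.
move=> iu; have K0 := fourier_cst_ge0.
have I0 : 0 <= RI (fun x => cabs (u x)).
  by apply: Rintegral_ge0 => x _; exact: cabs_ge0.
rewrite /fourierI; case: ifP => _; last by rewrite cabs0 mulr_ge0.
rewrite cabsM cabsR ger0_norm// ler_wpM2l//.
apply: cI_abs; [exact: cint_expi|exact: cint_cabs|].
by move=> x; rewrite cabsM cabs_expi mulr1.
Qed.

Lemma cint_expp_bounded (v : RR -> C) (e M : R) : 0 < e -> cmeas v ->
  (forall t, cabs (v t) <= M) -> cint (fun t => (expp e t)%:C%C * v t).
Proof.
move=> e0 mv vM; apply: (@cint_le _ _ (fun t => M * expp e t)).
- by apply: cmeasM => //; apply: cmeasR; exact: meas_expp.
- by apply: rintZ; exact: (expp_int e0).1.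
- by move=> t; rewrite cabsM cabsR ger0_norm ?expp_ge0// mulrC ler_wpM2r ?expp_ge0.
Qed.

(** * Boundedness of the Fourier integral through the Poisson kernel *)

Definition poisson (e s t : R) : R :=
  if (0 < s) && (0 < t) then pi^-1 * (e / (e ^+ 2 + (s - t) ^+ 2)) else 0.

Lemma poissonC e s t : poisson e s t = poisson e t s.
Proof. by rewrite /poisson andbC -[(s - t) ^+ 2]sqrrN opprB. Qed.

Lemma poisson_pos e s t : 0 < s -> 0 < t -> poisson e s t = pi^-1 * (e / (e ^+ 2 + (s - t) ^+ 2)).
Proof. by rewrite /poisson => -> ->. Qed.

Lemma poisson_kern_int (e s : R) : 0 < e -> rint mu (fun t : RR => poisson e s t) /\
  RI (fun t : RR => poisson e s t) <= 1.
Proof.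
move=> e0; have p0 := @pi_gt0 R.
have [s0|s0] := ltP 0 s; last first.
  have -> : (fun t : RR => poisson e s t) = fun=> 0.
    by apply/funext => t; rewrite /poisson ltNge s0.
  by split; [exact: rint0|rewrite Rintegral_cst// mul0r].
have [i I] := poisson_int s e0.
have E : (fun t : RR => poisson e s t) = fun t => pi^-1 * (if 0 < t then e / (e ^+ 2 + (s - t) ^+ 2) else 0).
  by apply/funext => t; rewrite /poisson s0 /=; case: ifP => // _; rewrite mulr0.
rewrite E; split; first exact: rintZ.
by rewrite RintegralZl// mulrC ler_pdivrMr// mul1r.
Qed.

Lemma meas_poisson e : meas (fun z : RR * RR => poisson e z.1 z.2).
Proof.
rewrite /poisson; apply: measurable_fun_ifT => //.
- by apply: measurable_and; apply: measurable_fun_ltr.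
- apply: measurable_funM => //; apply: measurable_funM => //.
  have mA : meas (fun z : RR * RR => e ^+ 2 + (z.1 - z.2) ^+ 2).
    apply: measurable_funD => //; apply: measurable_funX.
    by apply: measurable_funB; [exact: meas_fst|exact: meas_snd].
  exact: (measurableT_comp (@meas_inv R) mA).
Qed.

Lemma poisson_ge0 e s t : 0 < e -> 0 <= poisson e s t.
Proof.
move=> e0; rewrite /poisson; case: ifP => // _.
by rewrite mulr_ge0 ?invr_ge0 ?pi_ge0// divr_ge0 ?addr_ge0 ?sqr_ge0// ltW.
Qed.

Lemma poisson_le e s t : 0 < e -> poisson e s t <= (pi * e)^-1.
Proof.
move=> e0; have p0 := @pi_gt0 R.
rewrite /poisson; case: ifP => // _; last by rewrite invr_ge0 mulr_ge0// ltW.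
rewrite invfM ler_pM2l ?invr_gt0// ler_pdivrMr; last by rewrite ltr_wpDr ?sqr_ge0 ?exprn_gt0.
have -> : e^-1 * (e ^+ 2 + (s - t) ^+ 2) = e + e^-1 * (s - t) ^+ 2 by field; rewrite gt_eqF.
by rewrite lerDl mulr_ge0 ?sqr_ge0// invr_ge0 ltW.
Qed.

Lemma poisson_rint (e s : R) (g : RR -> R) : 0 < e -> rint mu g -> rint mu (fun t => poisson e s t * g t).
Proof.
move=> e0 ig; apply: (rint_le _ (rintZ ((pi * e)^-1) (rint_norm ig))).
  by apply: measurable_funM; [exact: (meas_section1 s (meas_poisson e))|exact: rint_meas ig].
by move=> t; rewrite normrM ger0_norm ?poisson_ge0// ler_wpM2r// poisson_le.
Qed.

(** The kernel is symmetric and has integral at most 1 in each variable, so the Schur test applies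
    with the constant weight 1. *)
Lemma poisson_schur (e : R) (g : RR -> R) : 0 < e -> L2 mu g -> rint mu g ->
  L2 mu (fun s : RR => RI (fun t => poisson e s t * g t)) /\
  (sqi mu (fun s => RI (fun t => poisson e s t * g t)%R) <= sqi mu g)%E.
Proof.
move=> e0 Lg ig; have mg : meas g by case: Lg.
have mk : meas (fun z : RR * RR => poisson e z.1 z.2 * g z.2).
  by apply: measurable_funM; [exact: meas_poisson|exact: (measurableT_comp mg)].
have S : (sqi mu (fun s => RI (fun t => poisson e s t * g t)%R) <= sqi mu g)%E.
  apply: (@schur R (fun z => poisson e z.1 z.2) (fun=> 1)) => //=.
  - exact: meas_poisson.
  - by move=> z; exact: poisson_ge0.
  - by move=> s; under eq_fun do rewrite mulr1; exact: (poisson_kern_int s e0).1.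
  - by move=> s; under eq_Rintegral do rewrite mulr1; exact: (poisson_kern_int s e0).2.
  - by move=> t; under eq_fun do rewrite poissonC mulr1; exact: (poisson_kern_int t e0).1.
  - by move=> t; under eq_Rintegral do rewrite poissonC mulr1; exact: (poisson_kern_int t e0).2.
  - by move=> s; exact: poisson_rint.
split=> //; split; last by apply: (le_lt_trans S); case: Lg.
by apply: (meas_RI mk) => s; exact: poisson_rint.
Qed.

Lemma cintR (g : RR -> R) : rint mu g -> cint (fun t => (g t)%:C%C).
Proof. by move=> ig; split=> //=; exact: rint0. Qed.

Lemma sqi_le_RI_mul (g p : RR -> R) : L2 mu g -> L2 mu p -> (sqi mu p <= sqi mu g)%E ->
  RI (fun s => g s * p s) <= RI (fun s => g s ^+ 2).
Proof.
move=> Lg Lp; rewrite !sqi_RI// lee_fin => S.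
have := RI_cauchy_schwarz Lg Lp.
have G0 : 0 <= RI (fun t => g t ^+ 2).
  by apply: Rintegral_ge0 => t _; exact: sqr_ge0.
move: (RI _) (RI (fun s => g s * p s)) (RI (fun s => p s ^+ 2)) G0 S => a b c a0 ca.
have [h|h] := leP b 0; first by move=> _; exact: le_trans h a0.
by move=> h1; rewrite -(@ler_pXn2r _ 2) ?nnegrE ?(ltW h)// (le_trans h1)// expr2 ler_wpM2l.
Qed.

Lemma cReMl (r : R) (z : C) : Re (r%:C%C * z) = r * Re z.
Proof. by rewrite cReM /= mul0r subr0. Qed.

Lemma cImMl (r : R) (z : C) : Im (r%:C%C * z) = r * Im z.
Proof. by rewrite cImM /= mul0r addr0. Qed.

(** Expanding the square and integrating over [t] with [abel] for [s = -1] turns the left side into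
    [1/(2 pi)] times the quadratic form with kernel [1 / (e - i (xi - eta))]. For real [g] its real
    part is [1/2] times the form of the Poisson kernel, which is at most the squared norm of [g]. *)
Lemma bessel (g : RR -> R) (e : R) : 0 < e -> L2 mu g -> rint mu g ->
  (forall t, t <= 0 -> g t = 0) ->
  rint mu (fun t => expp e t * csqnorm (fourierI (fun x => (g x)%:C%C) t)) /\
  RI (fun t => expp e t * csqnorm (fourierI (fun x => (g x)%:C%C) t)) <=
    2^-1 * RI (fun t => g t ^+ 2).
Proof.
move=> e0 Lg ig g0; pose u (x : RR) : C := (g x)%:C%C.
have iu : cint u by exact: cintR.
have mv := fourierI_meas iu; have vM t := fourierI_bound t iu.
pose v := fourierI u; set M := fourier_cst * _ in vM.
have M0 : 0 <= M by exact: le_trans (cabs_ge0 _) (vM 0).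
have i1 : rint mu (fun t => expp e t * csqnorm (v t)).
  apply: (rint_le _ (rintZ (M ^+ 2) (expp_int e0).1)).
    apply: measurable_funM; [exact: meas_expp|exact: meas_csqnorm].
  move=> t; rewrite ger0_norm ?mulr_ge0 ?expp_ge0 ?csqnorm_ge0// mulrC.
  by rewrite ler_wpM2r ?expp_ge0// -cabs_sq ler_pXn2r ?nnegrE ?cabs_ge0// vM.
split; first exact: i1.
(* Chosen so that pairing [f] with the Fourier integral of [u] gives the damped square norm of [v];
   the other order of integration exposes the Poisson kernel. *)
pose f t : C := fourier_cst%:C%C * ((expp e t)%:C%C * (v t)^*%C).
have fi : cint f.
  apply: cintZ; apply: (@cint_expp_bounded _ _ M) => //; first exact: cmeasJ.
  by move=> t; rewrite cabsJ.
have [] := @cfubiniM R f u (fun z => expi (1 * (z.1 * z.2))) 1 fi iu (meas_expi2 1).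
  by move=> z; rewrite cabs_expi.
rewrite /=; move=> _ I1.
have L1 : cI (fun t => f t * cI (fun xi => u xi * expi (1 * (t * xi)))) =
    (RI (fun t => expp e t * csqnorm (v t)))%:C%C.
  rewrite -cIR; apply: eq_cI => t; rewrite /f.
  have -> : (fun xi => u xi * expi (1 * (t * xi))) = fun xi => u xi * expi (t * xi).
    by apply/funext => xi; rewrite mul1r.
  have [t0|t0] := ltP 0 t; last by rewrite /expp ltNge t0/= mul0r mulr0 mul0r mul0r.
  have -> : fourier_cst%:C%C * ((expp e t)%:C%C * (v t)^*%C) * cI (fun xi => u xi * expi (t * xi)) =
     (expp e t)%:C%C * ((v t)^*%C * v t) by rewrite {3}/v /fourierI t0; ring.
  by apply: complex_eq; rewrite !cE /= /csqnorm; ring.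
have inner xi : cI (fun t => f t * expi (1 * (t * xi))) =
    (fourier_cst ^+ 2)%:C%C * cI (fun eta => u eta * laplace_expi e (xi + (-1) * eta)).
  rewrite -(abel (-1) xi e0 iu).2 -cIZ; last exact: (abel (-1) xi e0 iu).1.
  apply: eq_cI => t; rewrite /f mul1r.
  have [t0|t0] := ltP 0 t; last first.
    by rewrite /expp ltNge t0/= !mul0r !mulr0 mul0r.
  have -> : (v t)^*%C = fourier_cst%:C%C * cI (fun eta => u eta * expi (-1 * (t * eta))).
    rewrite /v /fourierI t0; have -> : (fourier_cst%:C%C * cI (fun xi0 => u xi0 * expi (t * xi0)))^*%C =
      fourier_cst%:C%C * (cI (fun xi0 => u xi0 * expi (t * xi0)))^*%C.
      by apply: complex_eq; rewrite !cE /=; ring.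
    rewrite -cIJ; last exact: cint_expi.
    congr (_ * _); apply: eq_cI => eta; rewrite mulN1r expiN.
    by apply: complex_eq; rewrite !cE /=; ring.
  rewrite rmorphXn /=; ring.
have Lp := (poisson_schur e0 Lg ig).1; have Sp := (poisson_schur e0 Lg ig).2.
pose p s := RI (fun t => poisson e s t * g t).
have E1 : RI (fun t => expp e t * csqnorm (v t)) =
    2^-1 * RI (fun s => g s * p s).
  have -> : RI (fun t => expp e t * csqnorm (v t)) =
      Re (cI (fun xi => u xi * cI (fun t => f t * expi (1 * (t * xi))))).
    by rewrite -I1 L1.
  rewrite -(RIZ 2^-1 (L2_mul Lg Lp)).
  apply: eq_Rintegral => xi _; rewrite inner [u xi]/u !cReMl.
  have [x0|x0] := ltP 0 xi; last first.
    by rewrite (g0 xi x0) [LHS]mul0r [X in _ * X]mul0r mulr0.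
  rewrite [RHS]mulrCA; congr (_ * _).
  rewrite fourier_cst_sq.
  rewrite /p; have p0 := @pi_gt0 R.
  have -> : Re (cI (fun eta => u eta * laplace_expi e (xi + -1 * eta))) =
     RI (fun t => pi * (poisson e xi t * g t)).
    apply: eq_Rintegral => t _; rewrite cReM /= mul0r subr0 mulN1r.
    have [t0|t0] := ltP 0 t; last by rewrite (g0 t t0) [LHS]mul0r [X in _ * X]mulr0 mulr0.
    rewrite (poisson_pos _ x0 t0); move: (e / _) (@pi R) p0 => P p0 p00.
    by field; rewrite gt_eqF.
  rewrite (RIZ pi (poisson_rint xi e0 ig)).
  move: (RI _) (@pi R) p0 => I p0 p00.
  by field; rewrite gt_eqF.
rewrite E1; apply: ler_wpM2l; first by rewrite invr_ge0.
exact: (sqi_le_RI_mul Lg Lp Sp).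
Qed.

(** Removal of the damping by Fatou's lemma, with [e / 2] in place of [e] because the factor gets
    squared. Real and imaginary part are each bounded by half of the squared norm of [g]. *)
Lemma fourierI_real_L2pos (g : RR -> R) : L2 mu g -> rint mu g ->
  (forall t, t <= 0 -> g t = 0) ->
  L2pos (fourierI (fun x => (g x)%:C%C)) /\
  (\int[mu]_t (csqnorm (fourierI (fun x => (g x)%:C%C) t))%:E <=
   (RI (fun t => g t ^+ 2))%:E)%E.
Proof.
move=> Lg ig g0; have iu := cintR ig; have mv := fourierI_meas iu.
set v := fourierI _ in mv *.
have Fp (p : C -> R) : meas (fun t => p (v t)) ->
    (forall z, p z ^+ 2 <= csqnorm z) ->
    (sqi mu (fun t => p (v t)) <= (2^-1 * RI (fun t => g t ^+ 2))%:E)%E.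
  move=> mp pc.
  have k0 (k : nat) : 0 < k.+1%:R^-1 :> R by rewrite invr_gt0.
  apply: (@sqi_fatou _ _ _ mu (fun k t => expp (k.+1%:R^-1 / 2) t * p (v t)) _ _ 0%N).
  - by move=> k; apply: measurable_funM => //; exact: meas_expp.
  - move=> t; have [t0|t0] := ltP 0 t; last first.
      have p00 : p 0 = 0.
        by have := pc 0; rewrite -cabs_sq cabs0 expr0n /= => h; apply/eqP; rewrite -sqrf_eq0 eq_le h sqr_ge0.
      have -> : v t = 0 by rewrite /v /fourierI ltNge t0.
      by rewrite p00; under eq_fun do rewrite mulr0; exact: cvg_cst.
    rewrite -[X in _ --> X]mul1r; apply: cvgM; last exact: cvg_cst.
    have -> : (fun k : nat => expp (k.+1%:R^-1 / 2) t) = (fun k => expp (k.+1%:R^-1) (t / 2)).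
      apply/funext => k; rewrite /expp t0 divr_gt0//; congr expR; ring.
    by apply: expp_cvg; rewrite divr_gt0.
  - move=> k _; have [i1 I1] := bessel (k0 k) Lg ig g0.
    apply: (@le_trans _ _ (RI (fun t => expp k.+1%:R^-1 t * csqnorm (v t)))%:E); last by rewrite lee_fin.
    rewrite RI_E//; apply: ge0_le_integral => //.
    + by move=> t _; rewrite lee_fin sqr_ge0.
    + by apply/measurable_EFinP/measurable_funX/measurable_funM => //; exact: meas_expp.
    + apply/measurable_EFinP/measurable_funM; [exact: meas_expp|exact: meas_csqnorm].
    + by move=> t _; rewrite lee_fin exprMn expp_sq ler_wpM2l ?expp_ge0.
have hr := Fp (@complex.Re R) mv.1 (fun z => ltac:(by rewrite /csqnorm lerDl sqr_ge0)).
have hi := Fp (@complex.Im R) mv.2 (fun z => ltac:(by rewrite /csqnorm lerDr sqr_ge0)).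
split.
  apply/L2posP; split.
  - by split; [exact: mv.1|exact: (le_lt_trans hr (ltry _))].
  - by split; [exact: mv.2|exact: (le_lt_trans hi (ltry _))].
  - by move=> t t0; rewrite /v /fourierI ltNge t0.
rewrite (integral_csqnorm mv); apply: (le_trans (leeD hr hi)).
rewrite -EFinD lee_fin; lra.
Qed.

Lemma fourierID (u w : RR -> C) (k : C) : cint u -> cint w ->
  fourierI (fun t => u t + k * w t) = fun t => fourierI u t + k * fourierI w t.
Proof.
move=> iu iw; apply/funext => t; rewrite /fourierI; case: ifP => _; last by rewrite mulr0 addr0.
have -> : (fun xi => (u xi + k * w xi) * expi (t * xi)) =
   fun xi => u xi * expi (t * xi) + k * (w xi * expi (t * xi)).
  by apply/funext => xi; ring.
rewrite cID; [|exact: cint_expi|by apply: cintZ; exact: cint_expi].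
by rewrite cIZ; [ring|exact: cint_expi].
Qed.

Lemma sqn_sqi (x : H R) : ((sqn x)%:E = sqi mu (fun t => Re (x t)) + sqi mu (fun t => Im (x t)))%E.
Proof. by rewrite sqn_integral integral_csqnorm//; exact: H_meas. Qed.

(** The constant 2 comes from applying the real case to the real and the imaginary part of [x]; any
    constant would serve for the extension by continuity. *)
Lemma fourierI_L2pos (x : H R) : cint x -> L2pos (fourierI x) /\
  forall p : L2pos (fourierI x), hnorm (MkH p) <= 2 * hnorm x.
Proof.
move=> ix; have [Lr Li] := H_L2 x.
have zr t : t <= 0 -> Re (x t) = 0 by move=> t0; rewrite H_pos.
have zi t : t <= 0 -> Im (x t) = 0 by move=> t0; rewrite H_pos.
have [pr hr] := fourierI_real_L2pos Lr ix.1 zr.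
have [pi hi] := fourierI_real_L2pos Li ix.2 zi.
have E : fourierI x = fun t => fourierI (fun t => (Re (x t))%:C%C) t + 'i%C * fourierI (fun t => (Im (x t))%:C%C) t.
  rewrite -fourierID; [|exact: (cintR ix.1)|exact: (cintR ix.2)].
  congr fourierI; apply/funext => t; apply: complex_eq; rewrite !cE /=; ring.
have P : L2pos (fourierI x) by rewrite E; apply: L2posD => //; exact: L2posZ.
split=> // p.
have -> : MkH p = MkH pr + 'i%C *: MkH pi.
  by apply: H_ext => t; rewrite HDE HZE /= E.
apply: (le_trans (hnormD _ _)); rewrite hnormZ.
have -> : cabs ('i%C : C) = 1.
  by rewrite /cabs /csqnorm /= expr0n expr1n add0r sqrtr1.
have h1 : hnorm (MkH pr) <= hnorm x.
  apply: hnorm_le; first exact: hnorm_ge0.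
  rewrite -lee_fin sqn_integral; apply: (le_trans hr).
  rewrite -sqi_RI// hnorm_sqr sqn_sqi leeDl// sqi_ge0//.
have h2 : hnorm (MkH pi) <= hnorm x.
  apply: hnorm_le; first exact: hnorm_ge0.
  rewrite -lee_fin sqn_integral; apply: (le_trans hi).
  rewrite -sqi_RI// hnorm_sqr sqn_sqi leeDr// sqi_ge0//.
by move: (hnorm (MkH pr)) (hnorm (MkH pi)) (hnorm x) h1 h2 => a b c; lra.
Qed.

(* Off the integrable elements the value is the junk value 0. *)
Definition fourier (x : H R) : H R :=
  match pselect (cint x) with
  | left ix => MkH (fourierI_L2pos ix).1
  | right _ => 0
  end.

Lemma fourierE (x : H R) t : cint x -> fourier x t = fourierI x t.
Proof. by move=> ix; rewrite /fourier; case: pselect => // p. Qed.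

Lemma fourier_le (x : H R) : hnorm (fourier x) <= 2 * hnorm x.
Proof.
rewrite /fourier; case: pselect => [p|_]; last by rewrite hnorm0 mulr_ge0 ?hnorm_ge0.
exact: (fourierI_L2pos p).2.
Qed.

Lemma cintH (x y : H R) (k : C) : cint x -> cint y -> cint (x + k *: y).
Proof. by move=> ix iy; apply: cintD => //; exact: cintZ. Qed.

Lemma fourierD (x y : H R) (k : C) : cint x -> cint y -> fourier (x + k *: y) = fourier x + k *: fourier y.
Proof.
move=> ix iy; apply: H_ext => t; rewrite HDE HZE !fourierE//; last exact: cintH.
by have := fourierID k ix iy => /(congr1 (fun f => f t)).
Qed.

Lemma fourierB (x y : H R) : cint x -> cint y -> fourier (x - y) = fourier x - fourier y.
Proof. by move=> ix iy; have := fourierD (-1) ix iy; rewrite !scaleN1r. Qed.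

(** * Approximation by integrable elements *)

Lemma mul_L2pos (c : RR -> R) (x : H R) : meas c -> (forall t, 0 <= c t <= 1) ->
  L2pos (fun t => (c t)%:C%C * x t).
Proof.
move=> mc c01; have [a b] := H_L2 x.
have bd (p : C -> R) : L2 mu (fun t => p (x t)) -> L2 mu (fun t => c t * p (x t)).
  move=> Lp; apply: (L2_bound _ Lp); first by apply: measurable_funM => //; case: Lp.
  move=> t; rewrite exprMn ler_piMl ?sqr_ge0//.
  by have /andP[h1 h2] := c01 t; rewrite expr_le1.
apply/L2posP; split.
- under eq_fun do rewrite cReM /= mul0r subr0; exact: bd.
- under eq_fun do rewrite cImM /= mul0r addr0; exact: bd.
- by move=> t t0; rewrite H_pos// mulr0.
Qed.

(** Dominated convergence; it serves both the exponential damping and the sharp truncation. *)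
Lemma mul_conv (c : nat -> RR -> R) (x : H R) (u : nat -> H R) :
  (forall k, meas (c k)) -> (forall k t, 0 <= c k t <= 1) ->
  (forall t, 0 < t -> (c k t : R) @[k --> \oo] --> (1 : R)) ->
  (forall k t, u k t = (c k t)%:C%C * x t) -> conv u x.
Proof.
move=> mc c01 c1 uE.
have qk k : sqn (u k - x) = RI (fun t => (1 - c k t) ^+ 2 * csqnorm (x t)).
  rewrite sqn_RI; apply: eq_Rintegral => t _; rewrite HDE HNE uE /csqnorm !cE /=; ring.
have [] := @RI_dct (fun k t => (1 - c k t) ^+ 2 * csqnorm (x t)) (fun=> 0) (fun t => csqnorm (x t))
  _ _ _ _.
- move=> k; apply: measurable_funM; last exact/meas_csqnorm/H_meas.
  by apply: measurable_funX; apply: measurable_funB.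
- move=> t; have [t0|t0] := ltP 0 t; last first.
    rewrite H_pos//; have -> : csqnorm (0 : C) = 0 by rewrite -cabs_sq cabs0 expr0n.
    by under eq_fun do rewrite mulr0; exact: cvg_cst.
  rewrite -[X in _ --> X](mul0r (csqnorm (x t))); apply: cvgM; last exact: cvg_cst.
  have -> : (0 : R) = (1 - 1) * (1 - 1) by rewrite subrr mul0r.
  under eq_fun do rewrite expr2.
  by apply: cvgM; (apply: cvgB; [exact: cvg_cst|exact: c1]).
- exact: csqnorm_rint.
- move=> k t; have /andP[h1 h2] := c01 k t.
  rewrite ger0_norm; last by apply: mulr_ge0; [exact: sqr_ge0|exact: csqnorm_ge0].
  apply: ler_piMl; first exact: csqnorm_ge0.
  by rewrite expr_le1 ?subr_ge0// lerBlDr lerDl.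
move=> _; rewrite Rintegral_cst// mul0r => /cvgr0Pnorm_le h e e0.
have [N _ hN] := h _ (exprn_gt0 2 e0).
exists N => m Nm; apply: hnorm_le; first exact: ltW.
by rewrite qk; apply: (le_trans (ler_norm _)); exact: hN.
Qed.

Lemma damp_L2pos (e : R) (x : H R) : 0 <= e -> L2pos (fun t => (expp e t)%:C%C * x t).
Proof.
move=> e0; apply: mul_L2pos; first exact: meas_expp.
by move=> t; rewrite expp_ge0 expp_le1.
Qed.

Definition damp (k : nat) (x : H R) : H R :=
  MkH (@damp_L2pos (k.+1%:R^-1) x ltac:(by rewrite invr_ge0)).

Lemma damp_conv (x : H R) : conv (damp ^~ x) x.
Proof.
apply: (@mul_conv (fun k => expp (k.+1%:R^-1))) => //.
- by move=> k; exact: meas_expp.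
- by move=> k t; rewrite expp_ge0 expp_le1// invr_ge0.
- exact: expp_cvg.
Qed.

Lemma expp_L2 (e : R) : 0 < e -> L2 mu (expp e : RR -> R).
Proof.
move=> e0; split; first exact: meas_expp.
have i : rint mu (fun t : RR => expp e t ^+ 2).
  have -> : (fun t : RR => expp e t ^+ 2) = expp (e * 2 : R).
    by apply/funext => t; rewrite -[RHS]expp_sq mulfK.
  by apply: (expp_int _).1; rewrite mulr_gt0.
exact: (integrable_lty _ i).
Qed.

(** A product of two square-integrable functions. Together with [damp_conv] this makes the
    integrable elements dense. *)
Lemma damp_cint k (x : H R) : cint (damp k x).
Proof.
apply: (@cint_le _ _ (fun t => expp (k.+1%:R^-1) t * cabs (x t))).
- exact: H_meas.
- apply: L2_mul; last exact: H_cabs_L2.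
  by apply: expp_L2; rewrite invr_gt0.
- by move=> t; rewrite /= cabsM cabsR ger0_norm ?expp_ge0.
Qed.

End Fourier.

(** * The graph of the truncated Fourier operator *)

Section Graph.
Variable R : realType.
Local Notation C := R[i].
Local Notation mu := (@lebesgue_measure R).
Local Notation RI := (Rintegral mu setT).
Local Notation RR := (measurableTypeR R).
Implicit Types x y z : H R.
Implicit Types u v w : nat -> H R.

Lemma convP u x : conv u x <-> hnorm (u k - x) @[k --> \oo] --> (0 : R).
Proof.
split=> [h|/cvgr0Pnorm_le h].
- apply/cvgr0Pnorm_le => e e0; have [N hN] := h e e0.
  by exists N => // m /= Nm; rewrite ger0_norm ?hnorm_ge0// hN.
- move=> e e0; have [N _ hN] := h e e0; exists N => m Nm.
  by rewrite (le_trans (ler_norm _))// hN.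
Qed.

Lemma conv_le (u : nat -> H R) x (a : nat -> R) : (forall k, hnorm (u k - x) <= a k) ->
  a @ \oo --> (0 : R) -> conv u x.
Proof.
move=> h a0; apply/convP; apply: (squeeze_cvgr _ (cvg_cst 0) a0).
by apply: nearW => k; rewrite hnorm_ge0 h.
Qed.

Lemma convD (k : C) u v x y : conv u x -> conv v y ->
  conv (fun m => u m + k *: v m) (x + k *: y).
Proof.
move=> /convP ux /convP vy.
apply: (@conv_le _ _ (fun m => hnorm (u m - x) + cabs k * hnorm (v m - y))).
- move=> m; rewrite opprD addrACA -scalerBr; apply: (le_trans (hnormD _ _)).
  by rewrite hnormZ.
- rewrite -(addr0 (0 : R)) -[X in _ + X](mulr0 (cabs k)).
  by apply: cvgD => //; apply: cvgM => //; exact: cvg_cst.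
Qed.

Lemma conv_cst x : conv (fun=> x) x.
Proof. by move=> e e0; exists 0%N => m _; rewrite subrr hnorm0 ltW. Qed.

Lemma conv_bound (c : R) u x v y : 0 <= c -> (forall k, hnorm (u k - x) <= c * hnorm (v k - y)) ->
  conv v y -> conv u x.
Proof.
move=> c0 h /convP vy; apply: (conv_le h).
by rewrite -(mulr0 c); apply: cvgM => //; exact: cvg_cst.
Qed.

Lemma conv_n u x : conv u x -> hnorm (u k) @[k --> \oo] --> hnorm x.
Proof.
move=> /convP ux.
have c1 : hnorm x - hnorm (u k - x) @[k --> \oo] --> hnorm x.
  by rewrite -[X in _ --> X]subr0; apply: cvgB => //; exact: cvg_cst.
have c2 : hnorm x + hnorm (u k - x) @[k --> \oo] --> hnorm x.
  by rewrite -[X in _ --> X]addr0; apply: cvgD => //; exact: cvg_cst.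
apply: (squeeze_cvgr _ c1 c2); apply: nearW => k.
have := hnorm_triangleB x (u k); have := hnorm_triangleB (u k) x; rewrite (hnormBC x); lra.
Qed.

Lemma conv_n_le (c : R) u x v y : conv u x -> conv v y ->
  (forall k, hnorm (u k) <= c * hnorm (v k)) -> hnorm x <= c * hnorm y.
Proof.
move=> /conv_n ux /conv_n vy h.
have vy' : c * hnorm (v k) @[k --> \oo] --> c * hnorm y by apply: cvgM => //; exact: cvg_cst.
by apply: (ler_cvg_to ux vy'); exact: nearW.
Qed.

Lemma ipBl x y z : ip (x - y) z = ip x z - ip y z.
Proof. by rewrite ipDl ipNl. Qed.

Lemma ipBr x y z : ip z (x - y) = ip z x - ip z y.
Proof. by rewrite ipDr ipNr. Qed.

Lemma conv_ip u v x y : conv u x -> conv v y -> ip (u k) (v k) @[k --> \oo] --> ip x y.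
Proof.
move=> ux vy; have nv := conv_n vy; move/convP : ux => ux; move/convP : vy => vy.
apply/cvgrPdist_le => e e0.
have /cvgr0Pnorm_le/(_ e e0) : hnorm (u k - x) * hnorm (v k) + hnorm x * hnorm (v k - y) @[k --> \oo] --> 0.
  rewrite -(addr0 (0 : R)) -[X in _ + X](mulr0 (hnorm x)) -[X in X + _](mul0r (hnorm y)).
  by apply: cvgD; apply: cvgM => //; exact: cvg_cst.
apply: filterS => k /=; apply: le_trans; apply: le_trans (ler_norm _).
have -> : ip x y - ip (u k) (v k) = - (ip (u k - x) (v k) + ip x (v k - y)).
  by rewrite ipBl ipBr; ring.
rewrite normrN; apply: (le_trans (ler_normD _ _)).
by apply: lerD; exact: ip_CS.
Qed.

Lemma conv_ip_eq u v x y u' v' x' y' : conv u x -> conv v y -> conv u' x' -> conv v' y' ->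
  (forall k, ip (u k) (v k) = ip (u' k) (v' k)) -> ip x y = ip x' y'.
Proof.
move=> a b a' b' h; have c := conv_ip a b; have := conv_ip a' b'.
under eq_fun do rewrite -h.
by move/(cvg_unique _ c) => /(_ (@norm_hausdorff _ _)).
Qed.

(* A norm limit and a pointwise limit of the same sequence agree, by Fatou's lemma. *)
Lemma conv_pointwise u z y : conv u z ->
  (forall t, ccvg (fun k => u k t) (y t)) -> hnorm (z - y) = 0.
Proof.
move=> uz uy; apply: le_all_eq0; first exact: hnorm_ge0.
move=> e e0; have [N hN] := uz (e / 2) (divr_gt0 e0 (ltr0n _ 2)).
have [mz1 mz2] := H_meas z.
have b (p : C -> R) : (forall a b, p (a - b) = p a - p b) -> (forall a, p a ^+ 2 <= csqnorm a) ->
   (forall w : H R, meas (fun t => p (w t))) ->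
   (forall t, p (u k t) @[k --> \oo] --> p (y t)) ->
   (sqi mu (fun t => p ((z - y)%R t)) <= ((e / 2) ^+ 2)%:E)%E.
  move=> pB pc pm pl.
  apply: (@sqi_fatou _ _ _ mu (fun k t => p ((z - u k) t)) _ _ N).
  - by move=> k; exact: (pm (z - u k)).
  - move=> t; rewrite !HE pB.
    under eq_fun do rewrite !HE pB.
    by apply: cvgB => //; exact: cvg_cst.
  - move=> k Nk; apply: (@le_trans _ _ (sqn (z - u k))%:E); last first.
      by rewrite lee_fin -hnorm_sqr ler_pXn2r ?nnegrE ?hnorm_ge0 ?divr_ge0 ?(ltW e0)// hnormBC hN.
    rewrite sqn_integral; apply: ge0_le_integral => //.
    + by move=> t _; rewrite lee_fin sqr_ge0.
    + by apply/measurable_EFinP/measurable_funX; exact: (pm (z - u k)).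
    + by apply/measurable_EFinP/meas_csqnorm; exact: (H_meas (z - u k)).
    + by move=> t _; rewrite lee_fin.
apply: hnorm_le; first exact: ltW.
rewrite -lee_fin sqn_sqi.
apply: (@le_trans _ _ (((e / 2) ^+ 2)%:E + ((e / 2) ^+ 2)%:E)%E).
  apply: leeD; apply: b.
  - by move=> a c; rewrite !cE.
  - by move=> a; rewrite /csqnorm lerDl sqr_ge0.
  - by move=> w; case: (H_meas w).
  - by move=> t; exact: (uy t).1.
  - by move=> a c; rewrite !cE.
  - by move=> a; rewrite /csqnorm lerDr sqr_ge0.
  - by move=> w; case: (H_meas w).
  - by move=> t; exact: (uy t).2.
rewrite -EFinD lee_fin expr_div_n; have := sqr_ge0 e; lra.
Qed.

(* The closure of the graph of [fourier] restricted to the integrable elements. *)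
Definition graphF x y := exists u, [/\ forall k, cint (u k), conv u x & conv (fun k => fourier (u k)) y].

Lemma fourier_conv u x : (forall k, cint (u k)) -> conv u x -> exists y, conv (fun k => fourier (u k)) y.
Proof.
move=> iu ux; apply: H_complete => e e0.
have e40 : 0 < e / 4 by rewrite divr_gt0.
have [N hN] := ux _ e40; exists N => m Nm.
rewrite -fourierB//; apply: (le_trans (fourier_le _)).
have := hnorm_triangle (u m) x (u N); have := hN _ Nm; have := hN _ (leqnn N); rewrite (hnormBC x).
lra.
Qed.

(** Extension by continuity from the dense set of integrable elements. The value is determined only
    up to a null function, and so a relation is kept. *)
Lemma graphF_total x : exists y, graphF x y.
Proof.
have iu k := damp_cint k x; have ux := damp_conv x.
by have [y uy] := fourier_conv iu ux; exists y, (fun k => damp k x).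
Qed.

Lemma graphF_cint x : cint x -> graphF x (fourier x).
Proof. by move=> ix; exists (fun=> x); split=> //; exact: conv_cst. Qed.

Lemma graphF_lin (k : C) x y x' y' : graphF x y -> graphF x' y' -> graphF (x + k *: x') (y + k *: y').
Proof.
move=> [u [iu ux uy]] [v [iv vx vy]]; exists (fun m => u m + k *: v m); split.
- by move=> m; exact: cintH.
- exact: convD.
- have -> : (fun m => fourier (u m + k *: v m)) = fun m => fourier (u m) + k *: fourier (v m).
    by apply/funext => m; rewrite fourierD.
  exact: convD.
Qed.

Lemma graphFB x y x' y' : graphF x y -> graphF x' y' -> graphF (x - x') (y - y').
Proof. by move=> h h'; have := graphF_lin (-1) h h'; rewrite !scaleN1r. Qed.

Lemma graphF0 : graphF 0 0.
Proof.
have [y h] := graphF_total 0; have := graphFB h h; by rewrite !subrr.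
Qed.

Lemma graphFZ (k : C) x y : graphF x y -> graphF (k *: x) (k *: y).
Proof. by move=> h; have := graphF_lin k graphF0 h; rewrite !add0r. Qed.

Lemma graphF_le x y : graphF x y -> hnorm y <= 2 * hnorm x.
Proof. by move=> [u [iu ux uy]]; apply: (conv_n_le uy ux) => k; exact: fourier_le. Qed.

Lemma graphF_null x y : graphF x y -> hnorm x = 0 -> hnorm y = 0.
Proof.
move=> /graphF_le + x0; rewrite x0 mulr0 => h.
by apply/eqP; rewrite eq_le h hnorm_ge0.
Qed.

(** The limit does not depend on the approximating sequence, by the bound [graphF_le] for
    differences. This permits the passage from damped functions to truncated ones. *)
Lemma graphF_conv u x y : (forall k, cint (u k)) -> conv u x -> graphF x y -> conv (fun k => fourier (u k)) y.
Proof.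
move=> iu ux h; apply: (@conv_bound 2 _ _ u x) => // k.
by apply: graphF_le; apply: graphFB => //; exact: graphF_cint.
Qed.

(** * Symmetry for the bilinear pairing *)

Lemma hconj_L2pos x : L2pos (fun t => (x t)^*%C).
Proof.
have [a b] := H_L2 x; apply/L2posP; split.
- by under eq_fun do rewrite cReJ.
- under eq_fun do rewrite cImJ -mulN1r; exact: L2Z.
- by move=> t t0; rewrite H_pos//; apply: complex_eq => /=; rewrite ?oppr0.
Qed.

(** [ip x (hconj y)] is the real part of the bilinear pairing, the integral of [x * y]. *)
Definition hconj x : H R := MkH (hconj_L2pos x).

Lemma hconjK x : hconj (hconj x) = x.
Proof. by apply: H_ext => t; apply: complex_eq; rewrite /= !cE ?opprK. Qed.

Lemma hconjB x y : hconj (x - y) = hconj x - hconj y.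
Proof. by apply: H_ext => t; apply: complex_eq; rewrite /= !cE /=; ring. Qed.

Lemma hnorm_hconj x : hnorm (hconj x) = hnorm x.
Proof. by rewrite /hnorm !sqn_RI; congr Num.sqrt; apply: eq_Rintegral => t _; rewrite csqnormJ. Qed.

Lemma conv_hconj u x : conv u x -> conv (fun k => hconj (u k)) (hconj x).
Proof.
by move=> ux e e0; have [N hN] := ux e e0; exists N => m Nm; rewrite -hconjB hnorm_hconj hN.
Qed.

(** The kernel [exp (i t xi)] is symmetric in its two variables and bounded, so this is Fubini for a
    bounded kernel. There is no conjugation: the operator is complex symmetric, not self-adjoint. *)
Lemma fourier_sym x y : cint x -> cint y -> ip (fourier x) (hconj y) = ip x (hconj (fourier y)).
Proof.
move=> ix iy; rewrite !(ip_cI _ _).2.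
have E (a b : H R) : cint a -> cint b ->
    (fun t => fourier a t * (hconj b t)^*%C) =
    fun t => (fourier_cst R)%:C%C * (b t * cI (fun xi => a xi * expi (1 * ((t, xi).1 * (t, xi).2)))).
  move=> ia ib; apply/funext => t.
  have -> : (hconj b t)^*%C = b t by apply: complex_eq; rewrite /= !cE ?opprK.
  rewrite fourierE// /fourierI; have [t0|t0] := ltP 0 t; last by rewrite (H_pos b t0) mulr0 mul0r mulr0.
  have -> : (fun xi => a xi * expi (1 * ((t, xi).1 * (t, xi).2))) = fun xi => a xi * expi (t * xi).
    by apply/funext => xi; rewrite mul1r.
  by ring.
have -> : (fun t => x t * (hconj (fourier y) t)^*%C) = fun t => fourier y t * (hconj x t)^*%C.
  by apply/funext => t; apply: complex_eq; rewrite /= !cE; ring.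
rewrite (E x y ix iy) (E y x iy ix).
have B (z : RR * RR) : cabs (expi (1 * (z.1 * z.2))) <= 1 by rewrite cabs_expi.
have [i1 I1] := cfubiniM iy ix (meas_expi2 1) B.
have [i2 I2] := cfubiniM ix iy (meas_expi2 1) B.
rewrite (cIZ (fourier_cst R)%:C%C i1) (cIZ (fourier_cst R)%:C%C i2) I1.
have -> // : cI (fun s => x s * cI (fun t => y t * expi (1 * ((t, s).1 * (t, s).2)))) =
   cI (fun s => x s * cI (fun t => y t * expi (1 * ((s, t).1 * (s, t).2)))).
by apply: eq_cI => s; congr (x s * _); apply: eq_cI => t; rewrite /= [t * s]mulrC.
Qed.

Lemma graphF_sym x y x' y' : graphF x y -> graphF x' y' -> ip y (hconj x') = ip x (hconj y').
Proof.
move=> [u [iu ux uy]] [v [iv vx vy]].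
apply: (conv_ip_eq uy (conv_hconj vx) ux (conv_hconj vy)) => k.
exact: fourier_sym.
Qed.

(** * The square of the truncated Fourier operator *)

Lemma laplace_expi_cabs (e a : R) : 0 < a -> cabs (laplace_expi e a) <= a^-1.
Proof.
move=> a0; have d0 : 0 < e ^+ 2 + a ^+ 2 by rewrite ltr_wpDl ?sqr_ge0 ?exprn_gt0.
apply: cabs_le; first by rewrite invr_ge0 ltW.
have -> : csqnorm (laplace_expi e a) = (e ^+ 2 + a ^+ 2)^-1.
  by rewrite /csqnorm /laplace_expi /=; field; rewrite gt_eqF.
by rewrite exprVn lef_pV2 ?posrE ?exprn_gt0// lerDr sqr_ge0.
Qed.

Lemma laplace_expi_cvg (a : R) : 0 < a -> ccvg (fun k => laplace_expi (k.+1%:R^-1) a) (Complex 0 a^-1).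
Proof.
move=> a0; have a1 : a != 0 by rewrite gt_eqF.
have c : ((k.+1%:R^-1 ^+ 2 + a ^+ 2)^-1 : R) @[k --> \oo] --> (a ^+ 2)^-1.
  apply: cvgV; first by rewrite expf_neq0.
  rewrite -[X in _ --> X]add0r; apply: cvgD; last exact: cvg_cst.
  under eq_fun do rewrite expr2.
  by rewrite -(mulr0 (0 : R)); apply: cvgM; exact: cvg_harmonic.
split.
- rewrite -(mul0r ((a ^+ 2)^-1)); apply: cvgM => //; exact: cvg_harmonic.
- have -> : a^-1 = a * (a ^+ 2)^-1 by field.
  by apply: cvgM => //; exact: cvg_cst.
Qed.

(** By [abel] with [s = 1] the damped composition has kernel [1/(2 pi) * 1/(e - i (t + eta))],
    dominated by [1/(2 pi (t + eta))] uniformly in [e]. The limit kernel [i / (2 pi (t + eta))] is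
    [i/2] times the Carleman kernel. *)
Lemma fourier_sq_pointwise x t : cint x ->
  ccvg (fun k => fourier (damp k (fourier x)) t) (('i%C / 2%:R *: carleman x) t).
Proof.
rewrite HZE => ix; have [t0|t0] := ltP 0 t; last first.
  by rewrite (H_pos (carleman x) t0) mulr0; under eq_fun do rewrite H_pos//; exact: ccvg_cst.
pose f k eta : C := x eta * laplace_expi (k.+1%:R^-1) (t + 1 * eta).
have E k : fourier (damp k (fourier x)) t = (fourier_cst R ^+ 2)%:C%C * cI (f k).
  have e0 : 0 < k.+1%:R^-1 :> R by rewrite invr_gt0.
  have [i1 I1] := abel 1 t e0 ix.
  rewrite fourierE; last exact: damp_cint.
  rewrite /fourierI t0 -I1 rmorphXn expr2 -mulrA -(cIZ _ i1); congr (_ * _).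
  apply: eq_cI => s; rewrite /= fourierE//.
  rewrite /fourierI; have [s0|s0] := ltP 0 s; last by rewrite /expp ltNge s0/= !mul0r mulr0.
  have -> : (fun xi => x xi * expi (1 * (s * xi))) = fun xi => x xi * expi (s * xi).
    by apply/funext => xi; rewrite mul1r.
  by rewrite [t * s]mulrC; ring.
have pi0 : pi != 0 :> R by rewrite gt_eqF// pi_gt0.
pose g eta : C := ('i%C * pi%:C%C) * ((kern t eta)%:C%C * x eta).
have gE eta : 0 < eta -> g eta = x eta * Complex 0 (t + 1 * eta)^-1.
  move=> h0; rewrite /g /kern t0 h0/= mul1r.
  have te : t + eta != 0 by rewrite gt_eqF// addr_gt0.
  rewrite [RHS]mulrC mulrA; congr (_ * _).
  apply: complex_eq; rewrite !cE /=; move: (@pi R) pi0 => p p0; field; rewrite ?p0 ?te//.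
have c : ccvg (fun k => cI (f k)) (cI g).
  apply: (@cI_dct _ f g (fun eta => pi * (kern t eta * cabs (x eta)))).
  - move=> k; apply: cmeasM; first exact: H_meas.
    have mA : meas (fun eta : RR => ((k.+1%:R^-1) ^+ 2 + (t + 1 * eta) ^+ 2 : R)).
      by apply: measurable_funD => //; apply: measurable_funX; apply: measurable_funD => //;
         apply: measurable_funM => //; exact: meas_id.
    have mB := measurableT_comp (@meas_inv R) mA.
    split; first by apply: measurable_funM => //; exact: mB.
    apply: measurable_funM; last exact: mB.
    by apply: measurable_funD => //; apply: measurable_funM => //; exact: meas_id.
  - move=> eta; have [h0|h0] := ltP 0 eta; last first.
      by rewrite /g /f (H_pos x h0) !mulr0; under eq_fun do rewrite mul0r; exact: ccvg_cst.
    by rewrite (gE _ h0); apply: ccvgMl; apply: laplace_expi_cvg; rewrite mul1r addr_gt0.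
  - by apply: rintZ; apply: kern_g_rint; exact: H_cabs_L2.
  - move=> k eta; rewrite /f; have [h0|h0] := ltP 0 eta; last first.
      by rewrite (H_pos x h0) mul0r cabs0 !mulr0.
    have te : 0 < t + 1 * eta by rewrite mul1r addr_gt0.
    rewrite cabsM mulrA mulrC; apply: ler_wpM2r; first exact: cabs_ge0.
    apply: (le_trans (laplace_expi_cabs _ te)); rewrite /kern t0 h0 /= mul1r.
    by rewrite invfM mulrA mulfV// mul1r.
have gI : (fourier_cst R ^+ 2)%:C%C * cI g = 'i%C / 2%:R * carleman x t.
  rewrite /g cIZ; last exact: carleman_cint.
  rewrite -[cI _]/(carleman x t) mulrA; congr (_ * _).
  rewrite mulrCA -rmorphM fourier_cst_sq.
  have -> : (2 * pi)^-1 * pi = 2^-1 :> R by move: (@pi R) pi0 => p p0; field.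
  by rewrite fmorphV rmorph_nat.
rewrite -gI; under eq_fun do rewrite E; exact: ccvgMl.
Qed.

(** The damped compositions converge in norm to [z] because F is bounded, and pointwise to the
    Carleman side; the two limits agree up to a null function. *)
Lemma graphF_sq_cint x z : cint x -> graphF (fourier x) z -> hnorm (z - ('i%C / 2%:R) *: carleman x) = 0.
Proof.
move=> ix h.
have c : conv (fun k => fourier (damp k (fourier x))) z.
  by apply: (graphF_conv _ _ h); [move=> k; exact: damp_cint|exact: damp_conv].
by apply: (conv_pointwise c) => t; exact: fourier_sq_pointwise.
Qed.

Lemma carleman_conv u x : conv u x -> conv (fun k => carleman (u k)) (carleman x).
Proof.
move=> ux; apply: (@conv_bound 1 _ _ u x) => // k.
by rewrite -carlemanB mul1r carleman_contr.
Qed.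

Lemma conv_Z (k : C) u x : conv u x -> conv (fun m => k *: u m) (k *: x).
Proof.
move=> ux; apply: (@conv_bound (cabs k) _ _ u x) => [|m|//]; first exact: cabs_ge0.
by rewrite -scalerBr hnormZ.
Qed.

Lemma graphF_sq x y z : graphF x y -> graphF y z -> hnorm (z - ('i%C / 2%:R) *: carleman x) = 0.
Proof.
move=> [u [iu ux uy]] h.
have [w hw] := @boolp.choice _ _ (fun k (w0 : H R) => graphF (fourier (u k)) w0) (fun k => graphF_total (fourier (u k))).
apply: (@conv_unique _ w).
- apply: (@conv_bound 2 _ _ (fun k => fourier (u k)) y) => // k.
  by apply: graphF_le; exact: graphFB.
- apply: (@conv_bound 1 _ _ (fun k => ('i%C / 2%:R) *: carleman (u k)) (('i%C / 2%:R) *: carleman x)) => //.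
    move=> k; rewrite mul1r; apply: (le_trans (hnorm_triangle _ (('i%C / 2%:R) *: carleman (u k)) _)).
    by rewrite (graphF_sq_cint (iu k) (hw k)) add0r.
  by apply: conv_Z; exact: carleman_conv.
Qed.

(** * Dilations *)

Lemma dilate_L2pos (a : R) x : 0 < a -> L2pos (fun t => x (a * t)).
Proof.
move=> a0; have [[mr hr] [mi hi]] := H_L2 x.
have B (f : RR -> R) : meas f -> (sqi mu f < +oo)%E -> L2 mu (fun t => f (a * t)).
  move=> mf fo; split.
    by apply: measurableT_comp => //; exact: measurable_funM.
  move: fo; rewrite (sqi_scale a0 mf); case: (sqi mu (fun t => f (a * t))) (sqi_ge0 mu (fun t => f (a * t))) => [r||]//.
    by move=> *; rewrite ltry.
  by rewrite mulry gtr0_sg// mul1e.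
apply/L2posP; split; [exact: B mr hr|exact: B mi hi|].
by move=> t t0; rewrite H_pos// pmulr_rle0.
Qed.

Definition dilate (a : R) (a0 : 0 < a) x : H R := MkH (dilate_L2pos x a0).

Lemma sqn_dilate (a : R) (a0 : 0 < a) x : sqn x = a * sqn (dilate a0 x).
Proof.
by rewrite !sqn_RI (RI_scale a0 (csqnorm_rint x)).
Qed.

Lemma dilate_cint (a : R) (a0 : 0 < a) x : cint x -> cint (dilate a0 x).
Proof.
by move=> [r i]; split; [exact: (rint_scale a0 r)|exact: (rint_scale a0 i)].
Qed.

Lemma dilate_conv (a : R) (a0 : 0 < a) u x : conv u x -> conv (fun k => dilate a0 (u k)) (dilate a0 x).
Proof.
apply: (@conv_bound (Num.sqrt a^-1)) => [|k]; first exact: sqrtr_ge0.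
have -> : dilate a0 (u k) - dilate a0 x = dilate a0 (u k - x) by exact: H_ext.
rewrite /hnorm -sqrtrM ?invr_ge0 ?(ltW a0)// (sqn_dilate a0 (u k - x)).
by rewrite mulKf// gt_eqF.
Qed.

Lemma cI_scale (a : R) (f : RR -> C) : 0 < a -> cint f -> cI f = a%:C%C * cI (fun t => f (a * t)).
Proof.
move=> a0 [r i]; apply: complex_eq; rewrite ?cReMl ?cImMl.
- exact: (RI_scale a0 r).
- exact: (RI_scale a0 i).
Qed.

(** Substitution in the Fourier integral: the phase [t * xi] stays fixed when one variable is
    dilated and the other contracted. *)
Lemma graphF_dilate (a : R) (a0 : 0 < a) (b0 : 0 < a^-1) x y : graphF x y ->
  graphF (dilate a0 x) (a^-1%:C%C *: dilate b0 y).
Proof.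
move=> [u [iu ux uy]]; exists (fun k => dilate a0 (u k)); split.
- by move=> k; exact: dilate_cint.
- exact: dilate_conv.
have -> : (fun k => fourier (dilate a0 (u k))) = fun k => a^-1%:C%C *: dilate b0 (fourier (u k)); last first.
  by apply: conv_Z; exact: dilate_conv.
apply/funext => k; apply: H_ext => t; rewrite HZE /= !fourierE//; last exact: dilate_cint.
rewrite /fourierI pmulr_rgt0//; case: ifP => t0; last by rewrite mulr0.
rewrite mulrCA; congr (_ * _).
have ie := cint_expi (a^-1 * t) (iu k).
rewrite (cI_scale a0 ie) mulrA -rmorphM mulVf ?gt_eqF// mul1r.
apply: eq_cI => s /=; congr (_ * expi _).
by rewrite mulrACA mulVf ?gt_eqF// mul1r.
Qed.

(** * Identification with the limit of truncated Fourier integrals *)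

Definition cut (k : nat) (t : R) : R := if (0 < t) && (t <= k%:R) then 1 else 0.

Lemma meas_cut k : meas (fun t : RR => cut k t).
Proof.
apply: measurable_fun_ifT => //; apply: measurable_and.
- by apply: measurable_fun_ltr => //; exact: meas_id.
- by apply: measurable_fun_ler => //; exact: meas_id.
Qed.

Lemma cut01 k t : 0 <= cut k t <= 1.
Proof. by rewrite /cut; case: ifP => _; rewrite ?lexx ?ler01. Qed.

Definition truncH k x : H R := MkH (mul_L2pos x (meas_cut k) (cut01 k)).

Lemma truncH_conv x : conv (truncH ^~ x) x.
Proof.
apply: (@mul_conv _ cut) => //; [exact: meas_cut|exact: cut01|].
move=> t t0; apply: (@cvg_near_cst _ _ _ _ _); near=> k.
by rewrite /cut t0 /=; case: ifP => // /negP[]; near: k; exact: nbhs_infty_ger.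
Unshelve. all: by end_near. Qed.

Lemma cut_L2 k : L2 mu (fun t : RR => cut k t).
Proof.
apply: (L2_bound (meas_cut k) (L2Z (expR k%:R) (@expp_L2 R 1 ltr01))) => t.
rewrite ler_pXn2r ?nnegrE//; last 2 first.
- by case/andP: (cut01 k t).
- by rewrite mulr_ge0 ?expR_ge0 ?expp_ge0.
rewrite /cut /expp; case: ltP => t0 /=; last by rewrite mulr0.
case: ifP => tk; last by rewrite mulr_ge0 ?expR_ge0.
by rewrite -expRD mul1r -[leLHS]expR0 ler_expR subr_ge0.
Qed.

Lemma truncH_cint k x : cint (truncH k x).
Proof.
apply: (@cint_le _ _ (fun t => cut k t * cabs (x t))).
- exact: H_meas.
- by apply: L2_mul; [exact: cut_L2|exact: H_cabs_L2].
- by move=> t; rewrite /= cabsM cabsR ger0_norm//; case/andP: (cut01 k t).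
Qed.

Lemma FP_truncE k x : FP_trunc x k%:R = fourier (truncH k x) :> (R -> C).
Proof.
apply/funext => t; rewrite fourierE; last exact: truncH_cint.
rewrite /FP_trunc /fourierI; case: ifP => // t0; congr (_ * _).
have cE s : (s \in (`[0, k%:R]%classic : set R)) = (0 <= s) && (s <= k%:R).
  by apply/idP/idP; rewrite inE /= in_itv.
have z s (f : C) : s \notin (`[0, k%:R]%classic : set R) -> truncH k x s * f = 0.
  rewrite cE /= /cut => h; case: ifP; rewrite ?mul0r//.
  by move=> /andP[/ltW s0 sk]; rewrite s0 sk in h.
have o s (f : C) : s \in (`[0, k%:R]%classic : set R) -> truncH k x s * f = x s * f.
  rewrite cE /= /cut => /andP[s0 sk]; rewrite sk andbT.
  move: s0; rewrite le_eqVlt => /predU1P[<-|->]; last by rewrite mul1r.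
  (* At [s = 0], the only point where the closed interval and [cut] differ, [x] vanishes. *)
  by rewrite (H_pos x (lexx 0)) mulr0.
apply: complex_eq; rewrite /cI /cintegral /= Rintegral_mkcond; apply: eq_Rintegral => s _.
- by rewrite patchE; case: ifPn => sI; [rewrite o|rewrite z].
- by rewrite patchE; case: ifPn => sI; [rewrite o|rewrite z].
Qed.

(** The truncations of [x] form an admissible sequence for [graphF]; conversely [graphF_conv] shows
    that this particular sequence converges to the right limit. [dist2] is a squared norm, so the
    two notions of convergence differ by a square. *)
Lemma FP_pos_graphE x y : FP_pos_graph x y <-> graphF x y.
Proof.
have E : (fun k : nat => dist2 (FP_trunc x k%:R) y) = fun k => (sqn (fourier (truncH k x) - y))%:E.
  by apply/funext => k; rewrite FP_truncE dist2E.
split=> [[_ _]|h].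
- rewrite E => /fine_cvg /= h; exists (truncH ^~ x); split.
  + by move=> k; exact: truncH_cint.
  + exact: truncH_conv.
  + move=> e e0; move/cvgr0Pnorm_le : h => /(_ _ (exprn_gt0 2 e0))[N _ hN].
    by exists N => m Nm; apply: (hnorm_le (ltW e0)); apply: (le_trans (ler_norm _)); exact: hN.
- split; [exact: hP|exact: hP|rewrite E].
  apply: cvg_EFin; first exact: nearW.
  have /convP c := graphF_conv (truncH_cint ^~ x) (@truncH_conv x) h.
  rewrite /=; have -> : (fine \o (fun k => (sqn (fourier (truncH k x) - y))%:E)) = fun k => hnorm (fourier (truncH k x) - y) * hnorm (fourier (truncH k x) - y).
    by apply/funext => k /=; rewrite -expr2 hnorm_sqr.
  by rewrite -(mulr0 (0 : R)); apply: cvgM.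
Qed.

End Graph.

(** * The resolvent set *)

Section Resolvent.
Variable R : realType.
Local Notation C := R[i].
Local Notation mu := (@lebesgue_measure R).
Local Notation RI := (Rintegral mu setT).
Local Notation RR := (measurableTypeR R).
Implicit Types x y z h : H R.

(** * Positivity of the Carleman operator through the Laplace transform *)

Definition lap (r s : R) : R := if (0 < r) && (0 < s) then expR (- (r * s)) else 0.

Lemma lap01 r s : 0 <= lap r s <= 1.
Proof.
rewrite /lap; case: ifP => [/andP[r0 s0]|_]; last by rewrite lexx ler01.
by rewrite expR_ge0 -expR0 ler_expR oppr_le0 mulr_ge0// ltW.
Qed.

Lemma meas_lap : meas (fun z : RR * RR => lap z.1 z.2).
Proof.
rewrite /lap; apply: measurable_fun_ifT => //.
- by apply: measurable_and; apply: measurable_fun_ltr.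
- apply: (@measurableT_comp _ _ _ _ _ _ (@expR R)) => //.
  by apply: measurableT_comp => //; apply: measurable_funM; [exact: meas_fst|exact: meas_snd].
Qed.

(** [pi * kern s t] with [d] added to the denominator. On the Laplace side the shift is a factor
    [exp (- d r)], which makes all the integrals absolutely convergent. *)
Definition regk (d s t : R) : R := if (0 < s) && (0 < t) then (d + s + t)^-1 else 0.

Lemma regk_lap (d s t : R) : 0 < d ->
  cI (fun r => ((expp d r)%:C%C * (lap r s)%:C%C) * (lap r t)%:C%C) = (regk d s t)%:C%C.
Proof.
move=> d0; have -> : (fun r : RR => ((expp d r)%:C%C * (lap r s)%:C%C) * (lap r t)%:C%C) =
    fun r => (if (0 < s) && (0 < t) then expp (d + s + t) r else 0)%:C%C.
  apply/funext => r; rewrite -!rmorphM /lap /expp; congr ((_)%:C)%C.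
  case: (ltP 0 r) => r0 /=; last by rewrite !mul0r; case: ifP.
  case: (ltP 0 s) => s0 /=; last by rewrite mulr0 mul0r.
  case: (ltP 0 t) => t0 /=; last by rewrite mulr0.
  by rewrite -!expRD; congr expR; ring.
rewrite cIR /regk; case: ifP => [/andP[s0 t0]|_].
- by congr ((_)%:C)%C; apply: (expp_int _).2; rewrite !addr_gt0.
- by rewrite Rintegral_cst// mul0r.
Qed.

(* With the Laplace transform [g r = int_0^oo exp (- r s) x s ds], the quadratic form of
   the kernel [(d + s + t)^-1] is [int_0^oo exp (- d r) |g r|^2 dr]. *)
Lemma regk_pos (d : R) (x : RR -> C) : 0 < d -> cint x ->
  cint (fun s => x s * cI (fun t => (x t)^*%C * (regk d s t)%:C%C)) /\
  0 <= Re (cI (fun s => x s * cI (fun t => (x t)^*%C * (regk d s t)%:C%C))).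
Proof.
move=> d0 ix; have mx := cint_meas ix.
have ml : cmeas (fun z : RR * RR => (lap z.1 z.2)%:C%C) by apply: cmeasR; exact: meas_lap.
have mswap : meas (fun z : RR * RR => (z.2, z.1)) by exact: measurable_fun_pair.
have ml' : cmeas (fun z : RR * RR => (lap z.2 z.1)%:C%C).
  exact: (cmeas_comp ml mswap).
have lb r s : cabs ((lap r s)%:C%C : C) <= 1.
  by rewrite cabsR ger0_norm; case/andP: (lap01 r s).
have il r : cint (fun s => x s * (lap r s)%:C%C).
  apply: (@cint_le _ _ (fun s => cabs (x s))).
  - by apply: cmeasM => //; apply: cmeasR; exact: (meas_section1 r meas_lap).
  - exact: cint_cabs.
  - by move=> s; rewrite cabsM ler_piMr ?cabs_ge0.
pose g r := cI (fun s => x s * (lap r s)%:C%C).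
have mg : cmeas g.
  have mh : cmeas (fun z : RR * RR => x z.2 * (lap z.1 z.2)%:C%C).
    by apply: cmeasM => //; exact: (cmeas_comp mx).
  case: mh => mr mi; split.
  - by apply: (meas_RI mr) => r; exact: (il r).1.
  - by apply: (meas_RI mi) => r; exact: (il r).2.
have gb r : cabs (g r) <= RI (fun s => cabs (x s)).
  apply: cI_abs; [exact: il|exact: cint_cabs|].
  by move=> s; rewrite cabsM ler_piMr ?cabs_ge0.
pose f r : C := (expp d r)%:C%C * (g r)^*%C.
have fi : cint f.
  apply: cint_expp_bounded => //; first exact: cmeasJ.
  by move=> r; rewrite cabsJ; exact: gb.
have [i1 I1] := cfubiniM ix fi ml' (fun z : RR * RR => lb z.2 z.1).
have inner s : cI (fun r => f r * (lap r s)%:C%C) = cI (fun t => (x t)^*%C * (regk d s t)%:C%C).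
  have fi' : cint (fun r => (expp d r)%:C%C * (lap r s)%:C%C).
    have ms : cmeas (fun r : RR => (lap r s)%:C%C).
      by apply: cmeasR; exact: (meas_section2 s meas_lap).
    exact: (cint_expp_bounded d0 ms (fun r => lb r s)).
  have jx : cint (fun t => (x t)^*%C).
    apply: (@cint_le _ _ (fun s => cabs (x s))); [exact: cmeasJ|exact: cint_cabs|].
    by move=> t; rewrite cabsJ.
  have [_ I2] := cfubiniM fi' jx ml (fun z : RR * RR => lb z.1 z.2).
  apply: etrans (etrans I2 _); last first.
    by apply: eq_cI => t; congr (_ * _); exact: regk_lap.
  apply: eq_cI => r; rewrite /f -mulrA [_ * (lap r s)%:C%C]mulrC mulrA; congr (_ * _).
  rewrite /g -(cIJ (il r)); apply: eq_cI => t.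
  by apply: complex_eq; rewrite !cE /=; ring.
have E : (fun s => x s * cI (fun t => (x t)^*%C * (regk d s t)%:C%C)) =
   fun s => x s * cI (fun r => f r * (lap r s)%:C%C).
  by apply/funext => s; rewrite inner.
rewrite E; split; first exact: i1.
have -> : cI (fun s => x s * cI (fun r => f r * (lap r s)%:C%C)) =
   (RI (fun r => expp d r * csqnorm (g r)))%:C%C.
  apply: (etrans I1); rewrite -cIR; apply: eq_cI => r.
  rewrite -[cI _]/(g r) /f; move: (g r) => w.
  by apply: complex_eq; rewrite !cE /= /csqnorm; ring.
apply: Rintegral_ge0 => r _; apply: mulr_ge0; [exact: expp_ge0|exact: csqnorm_ge0].
Qed.

Lemma regk_ge0 d s t : 0 < d -> 0 <= regk d s t.
Proof.
move=> d0; rewrite /regk; case: ifP => // /andP[s0 t0].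
by rewrite invr_ge0 ltW// !addr_gt0.
Qed.

Lemma regk_le d s t : 0 < d -> regk d s t <= pi * kern s t.
Proof.
move=> d0; rewrite /regk /kern; case: ifP => [/andP[s0 t0]|_]; last by rewrite mulr0.
have p0 := @pi_gt0 R.
rewrite invfM mulrA mulfV ?gt_eqF// mul1r lef_pV2 ?posrE ?addr_gt0//.
by rewrite -addrA lerDr ltW.
Qed.

Lemma regk_cvg s t : regk (k.+1%:R^-1) s t @[k --> \oo] --> pi * kern s t.
Proof.
rewrite /regk /kern; case: ifP => [/andP[s0 t0]|_]; last by rewrite mulr0; exact: cvg_cst.
have p0 := @pi_gt0 R.
rewrite invfM mulrA mulfV ?gt_eqF// mul1r.
have c : (k.+1%:R^-1 + s + t : R) @[k --> \oo] --> s + t.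
  have -> : (fun k : nat => k.+1%:R^-1 + s + t) = fun k => k.+1%:R^-1 + (s + t).
    by apply/funext => k; rewrite addrA.
  by rewrite -[X in _ --> X]add0r; apply: cvgD; [exact: cvg_harmonic|exact: cvg_cst].
by apply: (cvgV _ c); rewrite gt_eqF// addr_gt0.
Qed.

(** Dominated convergence is applied twice as [d] tends to 0: to the inner integral with bound
    [pi * kern * |x|], then to the outer one with [pi * |x|] times the Carleman image of [|x|],
    which is integrable by [kern_schur]. *)
Lemma carleman_pos_cint x : cint x -> 0 <= ip x (carleman x).
Proof.
move=> ix; have mx := H_meas x; have Lx := H_cabs_L2 x.
have k0 (k : nat) : 0 < k.+1%:R^-1 :> R by rewrite invr_gt0.
pose A k s := cI (fun t => (x t)^*%C * (regk k.+1%:R^-1 s t)%:C%C).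
have mr k s : cmeas (fun t => (x t)^*%C * (regk k.+1%:R^-1 s t)%:C%C).
  apply: cmeasM; first exact: cmeasJ.
  apply: cmeasR; apply: measurable_fun_ifT => //.
  - by apply: measurable_and => //; apply: measurable_fun_ltr => //; exact: meas_id.
  - by apply: (measurableT_comp (@meas_inv R)); apply: measurable_funD => //; exact: meas_id.
have ik s : rint mu (fun t => pi * (kern s t * cabs (x t))).
  by apply: rintZ; exact: kern_g_rint.
have bd k s t : cabs ((x t)^*%C * (regk k.+1%:R^-1 s t)%:C%C) <= pi * (kern s t * cabs (x t)).
  rewrite cabsM cabsJ cabsR ger0_norm ?regk_ge0// mulrA [leLHS]mulrC.
  by apply: ler_wpM2r; [exact: cabs_ge0|exact: regk_le].
have Ac s : ccvg (fun k => A k s) (pi%:C%C * (carleman x s)^*%C).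
  have -> : pi%:C%C * (carleman x s)^*%C = cI (fun t => (x t)^*%C * (pi * kern s t)%:C%C).
    rewrite -[carleman x s]/(carleman_fun x s) /carleman_fun -(cIJ (carleman_cint x s)) -cIZ.
      by apply: eq_cI => t; apply: complex_eq; rewrite !cE /=; ring.
    apply: (@cint_le _ _ (fun t => kern s t * cabs (x t))).
    - by apply: cmeasJ; exact: cint_meas (carleman_cint x s).
    - exact: kern_g_rint.
    - by move=> t; rewrite cabsJ cabsM cabsR ger0_norm ?kern_ge0.
  apply: (@cI_dct _ _ _ (fun t => pi * (kern s t * cabs (x t)))) => //.
  by move=> t; apply/ccvgMl/ccvgR; exact: regk_cvg.
have [] := @cI_dct _ (fun k s => x s * A k s) (fun s => x s * (pi%:C%C * (carleman x s)^*%C))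
   (fun s => pi * (cabs (x s) * RI (fun t => kern s t * cabs (x t)))).
- by move=> k; exact: cint_meas (regk_pos (k0 k) ix).1.
- by move=> s; apply: ccvgMl; exact: Ac.
- by apply: rintZ; apply: L2_mul => //; exact: (kern_schur Lx).1.
- move=> k s; rewrite cabsM mulrCA; apply: ler_wpM2l; first exact: cabs_ge0.
  rewrite -(RIZ pi (kern_g_rint s Lx)).
  apply: cI_abs => //; first by apply: (cint_le (mr k s) (ik s)) => t; exact: bd.
move=> c _.
have h : 0 <= Re (cI (fun s => x s * (pi%:C%C * (carleman x s)^*%C))).
  apply: (ler_cvg_to (cvg_cst 0) c); apply: nearW => k.
  exact: (regk_pos (k0 k) ix).2.
have [i1 ->] := ip_cI x (carleman x).
have p0 := @pi_gt0 R.
rewrite -(pmulr_rge0 _ p0) -cReMl -(cIZ _ i1).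
by move: h; congr (0 <= Re (cI _)); apply/funext => s; rewrite mulrCA.
Qed.

Lemma carleman_pos x : 0 <= ip (carleman x) x.
Proof.
have c := damp_conv x.
have := conv_ip c (carleman_conv c) => /(ler_cvg_to (cvg_cst 0)) h.
rewrite ipC; apply: h; apply: nearW => k.
by apply: carleman_pos_cint; exact: damp_cint.
Qed.

Lemma nullD (k : C) x y : hnorm x = 0 -> hnorm y = 0 -> hnorm (x + k *: y) = 0.
Proof.
move=> x0 y0; apply/eqP; rewrite eq_le hnorm_ge0 andbT.
by apply: (le_trans (hnormD _ _)); rewrite hnormZ x0 y0 mulr0 addr0.
Qed.

Lemma null_carleman x : hnorm x = 0 -> hnorm (carleman x) = 0.
Proof. by move=> x0; apply/eqP; rewrite eq_le hnorm_ge0 andbT -x0 carleman_contr. Qed.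

(** * A coercive quadratic in the Carleman operator *)

Section Quadratic.
Variables (m l : R).
Hypothesis ml : [\/ l != 0, m < 0 | 1 < m].

(** The product of [T - (m + i l)] and [T - (m - i l)], expanded; its coefficients are real. *)
Definition rform h := carleman (carleman h) - (2 * m)%:C%C *: carleman h + (m ^+ 2 + l ^+ 2)%:C%C *: h.

Lemma rformB x y : rform (x - y) = rform x - rform y.
Proof.
rewrite /rform !carlemanB; move: (carleman (carleman x)) (carleman (carleman y)) (carleman x) (carleman y) => a b c e.
by apply: H_ext => t; rewrite !HE; ring.
Qed.

Lemma rformZ (r : R) x : rform (r%:C%C *: x) = r%:C%C *: rform x.
Proof. by rewrite /rform !carlemanZ; apply: H_ext => t; rewrite !HE; ring. Qed.

Lemma rform_le x : hnorm (rform x) <= (1 + 2 * `|m| + (m ^+ 2 + l ^+ 2)) * hnorm x.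
Proof.
have h := carleman_contr x; have h' := le_trans (carleman_contr (carleman x)) h.
have c0 : 0 <= m ^+ 2 + l ^+ 2 by rewrite addr_ge0 ?sqr_ge0.
rewrite /rform; apply: (le_trans (hnormD _ _)); rewrite hnormZ cabsR (ger0_norm c0) [leRHS]mulrDl.
apply: lerD => //; apply: (le_trans (hnormB _ _)); rewrite hnormZ cabsR normrM normr_nat [leRHS]mulrDl mul1r.
exact: (lerD h' (ler_wpM2l (mulr_ge0 (ler0n R 2) (normr_ge0 m)) h)).
Qed.

Lemma rform_ip x : ip (rform x) x = sqn (carleman x) - 2 * m * ip (carleman x) x + (m ^+ 2 + l ^+ 2) * sqn x.
Proof.
by rewrite /rform ipDl ipBl !ipZl carleman_sym.
Qed.

(** With [c = |x|^2] and [b = <T x, x>], which lies between 0 and [c], the form is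
    [|T x - m x|^2 + l^2 c]. This gives the constant [l^2]. For [m < 0] the term [- 2 m b] is
    nonnegative, leaving [m^2]. For [m > 1], subtracting [|T x - x|^2] leaves at least
    [(m^2 - 1) c - 2 (m - 1) b >= (m - 1)^2 c]. *)
Lemma rform_coercive : exists d : R, 0 < d /\ forall x, d * sqn x <= ip (rform x) x.
Proof.
have b0 x := carleman_pos x.
have bc x : ip (carleman x) x <= sqn x.
  rewrite -hnorm_sqr expr2; apply: (le_trans (ler_norm _)); apply: (le_trans (ip_CS _ _)).
  by rewrite ler_wpM2r ?hnorm_ge0// carleman_contr.
have c0 x := sqn_ge0 x.
have sq (r : R) x : 0 <= sqn (carleman x) - 2 * r * ip (carleman x) x + r ^+ 2 * sqn x.
  have -> : sqn (carleman x) - 2 * r * ip (carleman x) x + r ^+ 2 * sqn x = sqn (carleman x - r%:C%C *: x).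
    by rewrite sqnD ipNr ipZr -[sqn (- _)]hnorm_sqr hnormN hnorm_sqr sqnZ /csqnorm /=; ring.
  exact: sqn_ge0.
case: ml => h.
- exists (l ^+ 2); split; first by rewrite lt_def sqrf_eq0 h sqr_ge0.
  by move=> x; rewrite rform_ip; have := sq m x; lra.
- exists (m ^+ 2); split; first by rewrite lt_def sqrf_eq0 lt_eqF// sqr_ge0.
  move=> x; rewrite rform_ip; have := b0 x; have := sqn_ge0 (carleman x); have := c0 x; have := sqr_ge0 l.
  move: (ip _ _) (sqn (carleman x)) (sqn x) => b a c; nra.
- exists ((m - 1) ^+ 2); split.
    by rewrite lt_def sqrf_eq0 subr_eq0 gt_eqF// sqr_ge0.
  move=> x; rewrite rform_ip; have := bc x; have := sq 1 x; have := c0 x; have := sqr_ge0 l.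
  move: (ip _ _) (sqn (carleman x)) (sqn x) => b a c; nra.
Qed.

End Quadratic.

Lemma rformE (mu0 : C) h : let w := carleman h - (mu0^*)%C *: h in
  carleman w - mu0 *: w = rform (Re mu0) (Im mu0) h.
Proof.
move=> w; rewrite /w /rform carlemanB carlemanZ; case: mu0 w => a b w.
apply: H_ext => t; rewrite !HE.
move: (carleman (carleman h) t) (carleman h t) (h t) => [u1 u2] [v1 v2] [h1 h2].
by apply: complex_eq; rewrite !cE /=; ring.
Qed.

(** * Bijectivity off the segment *)

Section Bounded.
Variable lam : C.
Let m0 : C := - 2%:R * 'i%C * lam ^+ 2.

Lemma m0E : 'i%C / 2%:R * m0 = lam ^+ 2.
Proof.
have ii : 'i%C * 'i%C = -1 :> C by rewrite -expr2 sqr_i.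
rewrite /m0; have -> : 'i%C / 2%:R * (- 2%:R * 'i%C * lam ^+ 2) =
  - ('i%C * 'i%C) * lam ^+ 2 * (2%:R / 2%:R) :> C by ring.
by rewrite ii opprK mul1r mulfV ?mulr1// pnatr_eq0.
Qed.

Hypothesis h0 : [\/ Im m0 != 0, Re m0 < 0 | 1 < Re m0].

(** If [rform h = - 2 i y] and [w = (T - conj m0) h], then [(T - m0) w = - 2 i y]. Hence
    [x = (F + lam) w] satisfies [(F - lam) x = (i/2)(T - m0) w = y], up to null functions. *)
Lemma graphF_surj y : exists x z, graphF x z /\ hnorm (z - lam *: x - y) = 0.
Proof.
have [d [d0 Qd]] := rform_coercive h0.
have K0 : 0 < 1 + 2 * `|Re m0| + (Re m0 ^+ 2 + Im m0 ^+ 2).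
  by rewrite ltr_pwDl// ?addr_ge0 ?sqr_ge0// ltr_pwDl// mulr_ge0.
have [h hh] := zarantonello (rformB (Re m0) (Im m0)) (rformZ (Re m0) (Im m0)) d0 K0
  (rform_le (Re m0) (Im m0)) Qd ((- 2%:R * 'i%C) *: y).
pose w := carleman h - (m0^*)%C *: h.
have [v Gv] := graphF_total w; have [v2 Gv2] := graphF_total v.
exists (v + lam *: w), (v2 + lam *: v); split; first exact: graphF_lin.
have h2 := graphF_sq Gv Gv2.
have -> : v2 + lam *: v - lam *: (v + lam *: w) - y =
   (v2 - ('i%C / 2%:R) *: carleman w) + ('i%C / 2%:R) *: (rform (Re m0) (Im m0) h - (- 2%:R * 'i%C) *: y).
  rewrite -rformE -/w; apply: H_ext => t; rewrite !HE.
  have e1 := m0E; have e2 : 'i%C / 2%:R * (- 2%:R * 'i%C) = 1 :> C.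
    have ii : 'i%C * 'i%C = -1 :> C by rewrite -expr2 sqr_i.
    have -> : 'i%C / 2%:R * (- 2%:R * 'i%C) = - ('i%C * 'i%C) * (2%:R / 2%:R) :> C by ring.
    by rewrite ii opprK mul1r mulfV// pnatr_eq0.
  move: (carleman w t) (carleman h t - (m0^*)%C * h t) (v t) (v2 t) (y t) => a b c c2 y0.
  have -> : c2 - 'i%C / 2%:R * a + 'i%C / 2%:R * (a - m0 * b - - 2%:R * 'i%C * y0) =
    c2 - ('i%C / 2%:R * m0) * b - ('i%C / 2%:R * (- 2%:R * 'i%C)) * y0 by ring.
  by rewrite e1 e2; ring.
exact: nullD.
Qed.

(** Applying [F + lam] to the equation gives [(T - m0) x = 0], then [T - conj m0] gives
    [rform x = 0], and coercivity forces [x] to be null. *)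
Lemma graphF_inj x z : graphF x z -> hnorm (z - lam *: x) = 0 -> hnorm x = 0.
Proof.
move=> Gx zx; have [d [d0 Qd]] := rform_coercive h0.
have [z2 Gz] := graphF_total z.
have h1 := graphF_null (graphFB Gz (graphFZ lam Gx)) zx.
have h2 := graphF_sq Gx Gz.
have h3 : hnorm (carleman x - m0 *: x) = 0.
  have -> : carleman x - m0 *: x = (- 2%:R * 'i%C) *: (
     ((z2 - lam *: z) + lam *: (z - lam *: x)) + (-1) *: (z2 - ('i%C / 2%:R) *: carleman x)).
    apply: H_ext => t; rewrite !HE.
    have ii : 'i%C * 'i%C = -1 :> C by rewrite -expr2 sqr_i.
    have -> : - 2 * 'i%C * (z2 t - lam * z t + lam * (z t - lam * x t) -
       (z2 t - 'i%C / 2 * carleman x t)) = - ('i%C * 'i%C) * (2 / 2) * carleman x t - (- 2 * 'i%C * lam ^+ 2) * x t by ring.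
    by rewrite ii opprK mul1r mulfV ?mul1r// pnatr_eq0.
  by rewrite hnormZ (nullD (-1))// ?mulr0//; exact: nullD.
have h4 : hnorm (rform (Re m0) (Im m0) x) = 0.
  have -> : rform (Re m0) (Im m0) x = carleman (carleman x - m0 *: x) + (- (m0^*)%C) *: (carleman x - m0 *: x).
    rewrite -rformE carlemanB carlemanZ; apply: H_ext => t; rewrite !HE carlemanB carlemanZ !HE; ring.
  by apply: nullD => //; exact: null_carleman.
have := Qd x; have := ip_CS (rform (Re m0) (Im m0) x) x; rewrite h4 mul0r normr_le0 => /eqP ->.
rewrite pmulr_rle0// => q0; apply/eqP; rewrite eq_le hnorm_ge0 andbT.
by apply: hnorm_le => //; rewrite expr0n.
Qed.

End Bounded.

(** Translation only: functions are packed with their integrability proofs into [H], and vanishing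
    of [dist2] becomes vanishing of the seminorm of a difference. *)
Lemma resolventE (lam : C) : FP_pos_resolvent lam <->
  (forall y, exists x z, graphF x z /\ hnorm (z - lam *: x - y) = 0) /\
  (forall x z, graphF x z -> hnorm (z - lam *: x) = 0 -> hnorm x = 0).
Proof.
have E x z y : dist2 (fun t => z t - lam * x t) y = (sqn (z - lam *: x - y))%:E.
  rewrite -dist2E; suff -> : (fun t => z t - lam * x t) = (z - lam *: x : H R) by [].
  by apply/funext => t; rewrite [RHS]HDE HNE HZE.
have D (a b : H R) : dist2 a b = 0%E <-> hnorm (a - b) = 0.
  rewrite dist2E -hnorm_sqr; split=> [[/eqP]|->]; last by rewrite expr0n.
  by rewrite sqrf_eq0 => /eqP.
have Z : (fun=> 0 : C) = (0 : H R) by [].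
split=> [[a b]|[a b]]; split.
- move=> y; have [x [z [px g e]]] := a y (hP y).
  have pz : L2pos z by case: g.
  exists (MkH px), (MkH pz); split; first by apply/FP_pos_graphE.
  apply/D; rewrite dist2E; move: e; rewrite -[z]/(MkH pz : _ -> _) -[x]/(MkH px : _ -> _) E.
  by [].
- move=> x z g e; have := b x z (hP x); rewrite FP_pos_graphE Z E => /(_ g).
  by rewrite subr0 -hnorm_sqr e expr0n => /(_ erefl) /D; rewrite subr0.
- move=> y py; have [x [z [g e]]] := a (MkH py).
  exists x, z; split; [exact: hP|exact/FP_pos_graphE|].
  by rewrite -[y]/(MkH py : _ -> _) E -hnorm_sqr e expr0n.
- move=> x z px g e; have pz : L2pos z by case: g.
  have := b (MkH px) (MkH pz); rewrite -FP_pos_graphE => /(_ g).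
  rewrite Z; have -> : dist2 x (0 : H R) = dist2 (MkH px) (0 : H R) by [].
  move=> h; apply/D; rewrite subr0; apply: h.
  move: e; rewrite Z -[z]/(MkH pz : _ -> _) -[x]/(MkH px : _ -> _) E subr0 -hnorm_sqr => -[/eqP].
  by rewrite sqrf_eq0 => /eqP.
Qed.

End Resolvent.

(** * Approximate eigenfunctions of the Carleman operator *)

Section Mellin.
Variable R : realType.
Local Notation C := R[i].
Local Notation mu := (@lebesgue_measure R).
Local Notation RI := (Rintegral mu setT).
Local Notation RR := (measurableTypeR R).
Implicit Types x y z : H R.

Lemma pw_mul (p sqn r u : R) : p + sqn = r -> pw p u * pw sqn u = pw r u.
Proof. by move=> <-; rewrite pwD. Qed.

Lemma pwN1 (u : R) : 0 < u -> pw (-1) u = u^-1.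
Proof. by move=> u0; rewrite /pw mulN1r expRN lnK. Qed.

Lemma expR_lip (r t : R) : `|r| <= t -> `|expR r - 1| <= t * expR t.
Proof.
move=> rt; have t0 : 0 <= t by exact: le_trans (normr_ge0 _) rt.
have h : expR t - 1 <= t * expR t.
  have := expR_ge1Dx (- t); have E : expR t * expR (- t) = 1 by exact: expRxMexpNx_1.
  have := expR_gt0 t; move: (expR t) (expR (- t)) E => a b E a0 ab.
  have : a * (1 - t) <= a * b by rewrite ler_pM2l.
  rewrite E; lra.
apply: le_trans h; move: rt; rewrite !ler_norml => /andP[r1 r2].
have h1 : expR r <= expR t by rewrite ler_expR.
have := expR_ge1Dx r; have := expR_ge1Dx t; lra.
Qed.

Lemma abs_le_expR (k B : R) : 0 < k -> `|B| <= k * expR (`|B| / k).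
Proof.
move=> symkern; have := expR_ge1Dx (`|B| / k); rewrite -(ler_pM2l symkern).
by apply: le_trans; rewrite mulrDr mulrCA mulfV ?gt_eqF// !mulr1 lerDr ltW.
Qed.

(** Translating the cutoff by [B] changes it by a relative error of order [eps]. The growth
    [|B| exp (eps |B|)] is absorbed in [8 exp (|B| / 4)], using [eps <= 1/8] and
    [|B| <= 8 exp (|B| / 8)]; the rate 1/4 is below 1/2, so the error stays integrable against the
    Carleman kernel. *)
Lemma damp_lip (eps A B : R) : 0 <= eps <= 8^-1 ->
  `|expR (- (eps * `|B + A|)) - expR (- (eps * `|A|))| <=
  eps * (8 * expR (`|B| / 4)) * expR (- (eps * `|A|)).
Proof.
move=> /andP[e0 e8].
have -> : expR (- (eps * `|B + A|)) = expR (eps * (`|A| - `|B + A|)) * expR (- (eps * `|A|)).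
  by rewrite -expRD; congr expR; ring.
rewrite -[X in _ - X]mul1r -mulrBl normrM [`|expR _|]ger0_norm ?expR_ge0//.
apply: ler_wpM2r; first exact: expR_ge0.
have r1 : `|eps * (`|A| - `|B + A|)| <= eps * `|B|.
  rewrite normrM (ger0_norm e0); apply: ler_wpM2l => //.
  rewrite ler_norml lerBlDr lerBrDr addrC lerBlDl.
  have := ler_normD B A; have := ler_normB (B + A) B; rewrite addrAC subrr add0r.
  move: (`|A|) (`|B|) (`|B + A|) => a b c; lra.
apply: (le_trans (expR_lip r1)); rewrite -mulrA; apply: ler_wpM2l => //.
have h1 : `|B| <= 8 * expR (`|B| / 8) by exact: abs_le_expR.
have h2 : expR (eps * `|B|) <= expR (`|B| / 8).
  by rewrite ler_expR mulrC; apply: ler_wpM2l.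
have -> : expR (`|B| / 4) = expR (`|B| / 8) * expR (`|B| / 8).
  by rewrite -expRD; congr expR; field.
have := expR_ge0 (`|B| / 8); have := expR_ge0 (eps * `|B|).
move: (expR (`|B| / 8)) (expR (eps * `|B|)) (normr_ge0 B) h1 h2 => a b; nra.
Qed.

Lemma expR_abs_le (B : R) : expR (`|B|) <= expR B + expR (- B).
Proof.
have [b0|b0] := leP 0 B; first by rewrite ger0_norm// lerDl expR_ge0.
by rewrite ltr0_norm// lerDr expR_ge0.
Qed.

(** An upper bound for [c^(-1/2) * 8 exp (|ln c| / 4)], written as a sum of powers of [c] so that it
    can be integrated. *)
Definition dil_wt (c : R) : R := 8 * (pw (- 2^-1) c * (pw (4^-1) c + pw (- 4^-1) c)).

Lemma dil_wt_ge0 c : 0 <= dil_wt c.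
Proof. by rewrite !mulr_ge0 ?addr_ge0// ltW// pw_gt0. Qed.

Lemma dil_wt_lb c : pw (- 2^-1) c * (8 * expR (`|ln c| / 4)) <= dil_wt c.
Proof.
rewrite /dil_wt mulrCA; apply: ler_wpM2l => //; apply: ler_wpM2l; first exact/ltW/pw_gt0.
have -> : `|ln c| / 4 = `|ln c / 4| by rewrite normrM (@ger0_norm _ 4^-1)// invr_ge0.
by apply: (le_trans (expR_abs_le _)); rewrite /pw mulNr [ln c / 4]mulrC.
Qed.

(* Approximate eigenfunctions: [s^(-1/2 + i nu)] with a slow logarithmic cutoff. *)
Definition eigfun (nu eps s : R) : C :=
  if 0 < s then (pw (- 2^-1) s * expR (- (eps * `|ln s|)))%:C%C * expi (nu * ln s) else 0.

(** The power [s^(-1/2 + i nu)] is exactly homogeneous. Only the cutoff produces an error, and in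
    the variable [ln s] a dilation is a translation, to which [damp_lip] applies. *)
Lemma eigfun_dilate nu eps (c s : R) : 0 <= eps <= 8^-1 -> 0 < c ->
  cabs (eigfun nu eps (c * s) - (pw (- 2^-1) c)%:C%C * expi (nu * ln c) * eigfun nu eps s) <=
  eps * dil_wt c * cabs (eigfun nu eps s).
Proof.
move=> e08 c0; rewrite /eigfun pmulr_rgt0//; case: ifP => s0; last first.
  by rewrite mulr0 subrr cabs0 mulr0.
rewrite pwM// lnM ?posrE// mulrDr expiD.
set p := pw _ c; set ps := pw _ s; set E1 := expR _; set E2 := expR _.
have -> : (p * ps * E1)%:C%C * (expi (nu * ln c) * expi (nu * ln s)) -
   p%:C%C * expi (nu * ln c) * ((ps * E2)%:C%C * expi (nu * ln s)) =
   (p * ps * (E1 - E2))%:C%C * (expi (nu * ln c) * expi (nu * ln s)).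
  by rewrite !rmorphM rmorphB; ring.
have p0 : 0 <= p by exact/ltW/pw_gt0.
have ps0 : 0 <= ps by exact/ltW/pw_gt0.
rewrite !cabsM !cabsR !cabs_expi !mulr1 !normrM (ger0_norm p0) (ger0_norm ps0).
rewrite (@ger0_norm _ E2) ?expR_ge0//.
have := damp_lip (ln s) (ln c) e08; rewrite -/E1 -/E2 => h.
have h1 : p * ps * `|E1 - E2| <= p * ps * (eps * (8 * expR (`|ln c| / 4)) * E2).
  by apply: ler_wpM2l => //; exact: mulr_ge0.
apply: (le_trans h1).
have -> : p * ps * (eps * (8 * expR (`|ln c| / 4)) * E2) =
  eps * (p * (8 * expR (`|ln c| / 4))) * (ps * E2) by ring.
apply: ler_wpM2r; first by rewrite mulr_ge0 ?expR_ge0.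
by apply: ler_wpM2l; [case/andP: e08|exact: dil_wt_lb].
Qed.

Lemma cmeas_eigfun nu eps : cmeas (fun s : RR => eigfun nu eps s).
Proof.
apply: cmeas_if; first by apply: measurable_fun_ltr => //; exact: meas_id.
apply: cmeasM.
- apply: cmeasR; apply: measurable_funM; first exact: meas_pw.
  apply: (@measurableT_comp _ _ _ _ _ _ (@expR R)) => //.
  apply: measurableT_comp => //; apply: measurable_funM => //.
  by apply: measurableT_comp => //; exact: measurable_ln.
- by apply: cmeas_expi; apply: measurable_funM => //; exact: measurable_ln.
Qed.

Lemma csqnorm_eigfun nu eps s : csqnorm (eigfun nu eps s) =
  if 0 < s then pw (-1) s * expR (- (2 * eps * `|ln s|)) else 0.
Proof.
rewrite -cabs_sq /eigfun; case: ifP => s0; last by rewrite cabs0 expr0n.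
rewrite cabsM cabsR cabs_expi mulr1 real_normK ?num_real// exprMn.
rewrite !expr2 (@pw_mul _ _ (-1)) -?expRD; last by field.
by have -> : - (eps * `|ln s|) - eps * `|ln s| = - (2 * eps * `|ln s|) by ring.
Qed.

(* [min v v^-1] is comparable with [v / (1 + v ^ 2)], where [v = s ^ (2 eps)]. *)
Lemma csqnorm_eigfun_bounds nu eps s : 0 < eps ->
  let h := if 0 < s then 2 * eps * pw (2 * eps - 1) s / (1 + pw (2 * (2 * eps)) s) else 0 in
  (2 * eps)^-1 * h <= csqnorm (eigfun nu eps s) <= eps^-1 * h.
Proof.
move=> e0 /=; rewrite csqnorm_eigfun; case: ifP => s0; last by rewrite !mulr0 lexx.
set p := 2 * eps; have p0 : 0 < p by rewrite mulr_gt0.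
have -> : pw (p - 1) s = pw (-1) s * pw p s by rewrite -pwD addrC.
have -> : pw (2 * p) s = pw p s * pw p s by rewrite (@pw_mul _ _ (2 * p)) //; ring.
set v := pw p s; have v0 : 0 < v by exact: pw_gt0.
have w0 : 0 < pw (-1) s by exact: pw_gt0.
have d0 : 0 < 1 + v * v by rewrite addr_gt0// mulr_gt0.
have -> : p^-1 * (p * (pw (-1) s * v) / (1 + v * v)) = pw (-1) s * (v / (1 + v * v)).
  by field; rewrite !gt_eqF.
have -> : eps^-1 * (p * (pw (-1) s * v) / (1 + v * v)) = pw (-1) s * (2 * v / (1 + v * v)).
  by rewrite /p; field; rewrite !gt_eqF.
rewrite !ler_pM2l// ler_pdivrMr// ler_pdivlMr//.
have [l0|l0] := leP 0 (ln s).
- have v1 : 1 <= v by rewrite -expR0 ler_expR mulr_ge0// ltW.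
  rewrite (ger0_norm l0) expRN -[expR _]/v.
  have -> : v^-1 * (1 + v * v) = v^-1 + v by field; rewrite gt_eqF.
  rewrite lerDr invr_ge0 (ltW v0) /=.
  have : v^-1 <= v by rewrite (le_trans _ v1)// invf_le1.
  lra.
- have v1 : v <= 1 by rewrite -expR0 ler_expR nmulr_lle0// ltW.
  rewrite (ltr0_norm l0) mulrN opprK -[expR _]/v.
  have : v * (v * v) <= v by rewrite -[leRHS]mulr1 ler_pM2l// mulr_ile1 ?(ltW v0).
  have := mulr_gt0 v0 (mulr_gt0 v0 v0); rewrite mulrDr mulr1; lra.
Qed.

Lemma eigfun_L2pos nu eps : 0 < eps -> L2pos (eigfun nu eps) /\
  0 < RI (fun s => csqnorm (eigfun nu eps s)).
Proof.
move=> e0; have p0 : 0 < 2 * eps by rewrite mulr_gt0.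
have [i I] := pw_atan_int p0; have b s := csqnorm_eigfun_bounds nu s e0.
have mx := cmeas_eigfun nu eps.
have ic : rint mu (fun s => csqnorm (eigfun nu eps s)).
  apply: (rint_le _ (rintZ eps^-1 i)); first exact: meas_csqnorm.
  by move=> s; rewrite ger0_norm ?csqnorm_ge0//; case/andP: (b s).
split.
  split; [by case: mx|by case: mx|by move=> s s0; rewrite /eigfun ltNge s0|].
  by rewrite -RI_E// ltry.
have h : (2 * eps)^-1 * (pi / 2) <= RI (fun s => csqnorm (eigfun nu eps s)).
  rewrite -I -(RIZ _ i); apply: le_Rintegral => //; first exact: rintZ.
  by move=> s _; case/andP: (b s).
by apply: (lt_le_trans _ h); rewrite mulr_gt0 ?invr_gt0// divr_gt0// pi_gt0.
Qed.

Definition eigH nu eps (e0 : 0 < eps) : H R := MkH (eigfun_L2pos nu e0).1.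

Lemma eigH_gt0 nu eps (e0 : 0 < eps) : 0 < hnorm (eigH nu e0).
Proof. by rewrite sqrtr_gt0 sqn_RI; exact: (eigfun_L2pos nu e0).2. Qed.

Lemma hnorm_pointwise (c : R) x y : 0 <= c -> (forall t, cabs (x t) <= c * cabs (y t)) ->
  hnorm x <= c * hnorm y.
Proof.
move=> c0 h; apply: hnorm_le; first by rewrite mulr_ge0 ?hnorm_ge0.
have i := @csqnorm_rint R.
rewrite exprMn hnorm_sqr !sqn_RI -(RIZ _ (i y)); apply: (le_Rintegral measurableT (i x) (rintZ _ (i y))).
by move=> t _; rewrite -!cabs_sq -exprMn ler_pXn2r ?nnegrE ?mulr_ge0 ?cabs_ge0.
Qed.

(** * The symbol of the Carleman operator *)

(** The kernel of T as a multiplicative convolution, twisted by the homogeneity [-1/2]; it is a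
    probability density. *)
Definition symkern (u : R) : R := kern 1 u * pw (- 2^-1) u.

Lemma symkernE u : symkern u = if 0 < u then pw (- 2^-1) u / (pi * (1 + u)) else 0.
Proof. by rewrite /symkern /kern ltr01 /=; case: ifP => _; rewrite ?mul0r// mulrC. Qed.

Lemma symkern_int : rint mu (symkern : RR -> R) /\ RI (symkern : RR -> R) = 1.
Proof.
have -> : (symkern : RR -> R) = fun u => if 0 < u then pw (- 2^-1) u / (pi * (1 + u)) else 0.
  by apply/funext => u; exact: symkernE.
exact: sqrt_kern_int.
Qed.

Lemma symkern_ge0 u : 0 <= symkern u.
Proof. by rewrite mulr_ge0 ?kern_ge0// ltW// pw_gt0. Qed.

Lemma meas_dil_wt : meas (fun u : RR => dil_wt u).
Proof.
apply: measurable_funM => //; apply: measurable_funM; first exact: meas_pw.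
by apply: measurable_funD; exact: meas_pw.
Qed.

(** With [v = u^(1/2)], the estimate [(1 + v) / (1 + v^2) <= 2 / (1 + v)] reduces this to
    [pw_atan_int] for [p = 1/4]. *)
Lemma kern_dil_wt_rint : rint mu (fun u : RR => kern 1 u * dil_wt u).
Proof.
have h0 : 0 < 4^-1 :> R by rewrite invr_gt0.
have [i _] := pw_atan_int h0.
apply: (rint_le _ (rintZ (64 / pi) i)).
  by apply: measurable_funM; [exact: meas_kern1|exact: meas_dil_wt].
move=> u; rewrite ger0_norm; last by rewrite mulr_ge0 ?kern_ge0 ?dil_wt_ge0.
rewrite /kern ltr01 /=; case: ifP => u0; last by rewrite mul0r mulr0.
have -> : 4^-1 - 1 = - 2^-1 + - 4^-1 :> R by field.
have -> : 2 * 4^-1 = 2^-1 :> R by field.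
rewrite /dil_wt; have e1 : pw (4^-1) u = pw (2^-1) u * pw (- 4^-1) u.
  by rewrite (@pw_mul _ _ (4^-1))//; field.
have e2 : u = pw (2^-1) u * pw (2^-1) u.
  by rewrite (@pw_mul _ _ 1) ?pw1//; field.
rewrite e1 (pwD (- 2^-1) (- 4^-1)).
have v0 := pw_gt0 (2^-1) u; have a0 := pw_gt0 (- 2^-1) u; have b0 := pw_gt0 (- 4^-1) u.
have -> : 1 + u = 1 + pw (2^-1) u * pw (2^-1) u by rewrite -e2.
have p0 := @pi_gt0 R.
move: (pw (2^-1) u) (pw (- 2^-1) u) (pw (- 4^-1) u) (@pi R) v0 a0 b0 p0 => v a b p v0 a0 b0 p0.
have d0 : 0 < 1 + v * v by rewrite addr_gt0// mulr_gt0.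
have d1 : 0 < 1 + v by rewrite addr_gt0.
have -> : (p * (1 + v * v))^-1 * (8 * (a * (v * b + b))) =
   (8 / p * a * b) * ((1 + v) / (1 + v * v)) by field; rewrite !gt_eqF.
have -> : 64 / p * (4^-1 * (a * b) / (1 + v)) = (8 / p * a * b) * (2 / (1 + v)).
  by field; rewrite !gt_eqF.
have c0 : 0 < 8 / p * a * b by rewrite !mulr_gt0// invr_gt0.
rewrite ler_pM2l// ler_pdivrMr// mulrAC ler_pdivlMr//.
have := sqr_ge0 (1 - v); lra.
Qed.

Definition dil_cst : R := RI (fun u : RR => kern 1 u * dil_wt u).

Lemma dil_cst_ge0 : 0 <= dil_cst.
Proof. by apply: Rintegral_ge0 => u _; rewrite mulr_ge0 ?kern_ge0 ?dil_wt_ge0. Qed.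

Definition symbol_fun (nu u : R) : C := (symkern u)%:C%C * expi (nu * ln u).
(** The Mellin transform of the kernel on the critical line, in closed form [1 / cosh (pi nu)]. The
    argument avoids this formula and works with continuity, the value at 0 and decay. *)
Definition symbol (nu : R) : C := cI (symbol_fun nu).

Lemma meas_symkern : meas (fun u : RR => symkern u).
Proof. exact: rint_meas symkern_int.1. Qed.

Lemma symbol_fun_cint nu : cint (symbol_fun nu : RR -> C).
Proof.
apply: (cint_le _ symkern_int.1).
- apply: cmeasM; first by apply: cmeasR; exact: meas_symkern.
  by apply: cmeas_expi; apply: measurable_funM => //; exact: measurable_ln.
- by move=> u; rewrite cabsM cabsR cabs_expi mulr1 ger0_norm ?symkern_ge0.
Qed.

(** Homogeneity of degree -1 displays T as an average of dilations, with weight [kern 1 u]. *)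
Lemma carleman_scale x s : 0 < s ->
  cint (fun u => (kern 1 u)%:C%C * x (s * u)) /\
  carleman x s = cI (fun u => (kern 1 u)%:C%C * x (s * u)).
Proof.
move=> s0; have E : (fun u => (kern 1 u)%:C%C * x (s * u)) =
    fun u => s%:C%C * ((kern s (s * u))%:C%C * x (s * u)).
  apply/funext => u; rewrite mulrA -rmorphM; congr ((_)%:C%C * _).
  rewrite /kern ltr01 s0 pmulr_rgt0//=; case: ifP => u0; last by rewrite mulr0.
  have p0 := @pi_gt0 R.
  have u1 : 1 + u != 0 by rewrite gt_eqF// addr_gt0.
  have su : s + s * u != 0 by rewrite gt_eqF// addr_gt0// mulr_gt0.
  move: (@pi R) p0 => p p0; field.
  by rewrite ?u1 ?su ?gt_eqF.
have i := carleman_cint x s.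
have i' : cint (fun u => (kern s (s * u))%:C%C * x (s * u)).
  by case: i => i1 i2; split; [exact: (rint_scale s0 i1)|exact: (rint_scale s0 i2)].
rewrite E; split; first exact: cintZ.
by rewrite (cIZ _ i') -[carleman x s]/(carleman_fun x s) /carleman_fun (cI_scale s0 i).
Qed.

(** The pointwise estimate [eigfun_dilate] for the dilation by [u], averaged with weight [kern 1 u];
    the errors integrate to [eps * dil_cst]. *)
Lemma carleman_approx nu eps (e0 : 0 < eps) : eps <= 8^-1 ->
  hnorm (carleman (eigH nu e0) - symbol nu *: eigH nu e0) <= eps * dil_cst * hnorm (eigH nu e0).
Proof.
move=> e8; have e08 : 0 <= eps <= 8^-1 by rewrite ltW.
set x := eigH nu e0.
apply: hnorm_pointwise; first by rewrite mulr_ge0 ?dil_cst_ge0// ltW.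
move=> s; have [s0|s0] := ltP 0 s; last first.
  by rewrite (H_pos _ s0) cabs0 mulr_ge0 ?cabs_ge0// mulr_ge0 ?dil_cst_ge0// ltW.
have [i E] := carleman_scale x s0.
have ig := symbol_fun_cint nu.
have D : (carleman x - symbol nu *: x) s = cI (fun u => (kern 1 u)%:C%C * x (s * u) + (- x s) * symbol_fun nu u).
  rewrite HDE HNE HZE E (cID i (cintZ _ ig)) (cIZ _ ig) -/(symbol nu); ring.
rewrite D; have iw : rint mu (fun u => eps * cabs (x s) * (kern 1 u * dil_wt u)).
  by apply: rintZ; exact: kern_dil_wt_rint.
apply: (@le_trans _ _ (RI (fun u => eps * cabs (x s) * (kern 1 u * dil_wt u)))); last first.
  by rewrite (RIZ _ kern_dil_wt_rint) -/dil_cst mulrAC.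
apply: cI_abs => //; first by apply: (cintD i); exact: cintZ.
move=> u; rewrite /symbol_fun /symkern; have [u0|u0] := ltP 0 u; last first.
  have -> : kern 1 u = 0 by rewrite /kern [0 < u]ltNge u0 andbF.
  by rewrite [0 * pw _ _]mul0r [0 * dil_wt u]mul0r rmorph0 !mul0r !mulr0 addr0 cabs0.
have -> : (kern 1 u)%:C%C * x (s * u) + - x s * ((kern 1 u * pw (- 2^-1) u)%:C%C * expi (nu * ln u)) =
  (kern 1 u)%:C%C * (x (u * s) - (pw (- 2^-1) u)%:C%C * expi (nu * ln u) * x s).
  by rewrite [s * u]mulrC rmorphM; ring.
rewrite cabsM cabsR (ger0_norm (kern_ge0 _ _)).
have -> : eps * cabs (x s) * (kern 1 u * dil_wt u) = kern 1 u * (eps * dil_wt u * cabs (x s)) by ring.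
by apply: ler_wpM2l; [exact: kern_ge0|exact: eigfun_dilate].
Qed.

Lemma dilate_approx nu eps (e0 : 0 < eps) (c : R) (c0 : 0 < c) : eps <= 8^-1 ->
  hnorm (dilate c0 (eigH nu e0) - ((pw (- 2^-1) c)%:C%C * expi (nu * ln c)) *: eigH nu e0) <=
  eps * dil_wt c * hnorm (eigH nu e0).
Proof.
move=> e8; have e08 : 0 <= eps <= 8^-1 by rewrite ltW.
apply: hnorm_pointwise; first by rewrite mulr_ge0 ?dil_wt_ge0// ltW.
by move=> t; rewrite HDE HNE HZE; exact: eigfun_dilate.
Qed.

Lemma ipZc (k : C) x y : ip (k *: x) y = ip x ((k^*)%C *: y).
Proof. by apply: eq_Rintegral => t _; rewrite !HZE !cE; ring. Qed.

Lemma ipZ_self (k : C) x : ip (k *: x) x = Re k * sqn x.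
Proof.
have i := csqnorm_rint x.
by rewrite sqn_RI -(RIZ _ i); apply: eq_Rintegral => t _; rewrite !HZE !cE /csqnorm; ring.
Qed.

(* The approximate eigenvalues of a self-adjoint operator are real. *)
Lemma symbol_real nu : Im (symbol nu) = 0.
Proof.
have key eps : 0 < eps -> eps <= 8^-1 -> `|Im (symbol nu)| <= eps * dil_cst.
  move=> e0 e8; set x := eigH nu e0; have nx : 0 < hnorm x by exact: eigH_gt0.
  (* Symmetry of T makes this number equal to its own negative. *)
  have z : ip (carleman x) ('i%C *: x) = 0.
    have h1 : ip (carleman x) ('i%C *: x) = ip ('i%C *: carleman x) x by rewrite ipC -carleman_sym carlemanZ.
    have h2 : ip ('i%C *: carleman x) x = - ip (carleman x) ('i%C *: x).
      rewrite ipZc; have -> : ('i^*)%C = - 'i%C :> C by apply: complex_eq => /=; rewrite ?oppr0.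
      by rewrite scaleNr ipNr.
    by move: h1; rewrite h2 => h1; lra.
  have h : ip (symbol nu *: x) ('i%C *: x) = Im (symbol nu) * sqn x.
    rewrite ipC ipZc ipC scalerA ipZ_self; congr (_ * _).
    by rewrite cReM /=; ring.
  have r1 := carleman_approx nu e0 e8; have r2 := ip_CS (carleman x - symbol nu *: x) ('i%C *: x).
  rewrite ipBl z h sub0r normrN normrM (ger0_norm (sqn_ge0 x)) hnormZ -hnorm_sqr in r2.
  have ci : cabs ('i%C : C) = 1 by rewrite /cabs /csqnorm /= expr0n expr1n add0r sqrtr1.
  rewrite ci mul1r in r2; rewrite -(ler_pM2r (exprn_gt0 2 nx)); apply: (le_trans r2).
  by rewrite expr2 mulrA; apply: ler_wpM2r; [exact: hnorm_ge0|exact: r1].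
apply/eqP; rewrite -normr_eq0; apply/eqP; apply: le_all_eq0 => // e e0.
have K0 : 0 < dil_cst + 1 by rewrite ltr_wpDl// dil_cst_ge0.
pose eps := Num.min (8^-1) (e / (dil_cst + 1)).
have p0 : 0 < eps by rewrite lt_min invr_gt0 ltr0n divr_gt0.
have p8 : eps <= 8^-1 by rewrite ge_min lexx.
have pe : eps <= e / (dil_cst + 1) by rewrite ge_min lexx orbT.
apply: (le_trans (key eps p0 p8)); rewrite ler_pdivlMr// in pe.
by apply: le_trans pe; apply: ler_wpM2l; [exact: ltW|rewrite lerDl].
Qed.

Lemma cos_lip (a b : R) : `|cos a - cos b| <= `|a - b|.
Proof.
wlog ab : a b / b <= a.
  by move=> h; have [/h//|/ltW/h] := leP b a; rewrite distrC [leRHS]distrC.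
have [] := @MVT_segment _ cos (fun r => - sin r) b a ab.
  by apply: continuous_subspaceT => r; exact: continuous_cos.
by move=> c _ ->; rewrite normrM normrN ler_piMl// sin_max.
Qed.

Definition symbolR (nu : R) : R := RI (fun u : RR => symkern u * cos (nu * ln u)).

Lemma symbolRE nu : symbol nu = (symbolR nu)%:C%C.
Proof.
apply: complex_eq; last exact: symbol_real.
by apply: eq_Rintegral => u _; rewrite /symbol_fun cReMl.
Qed.

Lemma symbolR_rint nu : rint mu (fun u : RR => symkern u * cos (nu * ln u)).
Proof. by have := (symbol_fun_cint nu).1; congr (rint _ _); apply/funext => u; rewrite /symbol_fun cReMl. Qed.

Lemma symbolR0 : symbolR 0 = 1.
Proof.
by rewrite -symkern_int.2; apply: eq_Rintegral => u _; rewrite mul0r cos0 mulr1.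
Qed.

Lemma symbolR_lip nu nu' : `|symbolR nu - symbolR nu'| <= dil_cst * `|nu - nu'|.
Proof.
have -> : symbolR nu - symbolR nu' = RI (fun u : RR => symkern u * cos (nu * ln u) - symkern u * cos (nu' * ln u)).
  by rewrite (RintegralB measurableT (symbolR_rint nu) (symbolR_rint nu')).
rewrite mulrC /dil_cst -(RIZ _ kern_dil_wt_rint); apply: RI_le_abs.
- by apply: rintB; exact: symbolR_rint.
- by apply: rintZ; exact: kern_dil_wt_rint.
move=> u; rewrite -mulrBr normrM (ger0_norm (symkern_ge0 _)) /symkern [leRHS]mulrCA -mulrA.
apply: ler_wpM2l; first exact: kern_ge0.
(* The logarithm is absorbed by the exponential already present in [dil_wt], so the same integral
   serves as Lipschitz constant. *)
have h : `|cos (nu * ln u) - cos (nu' * ln u)| <= `|nu - nu'| * (4 * expR (`|ln u| / 4)).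
  apply: (le_trans (cos_lip _ _)); rewrite -mulrBl normrM; apply: ler_wpM2l => //.
  exact: abs_le_expR.
have p0 := pw_gt0 (- 2^-1) u.
apply: (le_trans (ler_wpM2l (ltW p0) h)); rewrite mulrCA; apply: ler_wpM2l => //.
apply: (le_trans _ (dil_wt_lb u)); apply: ler_wpM2l; first exact: ltW.
by apply: ler_wpM2r; [exact: expR_ge0|rewrite ler_nat].
Qed.

Lemma symbolR_cont : continuous symbolR.
Proof.
move=> nu; apply/cvgrPdist_le => e e0.
have K0 : 0 < dil_cst + 1 by rewrite ltr_wpDl// dil_cst_ge0.
near=> nu'; apply: (le_trans (symbolR_lip _ _)).
have h : `|nu - nu'| <= e / (dil_cst + 1).
  near: nu'; apply: cvgr_dist_le; [exact: cvg_id|exact: divr_gt0].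
apply: (le_trans (ler_wpM2l dil_cst_ge0 h)).
rewrite mulrCA ler_piMr ?(ltW e0)// ler_pdivrMr// mul1r lerDl//.
Unshelve. all: by end_near. Qed.

(** For [u > 0] the ratio of [r^2 symkern (r^2 u)] to [symkern u] is [r (1 + u) / (1 + r^2 u)]. It
    is at most [r], and at least [2 - r] because the cleared difference is
    [2 (r - 1) + r u (r - 1)^2]. *)
Lemma symkern_dilate (r u : R) : 1 <= r -> `|symkern u - r ^+ 2 * symkern (r ^+ 2 * u)| <= (r - 1) * symkern u.
Proof.
move=> r1; have r0 : 0 < r by exact: lt_le_trans r1.
have r20 : 0 < r ^+ 2 by rewrite exprn_gt0.
rewrite !symkernE pmulr_rgt0//; case: ifP => u0; last by rewrite !mulr0 subrr normr0.
have -> : pw (- 2^-1) (r ^+ 2 * u) = r^-1 * pw (- 2^-1) u.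
  rewrite pwM//; congr (_ * _).
  by rewrite expr2 pwM// (@pw_mul _ _ (-1)) ?pwN1//; field.
have p0 := pw_gt0 (- 2^-1) u; have q0 := @pi_gt0 R.
move: (pw (- 2^-1) u) (@pi R) p0 q0 => p q' p0 q0.
have d1 : 0 < 1 + u by rewrite addr_gt0.
have d2 : 0 < 1 + r ^+ 2 * u by rewrite addr_gt0// mulr_gt0.
have -> : p / (q' * (1 + u)) - r ^+ 2 * (r^-1 * p / (q' * (1 + r ^+ 2 * u))) =
   (p / (q' * (1 + u))) * (1 - r * (1 + u) / (1 + r ^+ 2 * u)).
  by field; rewrite !gt_eqF.
have c0 : 0 < p / (q' * (1 + u)) by rewrite divr_gt0// mulr_gt0.
rewrite normrM (gtr0_norm c0) mulrC; apply: ler_wpM2r; first exact: ltW.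
rewrite ler_norml; apply/andP; split.
- rewrite opprB lerD2l lerN2 ler_pdivrMr// ler_pM2l// lerD2l.
  by rewrite ler_peMl ?(ltW u0)// expr_ge1// ltW.
- rewrite lerBlDr -lerBlDl ler_pdivlMr//.
  have : 0 <= 2 * (r - 1) + r * u * (r - 1) ^+ 2.
    by rewrite addr_ge0 ?mulr_ge0 ?sqr_ge0 ?subr_ge0// ltW.
  lra.
Qed.

(** The Riemann-Lebesgue trick: dilation by [r^2 = exp (pi / nu)] shifts the phase by pi and flips
    the sign of the cosine. So twice the symbol is the integral of a kernel difference, which
    [symkern_dilate] bounds. *)
Lemma symbolR_decay nu : 0 < nu -> `|symbolR nu| <= 2^-1 * (expR (pi / (2 * nu)) - 1).
Proof.
move=> nu0; set r := expR _.
have r1 : 1 <= r by rewrite -expR0 ler_expR divr_ge0 ?pi_ge0// mulr_ge0// ltW.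
have r0 : 0 < r by exact: expR_gt0.
have r20 : 0 < r ^+ 2 by rewrite exprn_gt0.
have lr : nu * ln (r ^+ 2) = pi.
  by rewrite lnXn// expRK mulr2n; move: (@pi R) => p; field; rewrite gt_eqF.
have i := symbolR_rint nu.
have E : symbolR nu = RI (fun u => - (r ^+ 2 * symkern (r ^+ 2 * u) * cos (nu * ln u))).
  rewrite /symbolR (RI_scale r20 i) -(RIZ _ (rint_scale r20 i)); apply: eq_Rintegral => u _.
  have [u0|u0] := ltP 0 u; last first.
    by rewrite symkernE pmulr_rgt0// ltNge u0/= !(mul0r, mulr0) oppr0.
  by rewrite lnM ?posrE// mulrDr lr [pi + _]addrC cosDpi; ring.
have i2 : rint mu (fun u => - (r ^+ 2 * symkern (r ^+ 2 * u) * cos (nu * ln u))).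
  have -> : (fun u : RR => - (r ^+ 2 * symkern (r ^+ 2 * u) * cos (nu * ln u))) =
     fun u => r ^+ 2 * (symkern (r ^+ 2 * u) * cos (nu * ln (r ^+ 2 * u))).
    apply/funext => u; have [u0|u0] := ltP 0 u; last first.
      by rewrite symkernE pmulr_rgt0// ltNge u0/= !(mul0r, mulr0) oppr0.
    by rewrite lnM ?posrE// mulrDr lr [pi + _]addrC cosDpi; ring.
  by apply: rintZ; exact: (rint_scale r20 i).
have E2 : 2 * symbolR nu = RI (fun u => symkern u * cos (nu * ln u) + - (r ^+ 2 * symkern (r ^+ 2 * u) * cos (nu * ln u))).
  by rewrite (RintegralD measurableT i i2) -E -/(symbolR nu) mulr_natl mulr2n.
have h : `|2 * symbolR nu| <= r - 1.
  have -> : r - 1 = (r - 1) * RI (symkern : RR -> R) by rewrite symkern_int.2 mulr1.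
  rewrite E2 -(RIZ _ symkern_int.1); apply: RI_le_abs.
  - exact: rintD.
  - by apply: rintZ; exact: symkern_int.1.
  move=> u; rewrite -mulrBl normrM; apply: le_trans (symkern_dilate u r1).
  by rewrite ler_piMr// cos_max.
rewrite normrM ger0_norm// in h; lra.
Qed.

Lemma symbolR_surj (v : R) : 0 < v < 1 -> exists nu, 0 < nu /\ symbolR nu = v.
Proof.
move=> /andP[v0 v1].
have l0 : 0 < ln (1 + 2 * v) by rewrite ln_gt0// ltrDl mulr_gt0.
have p0 := @pi_gt0 R.
(* The frequency at which the bound of [symbolR_decay] equals [v]; the intermediate value theorem is
   applied between 0 and it. *)
pose nu1 := pi / (2 * ln (1 + 2 * v)).
have nu1p : 0 < nu1 by rewrite divr_gt0// mulr_gt0.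
have h : symbolR nu1 <= v.
  apply: (le_trans (ler_norm _)); apply: (le_trans (symbolR_decay nu1p)).
  have -> : pi / (2 * nu1) = ln (1 + 2 * v).
    by rewrite /nu1; move: (@pi R) p0 => p p0; field; rewrite !gt_eqF.
  rewrite lnK ?posrE ?addr_gt0 ?mulr_gt0//; lra.
have [||nu] := @IVT _ symbolR 0 nu1 v (ltW nu1p).
- by apply: continuous_subspaceT; exact: symbolR_cont.
- by rewrite symbolR0 ge_min h orbT le_max ltW.
rewrite in_itv /= => /andP[nu0 _] E; exists nu; split=> //.
rewrite lt_def nu0 andbT; apply/eqP => nz; move: E; rewrite nz symbolR0 => E.
by move: v1; rewrite -E ltxx.
Qed.

End Mellin.

(** * The spectrum *)

Section Spectrum.
Variable R : realType.
Local Notation C := R[i].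
Implicit Types x y z u : H R.

Definition not_bounded_below (lam : C) := forall e : R, 0 < e ->
  exists u z, [/\ graphF u z, hnorm u = 1 & hnorm (z - lam *: u) <= e].

(** The gliding hump is applied to the conjugates [p] of unit vectors almost annihilated by
    [F - lam]. If its output [y] were [(F - lam) x], the symmetry of the pairing would move
    [F - lam] onto [hconj p], whence [|ip p y| <= e * hnorm x]; this contradicts the choice of [y]
    for [M = hnorm x]. *)
Lemma not_bounded_below_surj lam : not_bounded_below lam ->
  ~ (forall y, exists x z, graphF x z /\ hnorm (z - lam *: x - y) = 0).
Proof.
move=> nb surj.
have [|y hy] := @gliding_hump R (fun e p => exists z, graphF (hconj p) z /\ hnorm (z - lam *: hconj p) <= e).
  move=> e /nb[u [z [Gu u1 h]]]; exists (hconj u); rewrite hconjK hnorm_hconj; split=> //.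
  by exists z.
have [x [w [Gx hx]]] := surj y.
have [e [p [e0 [z [Gp hz]] hM]]] := hy (hnorm x).
have E : ip p y = ip x (hconj (z - lam *: hconj p)).
  have -> : ip p y = ip p (w - lam *: x) - ip p (w - lam *: x - y) by rewrite [ip p (_ - y)]ipBr opprB addrCA subrr addr0.
  have -> : ip p (w - lam *: x - y) = 0.
    by apply/eqP; rewrite -normr_le0 (le_trans (ip_CS _ _))// hx mulr0.
  have s := graphF_sym Gx Gp; rewrite hconjK in s.
  rewrite subr0 ipBr [ip p w]ipC s hconjB ipBr; congr (_ - _).
  rewrite ipC ipZc; congr (ip x _); apply: H_ext => t.
  by apply: complex_eq; rewrite /= !cE /=; ring.
have := ip_CS x (hconj (z - lam *: hconj p)); rewrite -E hnorm_hconj => h.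
have := lt_le_trans hM h; rewrite mulrC ltNge => /negP[].
by apply: ler_wpM2l => //; exact: hnorm_ge0.
Qed.

Lemma not_bounded_below_closed (lam : C) : (forall d : R, 0 < d ->
  exists lam' : C, cabs (lam' - lam) <= d /\ not_bounded_below lam') -> not_bounded_below lam.
Proof.
move=> h e e0; have e20 : 0 < e / 2 by rewrite divr_gt0.
have [lam' [ll nb]] := h _ e20; have [u [z [Gu u1 hu]]] := nb _ e20.
exists u, z; split=> //.
have -> : z - lam *: u = (z - lam' *: u) + (lam' - lam) *: u.
  by rewrite scalerBl addrA subrK.
apply: (le_trans (hnormD _ _)); rewrite hnormZ u1 mulr1; lra.
Qed.

Lemma hnorm_dilate (a : R) (a0 : 0 < a) x : hnorm (dilate a0 x) = pw (- 2^-1) a * hnorm x.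
Proof.
have p0 := pw_gt0 (- 2^-1) a.
rewrite /hnorm (sqn_dilate a0 x) sqrtrM ?(ltW a0)//.
have -> : Num.sqrt a = pw (2^-1) a.
  have q0 := pw_gt0 (2^-1) a.
  rewrite -[a in LHS](pw1 a0) -(@pw_mul _ (2^-1) (2^-1)); last by field.
  by rewrite -expr2 sqrtr_sqr ger0_norm// ltW.
rewrite mulrA (@pw_mul _ _ _ 0); last by field.
by rewrite /pw mul0r expR0 mul1r.
Qed.

(** The hypothesis fixes only the square of [lam], and both signs of [rho] are covered. The witness
    is the normalized [u = F x + lam x]; its residual is controlled by [carleman_approx], and the
    lower bound [nu_lb] on its norm is the heart of the matter. *)
Lemma approx_eigen (rho : R) : 0 < 4 * rho ^+ 2 < 1 ->
  not_bounded_below (Complex rho rho).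
Proof.
move=> hr; set lam := Complex rho rho.
have rho0 : rho != 0.
  by apply: contraTneq hr => ->; rewrite expr0n mulr0 ltxx.
have L0 : 0 < cabs lam.
  rewrite lt_def cabs_ge0 andbT; apply: contra rho0 => /eqP/cabs_eq0 l0.
  by have := congr1 (@complex.Re R) l0 => /= ->.
have [nu [nu0 gv]] := symbolR_surj hr.
(* Dilation by [a] rotates the phase of [x] by a quarter turn and dilation by [1/a] rotates it back,
   so the factors are [i] and [- i]; after the rescaling by [1/a] in [graphF_dilate] both have
   modulus [b]. *)
pose a : R := expR (pi / (2 * nu)).
have a0 : 0 < a by exact: expR_gt0.
have b0 : 0 < a^-1 by rewrite invr_gt0.
have la : nu * ln a = pi / 2.
  by rewrite expRK; move: (@pi R) => p; field; rewrite gt_eqF.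
have ea : expi (nu * ln a) = 'i%C :> C.
  by rewrite la; apply: complex_eq => /=; rewrite ?cos_pihalf ?sin_pihalf.
have eb : expi (nu * ln a^-1) = - 'i%C :> C.
  by rewrite lnV ?posrE// mulrN la; apply: complex_eq => /=; rewrite ?cosN ?sinN ?cos_pihalf ?sin_pihalf ?oppr0.
pose b := pw (- 2^-1) a; have bp : 0 < b by exact: pw_gt0.
have bE : a^-1 * pw (- 2^-1) a^-1 = b.
  have -> : pw (- 2^-1) a^-1 = pw (2^-1) a by rewrite /pw lnV ?posrE//; congr expR; ring.
  by rewrite -(pwN1 a0) (@pw_mul _ _ _ (- 2^-1))//; field.
(* The total of the dilation errors per unit of [eps]: the first passes through F, of norm at most
   2, and the second is scaled by [lam / a]. *)
pose M := 2 * dil_wt a + a^-1 * cabs lam * dil_wt a^-1.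
have M0 : 0 <= M.
  apply: addr_ge0; first by apply: mulr_ge0 => //; exact: dil_wt_ge0.
  apply: mulr_ge0; last exact: dil_wt_ge0.
  by apply: mulr_ge0; [exact: ltW|exact: cabs_ge0].
move=> e e0.
have K0 := dil_cst_ge0 R.
have K1' : 0 < dil_cst R + 1 by rewrite ltr_wpDl.
have M1' : 0 < M + 1 by rewrite ltr_wpDl.
(* The three bounds serve the dilation estimate, the size of the residual relative to [e], and the
   contradiction in [nu_lb]. *)
pose eps := Num.min (8^-1) (Num.min (e * cabs lam / (dil_cst R + 1)) (b * cabs lam / (M + 1))).
have p0 : 0 < eps.
  by rewrite !lt_min invr_gt0 ltr0n /= !divr_gt0// mulr_gt0.
have p8 : eps <= 8^-1 by rewrite ge_min lexx.
have pe : eps * dil_cst R <= e * cabs lam.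
  have : eps <= e * cabs lam / (dil_cst R + 1) by rewrite !ge_min lexx orbT.
  rewrite ler_pdivlMr//; apply: le_trans; apply: ler_wpM2l; [exact: ltW|by rewrite lerDl].
have pM : eps * M < b * cabs lam.
  have : eps <= b * cabs lam / (M + 1) by rewrite !ge_min lexx !orbT.
  rewrite ler_pdivlMr//; apply: lt_le_trans; by rewrite ltr_pM2l// ltrDl.
pose x := eigH nu p0; have nx : 0 < hnorm x by exact: eigH_gt0.
have [y Gx] := graphF_total x; have [w Gy] := graphF_total y.
pose u := y + lam *: x; pose z := w + lam *: y.
have Gu : graphF u z by exact: graphF_lin.
have hz : hnorm (z - lam *: u) <= 2^-1 * (eps * dil_cst R * hnorm x).
  have h2 := graphF_sq Gx Gy.
  have -> : z - lam *: u = (w - ('i%C / 2%:R) *: carleman x) + ('i%C / 2%:R) *: (carleman x - symbol nu *: x).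
    have E : 'i%C / 2%:R * symbol nu = lam ^+ 2.
      by rewrite symbolRE gv /lam; apply: complex_eq; rewrite expr2 !cE /=; field.
    rewrite /z /u; apply: H_ext => t; rewrite !HE.
    move: (w t) (y t) (x t) (carleman x t) => w' y' x' t'.
    have -> : w' - 'i%C / 2%:R * t' + 'i%C / 2%:R * (t' - symbol nu * x') = w' - ('i%C / 2%:R * symbol nu) * x' by ring.
    by rewrite E; ring.
  apply: (le_trans (hnormD _ _)); rewrite h2 add0r hnormZ.
  have -> : cabs ('i%C / 2%:R : C) = 2^-1.
    rewrite cabsM; have -> : (2%:R^-1 : C) = (2^-1)%:C%C by rewrite fmorphV rmorph_nat.
    by rewrite cabsR cabs_i mul1r ger0_norm// invr_ge0.
  by apply: ler_wpM2l; [rewrite invr_ge0|exact: carleman_approx].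
have nu_lb : cabs lam / 2 * hnorm x <= hnorm u.
  rewrite leNgt; apply/negP => small.
  pose P := (a^-1)%:C%C *: dilate b0 y.
  have S1 : hnorm (P - (b%:C%C * 'i%C) *: y) <= 2 * (eps * dil_wt a * hnorm x).
    apply: (le_trans (graphF_le (graphFB (graphF_dilate a0 b0 Gx) (graphFZ (b%:C%C * 'i%C) Gx)))).
    apply: ler_wpM2l => //; rewrite -ea; exact: dilate_approx.
  have S2 : hnorm (P + ((a^-1)%:C%C * lam) *: dilate b0 x) = b * hnorm u.
    have -> : P + ((a^-1)%:C%C * lam) *: dilate b0 x = (a^-1)%:C%C *: dilate b0 u.
      by apply: H_ext => t; rewrite /P !HE /= /u; ring.
    by rewrite hnormZ cabsR (ger0_norm (ltW b0)) hnorm_dilate mulrA bE.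
  have S3 : hnorm (((a^-1)%:C%C * lam) *: dilate b0 x + (b%:C%C * 'i%C * lam) *: x) <=
      a^-1 * cabs lam * (eps * dil_wt a^-1 * hnorm x).
    have -> : ((a^-1)%:C%C * lam) *: dilate b0 x + (b%:C%C * 'i%C * lam) *: x =
      ((a^-1)%:C%C * lam) *: (dilate b0 x - ((pw (- 2^-1) a^-1)%:C%C * expi (nu * ln a^-1)) *: x).
      rewrite eb -bE rmorphM; apply: H_ext => t; rewrite !HE.
      move: (dilate b0 x t) (x t) => d x'; ring.
    rewrite hnormZ cabsM cabsR (ger0_norm (ltW b0)).
    apply: ler_wpM2l; first by rewrite mulr_ge0 ?cabs_ge0// ltW.
    exact: dilate_approx.
  have S4 : hnorm ((b%:C%C * 'i%C) *: u) = b * hnorm u.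
    rewrite hnormZ cabsM cabsR (ger0_norm (ltW bp)).
    by rewrite cabs_i mulr1.
  (* The two quarter turns have opposite signs, so the [lam x] contributions add up instead of
     cancelling. Of the four terms, two have norm [b * hnorm u] and two are dilation errors; if [u]
     were small, [2 b |lam| |x|] could not be reached. *)
  have E : (2%:C%C * (b%:C%C * 'i%C * lam)) *: x =
     ((b%:C%C * 'i%C) *: u + (P - (b%:C%C * 'i%C) *: y)) +
     ((((a^-1)%:C%C * lam) *: dilate b0 x + (b%:C%C * 'i%C * lam) *: x) -
      (P + ((a^-1)%:C%C * lam) *: dilate b0 x)).
    apply: H_ext => t; rewrite /u !HE; move: (P t) (dilate b0 x t) (x t) (y t) => P' d x' y'.
    have -> : 2%:C%C = 1 + 1 :> C by apply: complex_eq => /=; rewrite ?addr0.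
    ring.
  have S5 : hnorm ((2%:C%C * (b%:C%C * 'i%C * lam)) *: x) = 2 * b * cabs lam * hnorm x.
    rewrite hnormZ !cabsM !cabsR (ger0_norm (ltW bp)) ger0_norm//.
    by rewrite cabs_i mulr1 !mulrA.
  have := hnormD ((b%:C%C * 'i%C) *: u + (P - (b%:C%C * 'i%C) *: y))
     ((((a^-1)%:C%C * lam) *: dilate b0 x + (b%:C%C * 'i%C * lam) *: x) -
      (P + ((a^-1)%:C%C * lam) *: dilate b0 x)).
  rewrite -E S5.
  have := hnormD ((b%:C%C * 'i%C) *: u) (P - (b%:C%C * 'i%C) *: y); rewrite S4.
  have := hnormB (((a^-1)%:C%C * lam) *: dilate b0 x + (b%:C%C * 'i%C * lam) *: x)
    (P + ((a^-1)%:C%C * lam) *: dilate b0 x); rewrite S2.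
  have S6 : b * hnorm u < b * (cabs lam / 2 * hnorm x) by rewrite ltr_pM2l.
  have S7 : eps * M * hnorm x < b * cabs lam * hnorm x by rewrite ltr_pM2r.
  have S8 : eps * M * hnorm x = 2 * (eps * dil_wt a * hnorm x) + a^-1 * cabs lam * (eps * dil_wt a^-1 * hnorm x).
    by rewrite /M; ring.
  rewrite S8 in S7.
  have S9 : b * (cabs lam / 2 * hnorm x) = 2^-1 * (b * cabs lam * hnorm x) by ring.
  rewrite S9 in S6.
  have S10 : 2 * b * cabs lam * hnorm x = 2 * (b * cabs lam * hnorm x) by ring.
  rewrite S10.
  move: S1 S3 S6 S7; clear.
  lra.
have nu_gt : 0 < hnorm u by apply: lt_le_trans nu_lb; rewrite mulr_gt0 ?divr_gt0.
have ni : 0 <= (hnorm u)^-1 by rewrite invr_ge0 hnorm_ge0.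
exists (((hnorm u)^-1)%:C%C *: u), (((hnorm u)^-1)%:C%C *: z); split.
- exact: graphFZ.
- by rewrite hnormZ cabsR ger0_norm// mulVf// gt_eqF.
- have -> : ((hnorm u)^-1)%:C%C *: z - lam *: (((hnorm u)^-1)%:C%C *: u) = ((hnorm u)^-1)%:C%C *: (z - lam *: u).
    by rewrite scalerBr !scalerA mulrC.
  rewrite hnormZ cabsR ger0_norm// mulrC ler_pdivrMr//; apply: (le_trans hz).
  have h1 : e * (cabs lam / 2 * hnorm x) <= e * hnorm u by rewrite ler_pM2l.
  apply: le_trans h1; have h2 : eps * dil_cst R * hnorm x <= e * cabs lam * hnorm x by rewrite ler_pM2r.
  have -> : e * (cabs lam / 2 * hnorm x) = 2^-1 * (e * cabs lam * hnorm x) by ring.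
  by rewrite ler_pM2l// invr_gt0.
Qed.

(** Closedness supplies [rho = 0] and [rho = 1/2] or [-1/2], which [approx_eigen] excludes. *)
Lemma segment_not_bounded_below (rho : R) : `|rho| <= 2^-1 -> not_bounded_below (Complex rho rho).
Proof.
move=> hr; apply: not_bounded_below_closed => d d0.
have cab (r : R) : cabs (Complex r r) <= 2 * `|r|.
  apply: cabs_le; first by rewrite mulr_ge0.
  rewrite /csqnorm /= exprMn real_normK ?num_real//; have := sqr_ge0 r; lra.
pose t := Num.min (2^-1) d.
have t0 : 0 < t by rewrite lt_min invr_gt0 ltr0n.
have t1 : t <= 2^-1 by rewrite ge_min lexx.
have td : t <= d by rewrite ge_min lexx orbT.
(* [p] is moved towards 1/4, the midpoint of the interval, so that the open conditions hold. *)
have key (p : R) : 0 <= p <= 2^-1 -> let r := (1 - t) * p + t / 4 in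
    [/\ 0 < r, r < 2^-1 & `|r - p| <= t / 2].
  move=> /andP[p0 p1] r; have h1 : 0 <= t * p by rewrite mulr_ge0// ltW.
  have h2 : 0 <= (1 - t) * (2^-1 - p) by rewrite mulr_ge0 ?subr_ge0//; lra.
  have h3 : 0 <= (1 - t) * p by rewrite mulr_ge0// subr_ge0; lra.
  have h4 : t * p <= t * 2^-1 by rewrite ler_pM2l.
  by rewrite /r ler_norml; split; [lra|lra|apply/andP; split; lra].
have [r [r1 r2 r3]] : exists r : R, [/\ r ^+ 2 != 0, `|r| < 2^-1 & `|r - rho| <= t / 2].
  have [p0|p0] := leP 0 rho.
    rewrite ger0_norm// in hr; have [|h1 h2 h3] := key rho; first by rewrite p0.
    by exists ((1 - t) * rho + t / 4); rewrite sqrf_eq0 (gt_eqF h1) (gtr0_norm h1).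
  rewrite ltr0_norm// in hr; have [|h1 h2 h3] := key (- rho).
    by rewrite oppr_ge0 ltW.
  exists (- ((1 - t) * - rho + t / 4)); rewrite sqrf_eq0 oppr_eq0 (gt_eqF h1) normrN (gtr0_norm h1).
  by split=> //; rewrite -normrN opprD opprK -[rho]opprK -[- - rho]opprK; move: h3; rewrite !opprK.
exists (Complex r r); split.
  apply: (le_trans (cab (r - rho))); lra.
have q0 : 0 < r ^+ 2 by rewrite lt_def r1 sqr_ge0.
have : `|r| ^+ 2 < 2^-1 ^+ 2 by rewrite ltr_pXn2r ?nnegrE// invr_ge0.
have : (2^-1 : R) ^+ 2 = 4^-1 by field.
rewrite real_normK ?num_real// => h1 h2; apply: approx_eigen; apply/andP; split; lra.
Qed.

(** For [m0 = - 2 i lam^2], the condition that [m0] lies in [[0, 1]] reads [Re lam ^ 2 = Im lam ^ 2]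
    and [0 <= 4 Re lam Im lam <= 1]. *)
Lemma spectrum_diag (lam : C) :
  FP_pos_spectrum lam <-> Re lam = Im lam /\ `|Re lam| <= 2^-1.
Proof.
rewrite /FP_pos_spectrum /= resolventE; split=> [h|[e l] [a _]]; last first.
  move: a; apply: not_bounded_below_surj.
  have -> : lam = Complex (Re lam) (Re lam) by apply: complex_eq.
  exact: segment_not_bounded_below.
pose m0 : C := - 2%:R * 'i%C * lam ^+ 2.
have rE : Re m0 = 4 * (Re lam * Im lam).
  by rewrite /m0 expr2 !cE /=; ring.
have iE : Im m0 = - 2 * (Re lam ^+ 2 - Im lam ^+ 2).
  by rewrite /m0 !expr2 !cE /=; ring.
have key : ~ [\/ Im m0 != 0, Re m0 < 0 | 1 < Re m0].
  move=> h0; apply: h; split; first by move=> y; exact: graphF_surj.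
  by move=> x z; exact: graphF_inj.
have i0 : Im m0 = 0 by apply/eqP; apply: contra_notT key => ?; exact: Or31.
have r0 : 0 <= Re m0 by rewrite leNgt; apply/negP => ?; apply: key; exact: Or32.
have r1 : Re m0 <= 1 by rewrite leNgt; apply/negP => ?; apply: key; exact: Or33.
rewrite rE in r0 r1; rewrite iE in i0.
move: (Re lam) (Im lam) i0 r0 r1 => p r i0 r0 r1.
have pr : p = r.
  have : (p - r) * (p + r) = 0 by rewrite -subr_sqr; lra.
  move/eqP; rewrite mulf_eq0 subr_eq0 => /orP[/eqP //|].
  (* On the antidiagonal [Re m0 = - 4 r^2], and nonnegativity leaves only the origin. *)
  rewrite addr_eq0 => /eqP pr; have : r = 0.
    by apply/eqP; rewrite -sqrf_eq0 eq_le sqr_ge0 andbT; rewrite pr in r0; nra.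
  by rewrite pr => ->; rewrite oppr0.
split=> //; rewrite -(@ler_pXn2r _ 2) ?nnegrE// ?invr_ge0//.
rewrite real_normK ?num_real// -pr in r1 *.
have : (2^-1 : R) ^+ 2 = 4^-1 by field.
rewrite expr2; lra.
Qed.

Lemma expi_pi4 : expi (pi / 4) / (Num.sqrt 2)%:C%C = Complex (2^-1) (2^-1) :> C.
Proof.
have p0 := @pi_gt0 R.
have h2 : pi / 2 = pi / 4 + pi / 4 :> R by move: (@pi R) => p; field.
have sc : sin (pi / 4) = cos (pi / 4) :> R.
  by rewrite -[in LHS](addrK (pi / 4) (pi / 4)) -h2 sinB sin_pihalf cos_pihalf mul1r mul0r subr0.
have c0 : 0 <= cos (pi / 4) :> R.
  by apply: cos_ge0_pihalf; move: (@pi R) p0 => p p0; apply/andP; split; lra.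
have c2 : cos (pi / 4) ^+ 2 = 2^-1 :> R.
  have := cos2Dsin2 (pi / 4 : R); rewrite sc; lra.
have s2 : cos (pi / 4) = Num.sqrt 2 / 2 :> R.
  have s0 : 0 <= Num.sqrt 2 / 2 :> R by rewrite divr_ge0 ?sqrtr_ge0.
  apply/eqP; rewrite -(@eqrXn2 _ 2)//; apply/eqP.
  by rewrite c2 expr_div_n sqr_sqrtr//; field.
have sn : Num.sqrt 2 != 0 :> R by rewrite gt_eqF// sqrtr_gt0.
rewrite /expi sc s2 -fmorphV.
by apply: complex_eq; rewrite !cE /=; field.
Qed.

End Spectrum.

Theorem theorem4p4 (R : realType) (lambda : R[i]) :
  @FP_pos_spectrum R lambda <->
  exists tau : R, 0 <= tau <= 1 /\
    lambda = (1 - tau)%:C%C * (- (expi (pi / 4) / (Num.sqrt 2)%:C%C))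
             + tau%:C%C * (expi (pi / 4) / (Num.sqrt 2)%:C%C).
Proof.
rewrite spectrum_diag expi_pi4.
split=> [[e]|[t [/andP[t0 t1] ->]]].
- rewrite ler_norml => /andP[l1 l2].
  (* Since [exp (i pi/4) / sqrt 2 = (1 + i)/2], both coordinates of the point with parameter [tau]
     are [tau - 1/2]. *)
  exists (Re lambda + 2^-1); split; first by apply/andP; split; lra.
  by apply: complex_eq; rewrite !cE /= -?e; field.
- rewrite !cE /=; split; first by ring.
  by rewrite ler_norml; apply/andP; split; lra.
Qed.
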